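(* Let $n\ge 1$. Let $G\subset\widehat{\mathrm{Diff}}(\mathbb{C}^n,0)$ be a nilpotent group. Then $l(G)\le n$. Moreover there exists a unipotent nilpotent subgroup $G$ of $\mathrm{Diff}(\mathbb{C}^n,0)$ such that $l(G)=n$.
   Context: Let $\mathfrak m$ be the maximal ideal of $\mathbb{C}[[x_1,\dots,x_n]]$. $\widehat{\mathrm{Diff}}(\mathbb{C}^n,0)$ is the group, under composition, of formal diffeomorphisms: $n$-tuples $\varphi=(\varphi_1,\dots,\varphi_n)$ with each $\varphi_j\in\mathfrak m$ and invertible linear part $j^1\varphi\in GL(n,\mathbb{C})$. $\mathrm{Diff}(\mathbb{C}^n,0)$ is its subgroup of convergent elements, i.e. germs at $0$ of complex analytic diffeomorphisms of $\mathbb{C}^n$ fixing $0$. An element $\varphi$ is unipotent if $j^1\varphi$ is a unipotent linear map (i.e. $j^1\varphi-Id$ is nilpotent). A subgroup is unipotent if all its elements are unipotent. For a group $G$, the derived series is $G^{(0)}=G$, $G^{(k+1)}=[G^{(k)},G^{(k)}]$, and the soluble length is $l(G)=\min\{k\ge 0: G^{(k)}=\{Id\}\}$ (with $\min\emptyset=\infty$). The descending central series is $\mathcal C^0G=G$, $\mathcal C^{k+1}G=[G,\mathcal C^kG]$; $G$ is nilpotent if $\mathcal C^jG=\{Id\}$ for some $j\ge0$. *)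

(* Defs.v *)
From HB Require Import structures.
From mathcomp Require Import all_boot all_order all_algebra.
(* multinomials must be imported before mathcomp-analysis: the two libraries
   declare the same grammar levels and only this order is accepted. *)
From mathcomp Require Import mpoly.
From mathcomp Require Import complex.
From mathcomp Require Import mathcomp_extra boolp classical_sets.
From mathcomp Require Import reals ereal esum.

Set Implicit Arguments.
Unset Strict Implicit.
Unset Printing Implicit Defensive.

Import Order.TTheory GRing.Theory Num.Theory.

Local Open Scope ring_scope.

Section LowOrder.
Variables (K : fieldType) (n : nat).
Implicit Types (p q : {mpoly K[n]}) (m : 'X_{1..n}).
Implicit Types (lq lr : n.-tuple {mpoly K[n]}).

(* [low k p]: p lies in the k-th power of the ideal of polynomials vanishing
   at the origin. *)
Definition low k p := forall m, (mdeg m < k)%N -> p@_m = 0.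

Lemma low_leq a b p : (a <= b)%N -> low b p -> low a p.
Proof. by move=> ab lp m ma; apply: lp; apply: leq_trans ab. Qed.

Lemma low0 k : low k 0.
Proof. by move=> m _; rewrite mcoeff0. Qed.

Lemma lowD k p q : low k p -> low k q -> low k (p + q).
Proof. by move=> hp hq m mk; rewrite mcoeffD hp// hq// addr0. Qed.

Lemma lowN k p : low k p -> low k (- p).
Proof. by move=> hp m mk; rewrite mcoeffN hp// oppr0. Qed.

Lemma lowZ k c p : low k p -> low k (c *: p).
Proof. by move=> hp m mk; rewrite mcoeffZ hp// mulr0. Qed.

Lemma lowM a b p q : low a p -> low b q -> low (a + b) (p * q).
Proof.
move=> hp hq m mab; rewrite mcoeffM big1// => -[k1 k2] /= /eqP mE.
have dE : mdeg m = (mdeg k1 + mdeg k2)%N by rewrite [in LHS]mE mdegD.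
have [k1a|ak1] := ltnP (mdeg k1) a; first by rewrite hp// mul0r.
rewrite hq ?mulr0// ltnNge; apply/negP => bk2.
by have := leq_add ak1 bk2; rewrite -dE leqNgt mab.
Qed.

Lemma lowX a p k : low a p -> low (a * k) (p ^+ k).
Proof.
move=> hp; elim: k => [|k IH]; first by rewrite muln0.
by rewrite mulnS exprS; apply: lowM.
Qed.

Lemma low_monomial lq m : (forall i, low 1 (tnth lq i)) ->
  low (mdeg m) ('X_[m] \mPo lq).
Proof.
move=> hq; rewrite comp_mpolyX mdegE.
apply: (big_ind2 (fun p k => low k p)) => //; first by move=> ? ? ? ?; apply: lowM.
by move=> i _; rewrite -[X in low X _]mul1n; apply: lowX.
Qed.

Lemma low_comp k p lq : (forall i, low 1 (tnth lq i)) ->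
  low k p -> low k (p \mPo lq).
Proof.
move=> hq hp; rewrite comp_mpolyEX big_seq.
apply: (big_ind (low k)) => [||m]; [exact: low0|exact: lowD|].
rewrite mcoeff_msupp => pm; apply: lowZ.
refine (low_leq _ (low_monomial hq)).
by rewrite leqNgt; apply: contraNN pm => mk; rewrite hp.
Qed.

Lemma low_eqM k p p' q q' : low k (p - p') -> low k (q - q') ->
  low k (p * q - p' * q').
Proof.
move=> hp hq; have -> : p * q - p' * q' = (p - p') * q + p' * (q - q').
  by rewrite mulrBl mulrBr addrA subrK.
by apply: lowD; [rewrite -[k]addn0|rewrite -[k]add0n]; apply: lowM.
Qed.

Lemma low_eqMS k p p' q q' : low 1 q -> low 1 p' ->
  low k (p - p') -> low k (q - q') -> low k.+1 (p * q - p' * q').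
Proof.
move=> q1 p1 hp hq; have -> : p * q - p' * q' = (p - p') * q + p' * (q - q').
  by rewrite mulrBl mulrBr addrA subrK.
by apply: lowD; [rewrite -addn1|rewrite -add1n]; apply: lowM.
Qed.

Lemma low_eq_monomial k lq lq' m :
  (forall i, low k (tnth lq i - tnth lq' i)) ->
  low k (('X_[m] \mPo lq) - ('X_[m] \mPo lq')).
Proof.
move=> hq; rewrite !comp_mpolyX.
elim: (index_enum _) => [|i r IHr].
  by rewrite !big_nil subrr; exact: low0.
rewrite !big_cons; apply: low_eqM => //; elim: (m i) => [|j IH]; first by rewrite subrr; exact: low0.
by rewrite !exprS; apply: low_eqM.
Qed.

Lemma low_eq_comp k p lq lq' :
  (forall i, low k (tnth lq i - tnth lq' i)) ->
  low k ((p \mPo lq) - (p \mPo lq')).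
Proof.
move=> hq; rewrite !comp_mpolyEX -sumrB.
apply: (big_ind (low k)) => [||m _]; [exact: low0|exact: lowD|].
by rewrite -scalerBr; apply/lowZ/low_eq_monomial.
Qed.

Lemma low_eq_compS k p lq lq' : low 2 p ->
  (forall i, low 1 (tnth lq i)) -> (forall i, low 1 (tnth lq' i)) ->
  (forall i, low k (tnth lq i - tnth lq' i)) ->
  low k.+1 ((p \mPo lq) - (p \mPo lq')).
Proof.
move=> hp q1 q1' hq; rewrite !comp_mpolyEX -sumrB big_seq.
apply: (big_ind (low _)) => [||m]; [exact: low0|exact: lowD|].
rewrite mcoeff_msupp -scalerBr => pm; apply: lowZ.
have m2 : (1 < mdeg m)%N.
  by rewrite ltnNge; apply: contraNN pm => mk; rewrite hp.
have [i mi|m0] := pickP (fun i => 0 < m i)%N; last first.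
  move: m2; rewrite mdegE big1// => i _.
  by apply/eqP; rewrite -leqn0 leqNgt m0.
have mE : m = (m - U_(i) + U_(i))%MM.
  by rewrite submK//; rewrite lep1mP -lt0n.
have d1 : (0 < mdeg (m - U_(i)))%N.
  by move: m2; rewrite {1}mE mdegD mdeg1 addn1 ltnS.
rewrite mE mpolyXD !rmorphM/=; apply: low_eqMS.
- by rewrite comp_mpolyXU -tnth_nth.
- by refine (low_leq d1 (low_monomial q1')).
- exact: low_eq_monomial.
- exact: low_eq_monomial.
Qed.

Lemma comp_mpolyA p lq lr : ((p \mPo lq) \mPo lr) =
  (p \mPo [tuple (tnth lq i) \mPo lr | i < n]).
Proof.
rewrite [p \mPo lq]comp_mpolyEX [RHS]comp_mpolyEX raddf_sum/=.
apply: eq_bigr => m _; rewrite comp_mpolyZ; congr (_ *: _).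
rewrite !comp_mpolyX rmorph_prod/=; apply: eq_bigr => i _.
by rewrite rmorphXn/= tnth_mktuple.
Qed.

End LowOrder.

Section FormalSeries.
Variables (K : fieldType) (n : nat).

(* A formal power series in n variables is the family of its coefficients. *)
Definition fseries := 'X_{1..n} -> K.

Implicit Types (f : fseries) (F G H : 'I_n -> fseries) (m : 'X_{1..n}).
Implicit Types (p : {mpoly K[n]}) (lq : n.-tuple {mpoly K[n]}).

Definition fs_trunc (N : nat) f : {mpoly K[n]} :=
  \sum_(m : 'X_{1..n < N.+1}) f m *: 'X_[m].

Definition fs_truncs (N : nat) F : n.-tuple {mpoly K[n]} :=
  [tuple fs_trunc N (F j) | j < n].

(* Coefficient of x^m in f(F_1(x), ..., F_n(x)). As the F_j are meant to have
   no constant term, the terms of f and of the F_j of degree > |m| do not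
   contribute to it (see fs_compE), so that it can be read off the polynomial
   obtained by composing the truncations at degree |m|. *)
Definition fs_comp f F : fseries := fun m =>
  (fs_trunc (mdeg m) f \mPo fs_truncs (mdeg m) F)@_m.

Definition fs_var (j : 'I_n) : fseries := fun m => (m == U_(j)%MM)%:R.

Definition linear_part F : 'M[K]_n := \matrix_(i, j) F i U_(j)%MM.

Definition approx N p f := forall m, (mdeg m <= N)%N -> p@_m = f m.

Lemma fs_truncK N f : approx N (fs_trunc N f) f.
Proof. by move=> m mN; rewrite mcoeff_mpoly. Qed.

Lemma fs_truncsK N F i : approx N (tnth (fs_truncs N F) i) (F i).
Proof. by rewrite tnth_mktuple; exact: fs_truncK. Qed.

Arguments fs_truncK : clear implicits.
Arguments fs_truncsK : clear implicits.

Lemma approx_leq M N p f : (M <= N)%N -> approx N p f -> approx M p f.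
Proof. by move=> MN h m mM; apply/h/(leq_trans mM). Qed.

Lemma approx_low N p q f : approx N p f -> approx N q f -> low N.+1 (p - q).
Proof. by move=> hp hq m mN; rewrite mcoeffB hp// hq// subrr. Qed.

Lemma approx_low1 N p f : approx N p f -> f 0%MM = 0 -> low 1 p.
Proof.
move=> h f0 m; rewrite ltnS leqn0 => m0; rewrite h ?(eqP m0)//.
by move: m0; rewrite mdeg_eq0 => /eqP ->.
Qed.

Lemma fs_compE N p f lq F : approx N p f ->
  (forall i, approx N (tnth lq i) (F i)) -> (forall i, F i 0%MM = 0) ->
  approx N (p \mPo lq) (fs_comp f F).
Proof.
move=> hp hq F0 m mN; rewrite /fs_comp.
set t := fs_trunc _ _; set lt := fs_truncs _ _.
apply/eqP; rewrite -subr_eq0 -mcoeffB; apply/eqP.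
have -> : (p \mPo lq) - (t \mPo lt) =
    ((p - t) \mPo lq) + ((t \mPo lq) - (t \mPo lt)).
  by rewrite comp_mpolyB addrA subrK.
suff: low (mdeg m).+1 (((p - t) \mPo lq) + ((t \mPo lq) - (t \mPo lt))).
  exact.
apply: lowD.
  apply: low_comp => [i|]; first exact: approx_low1 (hq i) (F0 i).
  by refine (approx_low (approx_leq mN hp) (fs_truncK _ _)).
apply: low_eq_comp => i.
by refine (approx_low (approx_leq mN (hq i)) (fs_truncsK _ _ _)).
Qed.

Lemma eq_fs_comp N f F G : (forall i, F i 0%MM = 0) ->
  (forall i m, (mdeg m <= N)%N -> F i m = G i m) ->
  forall m, (mdeg m <= N)%N -> fs_comp f F m = fs_comp f G m.
Proof.
move=> F0 FG m mN; have G0 i : G i 0%MM = 0 by rewrite -FG ?mdeg0.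
rewrite -(fs_compE (fs_truncK N f) (fs_truncsK N G) G0)//.
rewrite -(fs_compE (fs_truncK N f) (lq := fs_truncs N G) _ F0)// => i k kN.
by rewrite fs_truncsK// FG.
Qed.

Lemma fs_comp_const f F : f 0%MM = 0 -> fs_comp f F 0%MM = 0.
Proof.
move=> f0; rewrite /fs_comp mdeg0.
have h : low 1 (fs_trunc 0 f) by apply: approx_low1 (fs_truncK _ _) f0.
have -> : fs_trunc 0 f = 0.
  rewrite /fs_trunc big1// => -[m /= m1] _.
  have : mdeg m == 0%N by rewrite -leqn0 -ltnS.
  by rewrite mdeg_eq0 => /eqP ->; rewrite f0 scale0r.
by rewrite comp_mpoly0 mcoeff0.
Qed.

Lemma fs_comp_var f : fs_comp f fs_var = f.
Proof.
apply/funext => m.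
rewrite -(@fs_compE (mdeg m) (fs_trunc (mdeg m) f) f
  [tuple 'X_i | i < n] fs_var (fs_truncK _ _))//.
- by rewrite comp_mpoly_id fs_truncK.
- by move=> i k _; rewrite tnth_mktuple mcoeffX eq_sym.
- by move=> i; rewrite /fs_var eq_sym mnm1_eq0.
Qed.

Lemma fs_var_comp i F : (forall i, F i 0%MM = 0) -> fs_comp (fs_var i) F = F i.
Proof.
move=> F0; apply/funext => m.
rewrite -(@fs_compE (mdeg m) 'X_i _ _ _ _ (fs_truncsK _ _))//.
  by rewrite comp_mpolyXU -tnth_nth fs_truncsK.
by move=> k _; rewrite mcoeffX eq_sym.
Qed.

Lemma fs_compA f F G : (forall i, F i 0%MM = 0) -> (forall i, G i 0%MM = 0) ->
  fs_comp (fs_comp f F) G = fs_comp f (fun i => fs_comp (F i) G).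
Proof.
move=> F0 G0; apply/funext => m; set N := mdeg m.
have h1 := fs_compE (fs_truncK N f) (fs_truncsK N F) F0.
rewrite -(fs_compE h1 (fs_truncsK N G) G0)// comp_mpolyA.
refine (@fs_compE N _ _ _ _ (fs_truncK N f) _ _ m _) => // [i|i].
  rewrite tnth_mktuple.
  by refine (fs_compE (fs_truncsK N F i) (fs_truncsK N G) G0).
exact: fs_comp_const.
Qed.

Definition lin_mpoly (a : 'I_n -> K) : {mpoly K[n]} := \sum_k a k *: 'X_k.

Lemma approx_lin f : f 0%MM = 0 ->
  approx 1 (lin_mpoly (fun k => f U_(k)%MM)) f.
Proof.
move=> f0 m; rewrite leq_eqVlt ltnS leqn0 => /orP[/mdeg1P[k /eqP ->]|].
  rewrite raddf_sum/= (bigD1 k)//= big1 => [|l lk].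
    by rewrite mcoeffZ mcoeffXU eqxx mulr1 addr0.
  by rewrite mcoeffZ mcoeffXU (negbTE lk) mulr0.
rewrite mdeg_eq0 => /eqP ->; rewrite f0 raddf_sum/= big1// => k _.
by rewrite mcoeffZ mcoeffX mnm1_eq0 mulr0.
Qed.

Lemma comp_lin_mpoly a lq : (lin_mpoly a \mPo lq) = \sum_k a k *: tnth lq k.
Proof.
rewrite /lin_mpoly raddf_sum/=; apply: eq_bigr => k _.
by rewrite comp_mpolyZ comp_mpolyXU -tnth_nth.
Qed.

Lemma linear_part_comp F G :
  (forall i, F i 0%MM = 0) -> (forall i, G i 0%MM = 0) ->
  linear_part (fun i => fs_comp (F i) G) = linear_part F *m linear_part G.
Proof.
move=> F0 G0; apply/matrixP => i j; rewrite !mxE.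
rewrite -(fs_compE (approx_lin (F0 i)) (fs_truncsK 1 G) G0) ?mdeg1//.
rewrite comp_lin_mpoly raddf_sum/=; apply: eq_bigr => k _.
by rewrite mcoeffZ fs_truncsK ?mdeg1// !mxE.
Qed.

(* Newton-type iteration G <- G + (linear part of F)^-1 (Id - F o G): the k-th
   iterate is a right inverse of F up to terms of degree > k. *)
Fixpoint fs_inv_iter F (k : nat) : 'I_n -> fseries :=
  if k is k'.+1 then fun i m => fs_inv_iter F k' i m
    + \sum_j invmx (linear_part F) i j *
        (fs_var j m - fs_comp (F j) (fs_inv_iter F k') m)
  else fun _ _ => 0.

Definition fs_inv F : 'I_n -> fseries := fun i m => fs_inv_iter F (mdeg m) i m.

Lemma fs_inv_iter0 F k i : (forall i, F i 0%MM = 0) ->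
  fs_inv_iter F k i 0%MM = 0.
Proof.
move=> F0; elim: k i => [//|k IH] i /=.
rewrite IH add0r big1// => j _.
by rewrite fs_comp_const// /fs_var eq_sym mnm1_eq0 subrr mulr0.
Qed.

Lemma fs_inv_iterP F k : (forall i, F i 0%MM = 0) ->
  linear_part F \in unitmx -> forall i m, (mdeg m <= k)%N ->
  fs_comp (F i) (fs_inv_iter F k) m = fs_var i m.
Proof.
move=> F0 Fu; elim: k => [|k IH] i m mk.
  move: mk; rewrite leqn0 mdeg_eq0 => /eqP ->.
  by rewrite fs_comp_const// /fs_var eq_sym mnm1_eq0.
set G := fs_inv_iter F k in IH *; set G' := fs_inv_iter F k.+1.
have G0 j : G j 0%MM = 0 by exact: fs_inv_iter0.
have G'0 j : G' j 0%MM = 0 by exact: fs_inv_iter0.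
have GG' j l : G' j l = G j l + \sum_j' invmx (linear_part F) j j' *
    (fs_var j' l - fs_comp (F j') G l) by [].
pose lq := fs_truncs k.+1 G; pose lq' := fs_truncs k.+1 G'.
pose p := fs_trunc k.+1 (F i).
pose l := lin_mpoly (fun j => F i U_(j)%MM).
have pl : low 2 (p - l).
  by refine (approx_low (approx_leq _ (fs_truncK _ _)) (approx_lin (F0 i))).
have q1 j : low 1 (tnth lq j) by apply: approx_low1 (fs_truncsK _ _ _) (G0 j).
have q1' j : low 1 (tnth lq' j).
  by apply: approx_low1 (fs_truncsK _ _ _) (G'0 j).
have qq j : low k.+1 (tnth lq' j - tnth lq j).
  move=> r rk; rewrite mcoeffB !fs_truncsK ?(ltnW rk)// GG'.
  rewrite big1 ?addr0 ?subrr// => j' _.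
  by rewrite IH// subrr mulr0.
rewrite -(fs_compE (fs_truncK k.+1 (F i)) (fs_truncsK k.+1 G') G'0)//.
rewrite -/p -/lq'.
have := low_eq_compS pl q1' q1 qq; move=> /(_ m); rewrite ltnS => /(_ mk).
rewrite !comp_mpolyB !mcoeffB => /eqP; rewrite subr_eq0.
have := fs_compE (fs_truncK k.+1 (F i)) (fs_truncsK k.+1 G) G0.
rewrite -/p -/lq => /(_ m mk) ->.
rewrite subr_eq => /eqP ->; rewrite !comp_lin_mpoly.
have -> : (\sum_j F i U_(j)%MM *: tnth lq' j)@_m =
  (\sum_j F i U_(j)%MM *: tnth lq j)@_m + (fs_var i m - fs_comp (F i) G m).
  rewrite !raddf_sum/=.
  under eq_bigr do rewrite mcoeffZ fs_truncsK// GG' mulrDr.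
  rewrite big_split/=; congr (_ + _).
    by apply: eq_bigr => j _; rewrite mcoeffZ fs_truncsK.
  under eq_bigr do rewrite mulr_sumr.
  rewrite exchange_big/=.
  have AV := mulmxV Fu.
  rewrite (bigD1 i)//= [X in _ + X]big1 ?addr0 => [|j ji].
    under eq_bigr do rewrite mulrA.
    rewrite -mulr_suml; move/matrixP: AV => /(_ i i); rewrite !mxE eqxx.
    by under eq_bigr do rewrite mxE; move=> ->; rewrite mul1r.
  under eq_bigr do rewrite mulrA.
  rewrite -mulr_suml; move/matrixP: AV => /(_ i j); rewrite !mxE eq_sym.
  rewrite (negbTE ji).
  by under eq_bigr do rewrite mxE; move=> ->; rewrite mul0r.
by rewrite addrA subrK addrC subrK.
Qed.

Lemma fs_inv_iter_stable F k N i m : (forall i, F i 0%MM = 0) ->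
  linear_part F \in unitmx -> (mdeg m <= k)%N -> (k <= N)%N ->
  fs_inv_iter F N i m = fs_inv_iter F k i m.
Proof.
move=> F0 Fu mk; elim: N => [|N IH]; first by rewrite leqn0 => /eqP ->.
rewrite leq_eqVlt => /orP[/eqP -> //|]; rewrite ltnS => kN /=.
rewrite IH// big1 ?addr0// => j _.
by rewrite fs_inv_iterP ?(leq_trans mk)// subrr mulr0.
Qed.

Lemma fs_inv0 F i : (forall i, F i 0%MM = 0) -> fs_inv F i 0%MM = 0.
Proof. by move=> F0; apply: fs_inv_iter0. Qed.

Lemma fs_invP F i : (forall i, F i 0%MM = 0) ->
  linear_part F \in unitmx -> fs_comp (F i) (fs_inv F) = fs_var i.
Proof.
move=> F0 Fu; apply/funext => m; rewrite -(fs_inv_iterP F0 Fu i (leqnn _)).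
refine (@eq_fs_comp (mdeg m) _ _ _ _ _ m (leqnn _)) => [j|j k km].
  exact: fs_inv0.
by rewrite (fs_inv_iter_stable j F0 Fu (leqnn _) km).
Qed.

Lemma linear_part_var : linear_part fs_var = 1%:M.
Proof. by apply/matrixP => i j; rewrite !mxE /fs_var eq_mnm1 eq_sym. Qed.

End FormalSeries.

Section FormalDiffeomorphisms.
Variables (K : fieldType) (n : nat).

HB.instance Definition _ := Choice.copy (fseries K n) ('X_{1..n} -> K).

Definition is_fdiff (F : 'I_n -> fseries K n) : bool :=
  [forall i, F i 0%MM == 0] && (linear_part F \in unitmx).

Record fdiff := FDiff {
  fdiff_val :> 'I_n -> fseries K n;
  fdiffP : is_fdiff fdiff_val
}.

HB.instance Definition _ := [isSub for fdiff_val].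
HB.instance Definition _ := [Choice of fdiff by <:].

Implicit Types F G H : fdiff.

Lemma fdiff0 F i : F i 0%MM = 0.
Proof. by case: F => F /= /andP[/forallP/(_ i)/eqP]. Qed.

Lemma fdiff_unit F : linear_part F \in unitmx.
Proof. by case: F => F /= /andP[]. Qed.

Lemma fdiff_eq F G : (forall i, F i = G i) -> F = G.
Proof. by move=> FG; apply/val_inj/funext. Qed.

Fact fdiff_one_subproof : is_fdiff (@fs_var K n).
Proof.
rewrite /is_fdiff linear_part_var unitmx1 andbT; apply/forallP => i.
by rewrite /fs_var [0%MM == _]eq_sym mnm1_eq0.
Qed.

Fact fdiff_mul_subproof F G : is_fdiff (fun i => fs_comp (F i) G).
Proof.
rewrite /is_fdiff linear_part_comp; [|exact: fdiff0..].
rewrite unitmx_mul !fdiff_unit !andbT; apply/forallP => i.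
by rewrite fs_comp_const// fdiff0.
Qed.

Fact fdiff_inv_subproof F : is_fdiff (fs_inv F).
Proof.
have F0 := fdiff0 F; have Fu := fdiff_unit F.
have I0 i : fs_inv F i 0%MM = 0 by exact: fs_inv0.
apply/andP; split; first by apply/forallP => i; rewrite I0.
have := linear_part_comp F0 I0.
under [in linear_part _]eq_fun do rewrite fs_invP//.
rewrite linear_part_var => /esym/mulmx1_unit; exact: proj2.
Qed.

Definition fdiff_one : fdiff := FDiff fdiff_one_subproof.
Definition fdiff_mul F G : fdiff := FDiff (fdiff_mul_subproof F G).
Definition fdiff_inv F : fdiff := FDiff (fdiff_inv_subproof F).

Fact fdiff_mulA : associative fdiff_mul.
Proof.
by move=> F G H; apply: fdiff_eq => i /=; rewrite fs_compA//; exact: fdiff0.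
Qed.

Fact fdiff_mul1 : left_id fdiff_one fdiff_mul.
Proof.
by move=> F; apply: fdiff_eq => i /=; rewrite fs_var_comp//; exact: fdiff0.
Qed.

Fact fdiff_1mul : right_id fdiff_one fdiff_mul.
Proof. by move=> F; apply: fdiff_eq => i /=; rewrite fs_comp_var. Qed.

Fact fdiff_mulV : right_inverse fdiff_one fdiff_inv fdiff_mul.
Proof.
move=> F; apply: fdiff_eq => i /=.
by rewrite fs_invP ?fdiff_unit//; exact: fdiff0.
Qed.

Fact fdiff_Vmul : left_inverse fdiff_one fdiff_inv fdiff_mul.
Proof.
move=> F; rewrite -[LHS]fdiff_1mul -(fdiff_mulV (fdiff_inv F)) fdiff_mulA.
by rewrite -[in LHS](fdiff_mulA (fdiff_inv F)) fdiff_mulV fdiff_1mul.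
Qed.

HB.instance Definition _ := isGroup.Build fdiff
  fdiff_mulA fdiff_mul1 fdiff_1mul fdiff_Vmul fdiff_mulV.

Definition unipotent F := exists k, (linear_part F - 1) ^+ k = 0.

End FormalDiffeomorphisms.

Section Convergence.
Variables (R : realType) (n : nat).
Local Open Scope classical_set_scope.
Local Open Scope complex_scope.

Definition convergent_fseries (f : fseries R[i] n) :=
  exists2 r : R, 0 < r & forall z : 'I_n -> R[i], (forall i, `|z i| < r%:C) ->
    summable [set: 'X_{1..n}]
      (fun m => (Normc.normc (f m * \prod_i z i ^+ m i))%:E).

(* The image of Diff(C^n, 0) in the group of formal diffeomorphisms. *)
Definition convergent_fdiff : set (fdiff R[i] n) :=
  [set F | forall j, convergent_fseries (F j)].

End Convergence.

Section GroupTheory.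
Variable gT : groupType.
Local Open Scope classical_set_scope.
Local Open Scope group_scope.
Implicit Types G H : set gT.

Definition subgroup G := group_closed (mem G).

Definition commutator_subgroup G H : set gT :=
  smallest subgroup [set [~ x, y] | x in G & y in H].

Definition derived_series G k := iter k (fun H => commutator_subgroup H H) G.

Definition lower_central_series G k := iter k (commutator_subgroup G) G.

Definition nilpotent G := exists j, lower_central_series G j = [set 1].

(* [None] stands for infinite soluble length. *)
Definition soluble_length G : option nat :=
  if pselect (exists k, `[< derived_series G k = [set 1] >]) is left ex
  then Some (ex_minn ex) else None.

End GroupTheory.

(* Main.v *)
Require Import Defs.
From HB Require Import structures.
From mathcomp Require Import all_boot all_order all_algebra.
From mathcomp Require Import mpoly.
From mathcomp Require Import complex.
From mathcomp Require Import generic_quotient fraction finmap.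
From mathcomp Require Import boolp classical_sets reals.
From mathcomp Require Import cardinality fsbigop ereal esum.
From mathcomp Require Import ring.

Set Implicit Arguments.
Unset Strict Implicit.
Unset Printing Implicit Defensive.

Import Order.TTheory GRing.Theory Num.Theory.

(** Upper bound. Let [G] be nilpotent. Formal diffeomorphisms act by substitution on
power series, as automorphisms [star x] that preserve the powers of the maximal ideal.
The entries of the powers of [star x] are exponential polynomials in the exponent;
replacing the eigenvalues by [1] gives a one-parameter group with derivative [fdlog x],
and [star x] is the product of a semisimple operator and of the exponential of the
derivation [fdlog x], which commute. The uniqueness of exponential polynomials makes
this functorial, so that iterated commutators in [G] can be differentiated: the
logarithms generate a nilpotent Lie algebra ([fil_eq0]) which commutes with all the
semisimple parts ([lie_semisimple]). A trace argument in the spirit of Engel's theorem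
shows that its elements are nilpotent modulo each power of the maximal ideal
([lie_nilp]), so that they have exponentials, and these form a group by the
Campbell-Hausdorff formula ([opexp_mul]).

A nilpotent Lie algebra of derivations of a domain, here in [n] variables, has derived
length at most [n]: the spans over the field of fractions of the successive relative
centers strictly increase, and each step costs one term of the derived series
([lie_derived_eq0]). Hence the group of exponentials has derived length at most [n].
Moreover [G] lies in the product of this group and of a commuting nilpotent group
[gamma], whose elements are products of semisimple elements and of central
exponentials ([gamma_jordan]). The derived length of [gamma] is governed by its action
on linear parts: a semisimple element that does not commute with the others has
several eigenvalues, and the commutators preserve its eigenspaces, so that each passage
to the derived group lowers the rank of the spaces to consider
([derived_acts_trivially]). Thus the [n]-th derived group of [gamma] is tangent to the
identity. Its elements are then central, and a central unipotent commutator with a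
semisimple element is trivial ([gamma_derived_trivial]).

Example. Give the variable [x_i] a weight [wt i] and consider the substitutions [x]
tangent to the identity such that, for some constant [a], each [(1 + a x_0) ^ wt i * x_i]
is a polynomial of weight at most [wt i]. They act, up to powers of [1 + a x_0], on
finite-dimensional spaces of polynomials; this shows that they form a group, that it is
nilpotent and that its elements converge. It contains a homography in [x_0] and shears
[x_k |-> x_k + u] by monomials [u]. Commutators of the homography with shears, and then
of shears with each other, give in the [j]-th derived group the shear of each [x_k],
[k >= j], by a monomial in which [x_1, ..., x_(j - 1)] do not occur; the last of them
adds a power of [x_0] to the last variable ([derived_shear]). *)

(** * Subgroups and commutators *)

Section SetGroups.
Variable gT : groupType.
Local Open Scope classical_set_scope.
Local Open Scope group_scope.
Implicit Types (G H S : set gT) (x y : gT).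

Lemma subgroupP G : subgroup G <->
  [/\ G 1, forall x y, G x -> G y -> G (x * y) & forall x, G x -> G x^-1].
Proof.
split=> [gG|[G1 GM GV]].
  have [/set_mem G1 _] := gG; split => // [x y|x] /mem_set xG.
    by move=> /mem_set yG; apply/set_mem/(group_closedM gG).
  by apply/set_mem/(group_closedV gG).
split; first exact: mem_set.
by move=> x y /set_mem xG /set_mem yG; apply/mem_set/GM/GV.
Qed.

Lemma subgroup1 G : subgroup G -> G 1. Proof. by case/subgroupP. Qed.
Lemma subgroupM G x y : subgroup G -> G x -> G y -> G (x * y).
Proof. by case/subgroupP => _ h _; apply: h. Qed.
Lemma subgroupV G x : subgroup G -> G x -> G x^-1.
Proof. by case/subgroupP => _ _; apply. Qed.

Lemma subgroupR G x y : subgroup G -> G x -> G y -> G [~ x, y].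
Proof. by move=> gG Gx Gy; do ?[apply: subgroupM|apply: subgroupV|done]. Qed.

Lemma commutator_subgroup_subgroup G H : subgroup (commutator_subgroup G H).
Proof.
apply/subgroupP; split => [|x y hx hy|x hx] S [gS sub].
- exact: subgroup1.
- by apply: subgroupM => //; [apply: hx|apply: hy].
- by apply: subgroupV => //; apply: hx.
Qed.

Lemma mem_commutator G H x y : G x -> H y -> commutator_subgroup G H [~ x, y].
Proof. by move=> Gx Hy S [_]; apply; exists x => //; exists y. Qed.

Lemma commutator_subgroup_min G H S : subgroup S ->
  (forall x y, G x -> H y -> S [~ x, y]) -> commutator_subgroup G H `<=` S.
Proof.
by move=> gS h z; apply; split => // _ [x Gx [y Hy <-]]; apply: h.
Qed.

Lemma derived_subgroup G k : subgroup G -> subgroup (derived_series G k).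
Proof. by move=> gG; case: k => // k; apply: commutator_subgroup_subgroup. Qed.

Lemma derived_sub G k : subgroup G -> derived_series G k `<=` G.
Proof.
move=> gG; elim: k => [//|k IH]; apply: commutator_subgroup_min => // x y /IH Gx /IH.
exact: subgroupR.
Qed.

Lemma lower_central_subgroup G k : subgroup G -> subgroup (lower_central_series G k).
Proof. by move=> gG; case: k => // k; apply: commutator_subgroup_subgroup. Qed.

Lemma lower_central_sub G k : subgroup G -> lower_central_series G k `<=` G.
Proof.
move=> gG; elim: k => [//|k IH]; apply: commutator_subgroup_min => // x y Gx /IH.
exact: subgroupR.
Qed.

Lemma set1_subgroup : subgroup [set (1 : gT)].
Proof.
by apply/subgroupP; split=> [//|x y -> ->|x ->]; rewrite /= ?mulg1 ?invg1.
Qed.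

Lemma derived_trivial_leq G j k : (j <= k)%N ->
  derived_series G j = [set 1] -> derived_series G k = [set 1].
Proof.
move=> /subnK <-; elim: (k - j)%N => [//|i IH] /IH e.
rewrite addSn /derived_series /= -/(derived_series G (i + j)) e.
apply/seteqP; split=> [|_ ->]; last first.
  exact: (subgroup1 (commutator_subgroup_subgroup _ _)).
by apply: commutator_subgroup_min => [|x y -> ->]; [exact: set1_subgroup|rewrite commg1].
Qed.

Lemma soluble_length_leP G n : derived_series G n = [set 1] ->
  exists2 l : nat, soluble_length G = Some l & (l <= n)%N.
Proof.
move=> Gn; rewrite /soluble_length; case: pselect => [ex|nex]; last first.
  by case: nex; exists n; exact: asboolT.
case: ex_minnP => m _ hmin; exists m; first by [].
by apply: hmin; exact: asboolT.
Qed.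

Lemma soluble_length_eq G n : derived_series G n = [set 1] ->
  (forall k, (k < n)%N -> derived_series G k <> [set 1]) ->
  soluble_length G = Some n.
Proof.
move=> Gn Gk; rewrite /soluble_length; case: pselect => [ex|nex]; last first.
  by case: nex; exists n; exact: asboolT.
case: ex_minnP => m /asboolP Gm hmin; congr Some; apply/eqP.
rewrite eqn_leq (hmin n (asboolT Gn)) andTb.
by rewrite leqNgt; apply/negP => /Gk; apply.
Qed.

End SetGroups.

Section CommutingSubgroups.
Variable gT : groupType.
Local Open Scope group_scope.
Implicit Types (G H : set gT) (x y z e : gT).

Lemma commg_mul_commute x e y z : commute e x -> commute e y -> commute x z -> commute y z ->
  [~ x * e, y * z] = [~ x, y] * [~ e, z].
Proof.
move=> ex ey xz yz; apply: (mulgI (y * z * (x * e))).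
rewrite -[LHS]commgC.
have -> : y * z * (x * e) = (y * x) * (z * e).
  by rewrite -!mulgA; congr (_ * _); rewrite !mulgA xz.
have -> : x * e * (y * z) = (x * y) * (e * z).
  by rewrite -!mulgA; congr (_ * _); rewrite !mulgA ey.
have cw : commute [~ x, y] (z * e).
  have h u : commute x u -> commute y u -> commute [~ x, y] u.
    move=> xu yu; apply: commute_sym.
    by do ?[apply: commuteM|apply: commuteV]; apply: commute_sym.
  by apply: h; apply: commuteM => //; apply: commute_sym.
transitivity ((y * x * [~ x, y]) * (z * e * [~ e, z])); first by rewrite -!commgC.
rewrite -[LHS]mulgA -[RHS]mulgA; congr (_ * _).
by rewrite [LHS]mulgA cw -[LHS]mulgA.
Qed.

Lemma mulg_insert x y z : x * y * z^-1 * (z * y^-1) = x.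
Proof. by rewrite mulgA mulgVK mulgK. Qed.

Lemma derived_series_add G i j :
  derived_series G (i + j) = derived_series (derived_series G i) j.
Proof. by rewrite /derived_series addnC iterD. Qed.

Lemma lower_central_subset G H i : (H `<=` G)%classic ->
  (lower_central_series H i `<=` lower_central_series G i)%classic.
Proof.
move=> HG; elim: i => [//|i IH].
apply: commutator_subgroup_min => [|x y /HG Gx /IH Gy].
  exact: commutator_subgroup_subgroup.
exact: mem_commutator.
Qed.

Lemma lower_central_trivial_leq G j k x : (j <= k)%N ->
  lower_central_series G j = [set 1]%classic -> lower_central_series G k x -> x = 1.
Proof.
move=> /subnK <- e; elim: (k - j)%N x => [x|i IH x]; first by rewrite e.
apply: (@commutator_subgroup_min _ _ _ [set 1]%classic); first exact: set1_subgroup.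
by move=> y z _ /IH ->; rewrite /= commg1.
Qed.

Section Congruence.
Variables (H : set gT) (R : gT -> gT -> Prop).

(** Left compatibility is asked for multipliers in [H] only: the relevant congruences
compare actions on a subspace which other elements need not preserve. *)
Definition congruence_on := [/\ forall x, R x x, forall x y, R x y -> R y x,
  forall x y z, R x y -> R y z -> R x z,
  forall x y z, R x y -> R (x * z) (y * z) &
  forall x y z, H z -> R x y -> R (z * x) (z * y)].

Hypotheses (gH : subgroup H) (congrR : congruence_on).

Lemma congr_commg x y : H x -> H y -> R [~ x, y] 1 <-> R (x * y) (y * x).
Proof.
move=> Hx Hy; have Hyx : H (y * x) by apply: subgroupM.
have [R1 Rs Rt Rr Rl] := congrR.
rewrite (commgC x y); move: [~ x, y] => w; split=> h.
  by have := Rl _ _ _ Hyx h; rewrite mulg1.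
have := Rl _ _ _ (subgroupV gH Hyx) h.
by rewrite mulgA mulVg mul1g.
Qed.

Lemma congr_kernel_subgroup : subgroup (fun x => H x /\ R x 1).
Proof.
have [R1 Rs Rt Rr Rl] := congrR.
apply/subgroupP; split=> [|x y [Hx ex] [Hy ey]|x [Hx ex]].
- by split; first exact: subgroup1.
- split; first exact: subgroupM.
  by apply: (Rt _ _ _ _ ex); have := Rl _ _ _ Hx ey; rewrite mulg1.
- split; first exact: subgroupV.
  by have := Rl _ _ _ (subgroupV gH Hx) ex; rewrite mulVg mulg1 => /Rs.
Qed.

Lemma congr_centralizer_subgroup a : H a ->
  subgroup (fun x => H x /\ R (x * a) (a * x)).
Proof.
have [R1 Rs Rt Rr Rl] := congrR.
move=> Ha; apply/subgroupP; split=> [|x y [Hx ex] [Hy ey]|x [Hx ex]].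
- by split; [exact: subgroup1|rewrite mul1g mulg1].
- split; first exact: subgroupM.
  have := Rl _ _ _ Hx ey; have := Rr _ _ y ex; rewrite !mulgA => e1 e2.
  exact: Rt e2 e1.
- split; first exact: subgroupV.
  have := Rl _ _ _ (subgroupV gH Hx) (Rr _ _ x^-1 ex).
  have -> : x^-1 * (x * a * x^-1) = a * x^-1 by rewrite !mulgA mulVg mul1g.
  have -> : x^-1 * (a * x * x^-1) = x^-1 * a by rewrite -(mulgA a) mulgV mulg1.
  exact: Rs.
Qed.

(** When [a] commutes with [H] up to elements that commute with [H], the map
[x |-> [~ x, a]] is a morphism to an abelian group modulo the congruence, so that
it kills commutators. *)
Lemma congr_commutator a x y : H a ->
  (forall x y, H x -> H y -> R ([~ x, a] * y) (y * [~ x, a])) ->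
  H x -> H y -> R ([~ x, y] * a) (a * [~ x, y]).
Proof.
have [R1 Rs Rt Rr Rl] := congrR; move=> Ha cen Hx Hy.
have two u v : H u -> H v -> R (u * v * a) (a * (u * v) * ([~ u, a] * [~ v, a])).
  move=> Hu Hv.
  have -> : u * v * a = a * u * ([~ u, a] * v) * [~ v, a].
    move: [~ u, a] [~ v, a] (commgC u a) (commgC v a) => c1 c2 e1 e2.
    by rewrite -mulgA e2 !mulgA e1.
  have -> : a * (u * v) * ([~ u, a] * [~ v, a]) = a * u * (v * [~ u, a]) * [~ v, a].
    by move: [~ u, a] [~ v, a] => c1 c2; rewrite !mulgA.
  by apply/Rr/Rl; [apply: subgroupM|apply: cen].
have Hw : H [~ x, y] by apply: subgroupR.
have xy : x * y = y * x * [~ x, y] by rewrite commgC.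
have e1 := two _ _ Hx Hy; have e2 := two _ _ Hy Hx.
have Hc u : H u -> H [~ u, a] by move=> Hu; apply: subgroupR.
have cc : R ([~ x, a] * [~ y, a]) ([~ y, a] * [~ x, a]) by apply: cen => //; apply: Hc.
have Hyx : H (y * x) by apply: subgroupM.
have := cen _ _ Hx Hw; have := cen _ _ Hy Hw; have := mulKg (y * x).
have := Hc _ Hx; have := Hc _ Hy; move: cc e1 e2 xy Hw.
move: [~ x, y] [~ x, a] [~ y, a] => w c1 c2 cc e1 e2 xy Hw Hc2 Hc1 K cw2 cw1.
have main : R (y * x * (w * a)) (y * x * (a * w)).
  have -> : y * x * (w * a) = x * y * a by rewrite xy mulgA.
  have -> : y * x * (a * w) = y * x * a * w by rewrite mulgA.
  apply: (Rt _ _ _ e1); apply: (Rs); apply: (Rt _ _ _ (Rr _ _ w e2)).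
  have -> : a * (x * y) * (c1 * c2) = a * (y * x) * (w * (c1 * c2)).
    by rewrite xy !mulgA.
  have -> : a * (y * x) * (c2 * c1) * w = a * (y * x) * (c2 * c1 * w) by rewrite -[LHS]mulgA.
  apply: (Rl); first exact: subgroupM.
  apply: (Rt _ _ _ (Rr _ _ w (Rs _ _ cc))).
  have -> : c1 * c2 * w = c1 * (c2 * w) by rewrite mulgA.
  apply: (Rt _ _ _ (Rl _ _ c1 Hc1 cw2)).
  by rewrite !mulgA; apply: Rr.
have := Rl _ _ (y * x)^-1 (subgroupV gH Hyx) main.
by rewrite !K.
Qed.

End Congruence.
End CommutingSubgroups.

Local Open Scope ring_scope.

(** * The ring of formal power series *)

Section SeriesRing.
Variables (K : fieldType) (n : nat).
Local Notation A := (fseries K n).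
Implicit Types (f g h : A) (p q : {mpoly K[n]}).

Definition fs_zero : A := fun _ => 0.
Definition fs_opp f : A := fun m => - f m.
Definition fs_add f g : A := fun m => f m + g m.
Definition fs_one : A := fun m => (m == 0%MM)%:R.
(** Truncating at the degree of the monomial makes the coefficient one of a product of
polynomials. *)
Definition fs_mul f g : A :=
  fun m => (fs_trunc (mdeg m) f * fs_trunc (mdeg m) g)@_m.
Definition fs_scale (c : K) f : A := fun m => c * f m.

Fact fs_addA : associative fs_add.
Proof. by move=> f g h; apply/funext => m; rewrite /fs_add addrA. Qed.
Fact fs_addC : commutative fs_add.
Proof. by move=> f g; apply/funext => m; rewrite /fs_add addrC. Qed.
Fact fs_add0 : left_id fs_zero fs_add.
Proof. by move=> f; apply/funext => m; rewrite /fs_add add0r. Qed.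
Fact fs_addN : left_inverse fs_zero fs_opp fs_add.
Proof. by move=> f; apply/funext => m; rewrite /fs_add addNr. Qed.

HB.instance Definition _ :=
  GRing.isZmodule.Build A fs_addA fs_addC fs_add0 fs_addN.

Lemma fs0E m : (0 : A) m = 0. Proof. by []. Qed.
Lemma fsDE f g m : (f + g) m = f m + g m. Proof. by []. Qed.
Lemma fsNE f m : (- f) m = - f m. Proof. by []. Qed.
Lemma fsBE f g m : (f - g) m = f m - g m. Proof. by []. Qed.

Lemma fs_sumE (I : Type) (r : seq I) (P : pred I) (F : I -> A) m :
  (\sum_(i <- r | P i) F i) m = \sum_(i <- r | P i) F i m.
Proof. by apply: (big_morph (fun f : A => f m)). Qed.

Fact approxMr N p q f g : approx N p f -> approx N q g ->
  approx N (p * q) (fs_mul f g).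
Proof.
move=> hp hq m mN; rewrite /fs_mul; set t := fs_trunc _ f; set u := fs_trunc _ g.
apply/eqP; rewrite -subr_eq0 -mcoeffB; apply/eqP.
suff : low (mdeg m).+1 (p * q - t * u) by apply.
apply: low_eqM; first exact: approx_low (approx_leq mN hp) (@fs_truncK _ _ _ _).
exact: approx_low (approx_leq mN hq) (@fs_truncK _ _ _ _).
Qed.

Lemma approx1 N : approx N (1 : {mpoly K[n]}) fs_one.
Proof. by move=> m _; rewrite mcoeff1. Qed.

Lemma approxD N p q f g : approx N p f -> approx N q g -> approx N (p + q) (f + g).
Proof. by move=> hp hq m mN; rewrite mcoeffD hp ?hq. Qed.

(** A series is determined by its polynomial approximations, so that the ring axioms
transfer from polynomials. *)
Lemma approx_eq f g :
  (forall N, exists2 p, approx N p f & approx N p g) -> f = g.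
Proof.
move=> h; apply/funext => m; have [p pf pg] := h (mdeg m).
by rewrite -pf // -pg.
Qed.

Let tK N f : approx N (fs_trunc N f) f := @fs_truncK _ _ N f.

Fact fs_mulA : associative fs_mul.
Proof.
move=> f g h; apply: approx_eq => N.
exists (fs_trunc N f * (fs_trunc N g * fs_trunc N h)).
  by do 2 ![apply: approxMr => //].
by rewrite mulrA; do 2 ![apply: approxMr => //].
Qed.

Fact fs_mulC : commutative fs_mul.
Proof.
move=> f g; apply: approx_eq => N; exists (fs_trunc N f * fs_trunc N g).
  exact: approxMr.
by rewrite mulrC; exact: approxMr.
Qed.

Fact fs_mul1 : left_id fs_one fs_mul.
Proof.
move=> f; apply: approx_eq => N; exists (1 * fs_trunc N f).
  by apply: approxMr => //; exact: approx1.
by rewrite mul1r.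
Qed.

Fact fs_mulD : left_distributive fs_mul fs_add.
Proof.
move=> f g h; apply: approx_eq => N.
exists ((fs_trunc N f + fs_trunc N g) * fs_trunc N h).
  by apply: approxMr => //; apply: approxD.
by rewrite mulrDl; apply: approxD; apply: approxMr.
Qed.

Fact fs_one_neq0 : fs_one != 0.
Proof.
apply/eqP => /(congr1 (fun f : A => f 0%MM)) /eqP.
by rewrite /fs_one eqxx oner_eq0.
Qed.

HB.instance Definition _ := GRing.Zmodule_isComNzRing.Build A
  fs_mulA fs_mulC fs_mul1 fs_mulD fs_one_neq0.

Fact fs_scaleA a b f : fs_scale a (fs_scale b f) = fs_scale (a * b) f.
Proof. by apply/funext => m; rewrite /fs_scale mulrA. Qed.
Fact fs_scale1 : left_id 1 fs_scale.
Proof. by move=> f; apply/funext => m; rewrite /fs_scale mul1r. Qed.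
Fact fs_scaleDr : right_distributive fs_scale +%R.
Proof. by move=> a f g; apply/funext => m; rewrite /fs_scale fsDE mulrDr. Qed.
Fact fs_scaleDl f : {morph fs_scale^~ f : a b / a + b}.
Proof. by move=> a b; apply/funext => m; rewrite /fs_scale mulrDl. Qed.

HB.instance Definition _ := GRing.Zmodule_isLmodule.Build K A
  fs_scaleA fs_scale1 fs_scaleDr fs_scaleDl.

Lemma fsZE c f m : (c *: f) m = c * f m. Proof. by []. Qed.

Lemma approxZ N c p f : approx N p f -> approx N (c *: p) (c *: f).
Proof. by move=> h m mN; rewrite mcoeffZ h. Qed.

Lemma approxM N p q f g : approx N p f -> approx N q g -> approx N (p * q) (f * g).
Proof. exact: approxMr. Qed.

Fact fs_scaleAl (c : K) f g : c *: (f * g) = (c *: f) * g.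
Proof.
apply: approx_eq => N; exists (c *: (fs_trunc N f * fs_trunc N g)).
  by apply/approxZ/approxM.
by rewrite scalerAl; apply: approxM => //; apply: approxZ.
Qed.

HB.instance Definition _ := GRing.Lmodule_isLalgebra.Build K A fs_scaleAl.

Fact fs_scaleAr (c : K) f g : c *: (f * g) = f * (c *: g).
Proof. by rewrite mulrC scalerAl mulrC. Qed.

HB.instance Definition _ := GRing.Lalgebra_isAlgebra.Build K A fs_scaleAr.

Definition fs_of_mpoly p : A := fun m => p@_m.

Fact fs_of_mpolyZ : linear fs_of_mpoly.
Proof. by move=> c p q; apply/funext => m; rewrite /fs_of_mpoly mcoeffD mcoeffZ. Qed.

HB.instance Definition _ :=
  GRing.isLinear.Build K {mpoly K[n]} A _ fs_of_mpoly fs_of_mpolyZ.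

Lemma approx_of_mpoly N p : approx N p (fs_of_mpoly p). Proof. by []. Qed.

Fact fs_of_mpolyM : monoid_morphism fs_of_mpoly.
Proof.
split=> [|p q]; first by apply/funext => m; rewrite /fs_of_mpoly mcoeff1.
apply: approx_eq => N; exists (p * q); first exact: approx_of_mpoly.
by apply: approxM.
Qed.

HB.instance Definition _ :=
  GRing.isMonoidMorphism.Build {mpoly K[n]} A fs_of_mpoly fs_of_mpolyM.

(** The [k]-th power of the maximal ideal. *)
Definition vanish k f := forall m, (mdeg m < k)%N -> f m = 0.

Lemma vanish0 k : vanish k 0. Proof. by []. Qed.
Lemma vanish_0 f : vanish 0 f. Proof. by []. Qed.
Lemma vanishD k f g : vanish k f -> vanish k g -> vanish k (f + g).
Proof. by move=> hf hg m mk; rewrite fsDE hf ?hg ?addr0. Qed.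
Lemma vanishN k f : vanish k f -> vanish k (- f).
Proof. by move=> hf m mk; rewrite fsNE hf ?oppr0. Qed.
Lemma vanishB k f g : vanish k f -> vanish k g -> vanish k (f - g).
Proof. by move=> hf hg; apply: vanishD => //; apply: vanishN. Qed.
Lemma vanishZ k c f : vanish k f -> vanish k (c *: f).
Proof. by move=> hf m mk; rewrite fsZE hf ?mulr0. Qed.
Lemma vanish_sum k (I : Type) (r : seq I) (P : pred I) (F : I -> A) :
  (forall i, P i -> vanish k (F i)) -> vanish k (\sum_(i <- r | P i) F i).
Proof. by move=> h; elim/big_ind: _ => //; apply: vanishD. Qed.
Lemma vanish_leq j k f : (j <= k)%N -> vanish k f -> vanish j f.
Proof. by move=> jk h m mj; apply: h; apply: leq_trans jk. Qed.

Lemma vanish_eq0 f : (forall k, vanish k f) -> f = 0.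
Proof. by move=> h; apply/funext => m; apply: (h (mdeg m).+1). Qed.

Lemma vanishP k f N : (k <= N.+1)%N -> vanish k f <-> low k (fs_trunc N f).
Proof.
move=> kN; split=> h m mk; last first.
  by rewrite -(tK (N := N)) ?h // -ltnS; apply: leq_trans kN.
by rewrite tK ?h // -ltnS; apply: leq_trans kN.
Qed.

Lemma vanishM a b f g : vanish a f -> vanish b g -> vanish (a + b) (f * g).
Proof.
move=> /(vanishP f (N := (a + b)%N) (leqW (leq_addr _ _))) hf.
move=> /(vanishP g (N := (a + b)%N) (leqW (leq_addl _ _))) hg m mab.
by rewrite -(approxM (@tK (a + b)%N f) (@tK (a + b)%N g)) ?(ltnW mab) // (lowM hf hg).
Qed.

Lemma vanishMr a f g : vanish a f -> vanish a (f * g).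
Proof. by move=> h; rewrite -[a]addn0; apply: vanishM. Qed.
Lemma vanishMl a f g : vanish a g -> vanish a (f * g).
Proof. by move=> h; rewrite mulrC; apply: vanishMr. Qed.

Lemma vanish_trunc N f : vanish N.+1 (f - fs_of_mpoly (fs_trunc N f)).
Proof. by move=> m mN; rewrite fsBE /fs_of_mpoly tK // subrr. Qed.

Lemma vanish1 f : vanish 1 f <-> f 0%MM = 0.
Proof.
split=> [->//|f0 m]; first by rewrite mdeg0.
by rewrite ltnS leqn0 mdeg_eq0 => /eqP ->.
Qed.

End SeriesRing.

Section SeriesDomain.
Variables (K : fieldType) (n : nat).
Local Notation A := (fseries K n).
Implicit Types (f g h : A) (p q : {mpoly K[n]}).

Definition fs_unit : {pred A} := fun f => `[< exists g, g * f = 1 >].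
Definition fs_invr f : A :=
  if pselect (exists g, g * f = 1) is left ex then projT1 (cid ex) else f.

Fact fs_mulVx : {in fs_unit, left_inverse 1 fs_invr *%R}.
Proof.
move=> f /asboolP ex; rewrite /fs_invr.
by case: pselect => // e; case: cid.
Qed.
Fact fs_unitPl f g : g * f = 1 -> fs_unit f.
Proof. by move=> e; apply/asboolP; exists g. Qed.
Fact fs_invr_out : {in [predC fs_unit], fs_invr =1 id}.
Proof.
move=> f; rewrite inE => /asboolP nex; rewrite /fs_invr.
by case: pselect.
Qed.

HB.instance Definition _ := GRing.ComNzRing_hasMulInverse.Build A
  fs_mulVx fs_unitPl fs_invr_out.

Lemma fs_orderP f : f != 0 -> exists2 k, vanish k f &
  exists2 m, mdeg m = k & f m != 0.
Proof.
move=> f0; have ex : exists k, `[< exists2 m, mdeg m = k & f m != 0 >].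
  have [m fm] : exists m, f m != 0.
    apply: contrapT => /forallNP h; case/eqP: f0; apply/funext => m.
    by apply: contrapT => /eqP fm; apply: (h m).
  by exists (mdeg m); apply/asboolP; exists m.
have [k /asboolP hk kmin] := ex_minnP ex; exists k => // m mk.
apply: contrapT => /eqP fm; have := kmin (mdeg m); rewrite leqNgt mk => h.
by have := h (introT (asboolP _) (ex_intro2 _ _ m erefl fm)).
Qed.

Lemma msize_trunc N f : (msize (fs_trunc N f) <= N.+1)%N.
Proof.
rewrite msizeE; apply/bigmax_leqP_seq => m; rewrite mcoeff_msupp => h _.
apply: contraNT h; rewrite -ltnNge => mN; rewrite /fs_trunc raddf_sum /= big1 //.
move=> a _; rewrite mcoeffZ mcoeffX; case: eqP => [e|_]; last by rewrite mulr0.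
by have := bmdeg a; rewrite e => h; have := leq_trans mN h; rewrite ltnn.
Qed.

(** The product of the initial forms of two nonzero series is the initial form of
their product, and polynomials have no zero divisors. *)
Fact fs_integral (f g : A) : f * g = 0 -> (f == 0) || (g == 0).
Proof.
move=> fg; have [//|f0] := eqVneq f 0; have [//|g0] := eqVneq g 0.
have [a va [ma mda fma]] := fs_orderP f0; have [b vb [mb mdb gmb]] := fs_orderP g0.
set t := fs_trunc a f; set u := fs_trunc b g.
have t0 : t != 0.
  apply/eqP => /(congr1 (fun p => p@_ma)); rewrite mcoeff0 => /eqP.
  by rewrite /t fs_truncK ?mda // (negbTE fma).
have u0 : u != 0.
  apply/eqP => /(congr1 (fun p => p@_mb)); rewrite mcoeff0 => /eqP.
  by rewrite /u fs_truncK ?mdb // (negbTE gmb).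
have tu0 : t * u != 0 by rewrite mulf_neq0.
have : msupp (t * u) != [::] by rewrite msupp_eq0.
case e: (msupp _) => [//|m s] _.
have hm : m \in msupp (t * u) by rewrite e mem_head.
have mab : (mdeg m <= a + b)%N.
  rewrite -ltnS; apply: leq_trans (msize_mdeg_lt hm) _.
  rewrite msizeM // -(leq_add2r 1) addn1 prednK.
    by rewrite addn1 -addnS -addSn leq_add ?msize_trunc.
  by rewrite addn_gt0 lt0n mmeasure_poly_eq0 t0.
suff : (t * u)@_m = 0 by move=> h; move: hm; rewrite mcoeff_msupp h eqxx.
have : vanish (a + b).+1 (f * g - fs_of_mpoly (t * u)).
  rewrite rmorphM /=.
  have -> : f * g - fs_of_mpoly t * fs_of_mpoly u =
    (f - fs_of_mpoly t) * g + fs_of_mpoly t * (g - fs_of_mpoly u).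
    by rewrite mulrBl mulrBr addrA subrK.
  apply: vanishD; first by rewrite -addSn; apply: vanishM => //; apply: vanish_trunc.
  rewrite -addnS; apply: vanishM; last exact: vanish_trunc.
  move=> m' m'a; rewrite /fs_of_mpoly fs_truncK ?(ltnW m'a) //; exact: va.
move=> /(_ m); rewrite ltnS => /(_ mab); rewrite fg fsBE fs0E sub0r => /eqP.
by rewrite oppr_eq0 => /eqP.
Qed.

HB.instance Definition _ := GRing.ComUnitRing_isIntegral.Build A fs_integral.

End SeriesDomain.

(** * Filtered operators on power series *)

Section Operators.
Variables (K : fieldType) (n : nat).
Local Notation A := (fseries K n).
Implicit Types (f g h : A) (p q : {mpoly K[n]}).

Definition filtered (T : A -> A) :=
  linear T /\ forall k f, vanish k f -> vanish k (T f).

Record op := Op { op_fun :> A -> A; op_filtered : filtered op_fun }.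

Lemma opP (S T : op) : (forall f, S f = T f) -> S = T.
Proof.
case: S T => [S HS] [T HT] /= e; have {}e : S = T by apply/funext.
by rewrite {}e in HS *; congr Op; apply: Prop_irrelevance.
Qed.

HB.instance Definition _ := gen_eqMixin op.
HB.instance Definition _ := gen_choiceMixin op.

Fact op_linear_subproof (T : op) : linear T. Proof. by case: T => ? []. Qed.
HB.instance Definition _ (T : op) :=
  GRing.isLinear.Build K A A _ T (op_linear_subproof T).

Lemma op_vanish (T : op) k f : vanish k f -> vanish k (T f).
Proof. by move=> fk; have [_ h] := op_filtered T; apply: h. Qed.

Fact op0_subproof : filtered (fun _ => 0).
Proof. by split=> [c f g|k f]; rewrite ?scaler0 ?addr0. Qed.
Definition op0 := Op op0_subproof.
Fact opN_subproof (T : op) : filtered (fun f => - T f).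
Proof.
split=> [c f g|k f h]; last by apply/vanishN/op_vanish.
by rewrite linearP opprD scalerN.
Qed.
Definition opN T := Op (opN_subproof T).
Fact opD_subproof (S T : op) : filtered (fun f => S f + T f).
Proof.
split=> [c f g|k f h]; last by apply: vanishD; apply: op_vanish.
by rewrite !linearP scalerDr addrACA.
Qed.
Definition opD S T := Op (opD_subproof S T).
Fact op1_subproof : filtered id.
Proof. by []. Qed.
Definition op1 := Op op1_subproof.
(** The left factor acts first, so that substitution becomes a morphism from formal
diffeomorphisms to operators and not an antimorphism. *)
Fact opM_subproof (S T : op) : filtered (fun f => T (S f)).
Proof.
split=> [c f g|k f h]; last by do 2 ![apply: op_vanish].
by rewrite !linearP.
Qed.
Definition opM S T := Op (opM_subproof S T).
Fact opZ_subproof (c : K) (T : op) : filtered (fun f => c *: T f).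
Proof.
split=> [d f g|k f h]; last by apply/vanishZ/op_vanish.
by rewrite [T _]linearP scalerDr !scalerA mulrC.
Qed.
Definition opZ c T := Op (opZ_subproof c T).

Fact opDA : associative opD.
Proof. by move=> S T U; apply: opP => f /=; rewrite addrA. Qed.
Fact opDC : commutative opD.
Proof. by move=> S T; apply: opP => f /=; rewrite addrC. Qed.
Fact op0D : left_id op0 opD.
Proof. by move=> S; apply: opP => f /=; rewrite add0r. Qed.
Fact opND : left_inverse op0 opN opD.
Proof. by move=> S; apply: opP => f /=; rewrite addNr. Qed.
HB.instance Definition _ := GRing.isZmodule.Build op opDA opDC op0D opND.

Fact opMA : associative opM.
Proof. by move=> S T U; apply: opP. Qed.
Fact op1M : left_id op1 opM.
Proof. by move=> S; apply: opP. Qed.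
Fact opM1 : right_id op1 opM.
Proof. by move=> S; apply: opP. Qed.
Fact opMDl : left_distributive opM opD.
Proof. by move=> S T U; apply: opP => f /=; rewrite raddfD. Qed.
Fact opMDr : right_distributive opM opD.
Proof. by move=> S T U; apply: opP => f. Qed.
Fact op1_neq0 : op1 != 0.
Proof.
apply/eqP => /(congr1 (fun T : op => T 1)) /= h.
by have := oner_neq0 A; rewrite h eqxx.
Qed.
HB.instance Definition _ := GRing.Zmodule_isNzRing.Build op
  opMA op1M opM1 opMDl opMDr op1_neq0.

Fact opZA a b T : opZ a (opZ b T) = opZ (a * b) T.
Proof. by apply: opP => f /=; rewrite scalerA. Qed.
Fact op1Z : left_id 1 opZ.
Proof. by move=> T; apply: opP => f /=; rewrite scale1r. Qed.
Fact opZDr : right_distributive opZ +%R.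
Proof. by move=> a S T; apply: opP => f /=; rewrite scalerDr. Qed.
Fact opZDl T : {morph opZ^~ T : a b / a + b}.
Proof. by move=> a b; apply: opP => f /=; rewrite scalerDl. Qed.
HB.instance Definition _ := GRing.Zmodule_isLmodule.Build K op opZA op1Z opZDr opZDl.
Fact opZAl (c : K) (S T : op) : c *: (S * T) = (c *: S) * T.
Proof. by apply: opP => f /=; rewrite linearZ. Qed.
HB.instance Definition _ := GRing.Lmodule_isLalgebra.Build K op opZAl.
Fact opZAr (c : K) (S T : op) : c *: (S * T) = S * (c *: T).
Proof. by apply: opP. Qed.
HB.instance Definition _ := GRing.Lalgebra_isAlgebra.Build K op opZAr.

Lemma op0E f : (0 : op) f = 0. Proof. by []. Qed.
Lemma op1E f : (1 : op) f = f. Proof. by []. Qed.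
Lemma opDE (S T : op) f : (S + T) f = S f + T f. Proof. by []. Qed.
Lemma opNE (S : op) f : (- S) f = - S f. Proof. by []. Qed.
Lemma opBE (S T : op) f : (S - T) f = S f - T f. Proof. by []. Qed.
Lemma opZE c (S : op) f : (c *: S) f = c *: S f. Proof. by []. Qed.
Lemma opME (S T : op) f : (S * T) f = T (S f). Proof. by []. Qed.
Lemma op_sumE (I : Type) (r : seq I) (P : pred I) (F : I -> op) f :
  (\sum_(i <- r | P i) F i) f = \sum_(i <- r | P i) F i f.
Proof. by apply: (big_morph (fun T : op => T f)). Qed.
Lemma opXSE (S : op) i f : (S ^+ i.+1) f = S ((S ^+ i) f).
Proof. by rewrite exprSr. Qed.

(** Operators with values in the [k]-th power of the maximal ideal form a
two-sided ideal. *)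
Definition small k (T : op) := forall f, vanish k (T f).

Lemma small0 k : small k 0. Proof. by move=> f. Qed.
Lemma smallD k S T : small k S -> small k T -> small k (S + T).
Proof. by move=> hS hT f; apply: vanishD. Qed.
Lemma smallN k S : small k S -> small k (- S).
Proof. by move=> hS f; apply: vanishN. Qed.
Lemma smallB k S T : small k S -> small k T -> small k (S - T).
Proof. by move=> hS hT f; apply: vanishB. Qed.
Lemma smallZ k c S : small k S -> small k (c *: S).
Proof. by move=> hS f; apply: vanishZ. Qed.
Lemma smallMl k S T : small k T -> small k (S * T).
Proof. by move=> hT f; exact: (hT (S f)). Qed.
Lemma smallMr k S T : small k S -> small k (S * T).
Proof. by move=> hS f; exact: (op_vanish T (hS f)). Qed.
Lemma small_sum k (I : Type) (r : seq I) (P : pred I) (F : I -> op) :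
  (forall i, P i -> small k (F i)) -> small k (\sum_(i <- r | P i) F i).
Proof.
by move=> h; elim/big_ind: _ => // S T; apply: smallD.
Qed.
Lemma small_eq0 T : (forall k, small k T) -> T = 0.
Proof. by move=> h; apply: opP => f; apply: vanish_eq0 => k; apply: h. Qed.
Lemma small_leq j k T : (j <= k)%N -> small k T -> small j T.
Proof. by move=> jk h f; exact: (vanish_leq jk (h f)). Qed.
Lemma smallX_leq k T i j : (i <= j)%N -> small k (T ^+ i) -> small k (T ^+ j).
Proof. by move=> /subnK <- h; rewrite exprD; apply: smallMl. Qed.

(** Filtered operators are continuous for the topology of the maximal ideal. *)
Lemma op_coef (T : op) f m :
  T f m = \sum_(a : 'X_{1..n < (mdeg m).+1}) f a * T (fs_of_mpoly 'X_[a]) m.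
Proof.
have := op_vanish T (@vanish_trunc _ _ (mdeg m) f) (ltnSn _).
rewrite raddfB /= fsBE => /eqP; rewrite subr_eq0 => /eqP ->.
rewrite /fs_trunc linear_sum /= linear_sum fs_sumE; apply: eq_bigr => a _.
by rewrite 2!linearZ.
Qed.

Lemma eq_op_mpoly (S T : op) :
  (forall p, S (fs_of_mpoly p) = T (fs_of_mpoly p)) -> S = T.
Proof.
by move=> h; apply: opP => f; apply/funext => m; rewrite !op_coef; under eq_bigr do rewrite h.
Qed.

End Operators.

(** * Substitutions as operators *)

Section Substitution.
Variables (K : fieldType) (n : nat).
Local Notation A := (fseries K n).
Local Notation op := (op K n).
Implicit Types (f g h : A) (p q : {mpoly K[n]}) (S T : op) (F H : fdiff K n).

Definition multiplicative_op T := T 1 = 1 /\ forall f g, T (f * g) = T f * T g.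

Section Comp.
Variable F : 'I_n -> A.
Hypothesis F0 : forall i, F i 0%MM = 0.
Let tK N f : approx N (fs_trunc N f) f := @fs_truncK _ _ N f.
Let cK N p f : approx N p f -> approx N (p \mPo fs_truncs N F) (fs_comp f F).
Proof. by move=> h; apply: fs_compE h (@fs_truncsK _ _ N F) F0. Qed.

Fact comp_op_subproof : filtered (fun f => fs_comp f F).
Proof.
split=> [c f g|k f fk m mk].
  apply: approx_eq => N; exists ((c *: fs_trunc N f + fs_trunc N g) \mPo fs_truncs N F).
    by apply/cK/approxD => //; apply: approxZ.
  by rewrite comp_mpolyD comp_mpolyZ; apply: approxD; [apply: approxZ|]; apply: cK.
rewrite -(cK (@tK k f)) ?(ltnW mk) //; apply: low_comp mk.
  by move=> i; exact: approx_low1 (@fs_truncsK _ _ k F i) (F0 i).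
exact: (proj1 (vanishP f (leqnSn k)) fk).
Qed.
Definition comp_op : op := Op comp_op_subproof.

Lemma comp_opE f : comp_op f = fs_comp f F. Proof. by []. Qed.

Lemma comp_op_multiplicative : multiplicative_op comp_op.
Proof.
split=> [|f g]; apply: approx_eq => N.
  exists (1 \mPo fs_truncs N F); first by apply: cK; exact: approx1.
  by rewrite rmorph1; exact: approx1.
exists ((fs_trunc N f * fs_trunc N g) \mPo fs_truncs N F).
  by apply: cK; apply: approxM.
by rewrite rmorphM /=; apply: approxM; apply: cK.
Qed.

End Comp.

Lemma fs_of_mpolyX (i : 'I_n) : fs_of_mpoly 'X_i = fs_var K i.
Proof. by apply/funext => m; rewrite /fs_of_mpoly mcoeffX eq_sym. Qed.

Lemma multiplicative_opX T f k : multiplicative_op T -> T (f ^+ k) = T f ^+ k.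
Proof. by case=> T1 TM; elim: k => [|k IH]; rewrite ?expr0 // !exprS TM IH. Qed.

Lemma multiplicative_op_prod T (I : Type) (r : seq I) (P : pred I) (E : I -> A) :
  multiplicative_op T ->
  T (\prod_(i <- r | P i) E i) = \prod_(i <- r | P i) T (E i).
Proof. by case=> T1 TM; apply: big_morph. Qed.

Lemma eq_multiplicative_op S T : multiplicative_op S -> multiplicative_op T ->
  (forall i, S (fs_var K i) = T (fs_var K i)) -> S = T.
Proof.
move=> hS hT e; apply: eq_op_mpoly => p; rewrite (mpolyE p) !linear_sum.
apply: eq_bigr => m _; rewrite /= !linearZ /=; congr (_ *: _).
rewrite mpolyXE_id rmorph_prod /= !multiplicative_op_prod //.
by apply: eq_bigr => i _; rewrite rmorphXn /= fs_of_mpolyX !multiplicative_opX // e.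
Qed.

Lemma fs_var0 (i : 'I_n) : fs_var K i 0%MM = 0.
Proof. by rewrite /fs_var eq_sym mnm1_eq0. Qed.

Lemma vanish_var (i : 'I_n) : vanish 1 (fs_var K i).
Proof. by apply/vanish1; exact: fs_var0. Qed.

Lemma op_var0 T i : T (fs_var K i) 0%MM = 0.
Proof. by apply/vanish1; apply: op_vanish; exact: vanish_var. Qed.

Lemma multiplicative_opE T f : multiplicative_op T ->
  T f = fs_comp f (fun i => T (fs_var K i)).
Proof.
have F0 i : T (fs_var K i) 0%MM = 0 := op_var0 T i.
move=> hT; rewrite -(comp_opE F0); congr (op_fun _ _).
apply: eq_multiplicative_op => // [|i]; first exact: comp_op_multiplicative.
by rewrite comp_opE fs_var_comp.
Qed.

Definition star F : op := comp_op (fdiff0 F).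

Lemma starE F f : star F f = fs_comp f F. Proof. by []. Qed.

Lemma star_var F i : star F (fs_var K i) = F i.
Proof. by rewrite starE fs_var_comp // => j; exact: fdiff0. Qed.

Lemma star_mult F : multiplicative_op (star F).
Proof. exact: comp_op_multiplicative. Qed.

Lemma star1F F : star F 1 = 1. Proof. by case: (star_mult F). Qed.
Lemma starMF F f g : star F (f * g) = star F f * star F g.
Proof. by case: (star_mult F). Qed.

Lemma starM F H : star (F * H)%g = star F * star H.
Proof. by apply: opP => f; rewrite opME !starE fs_compA //; exact: fdiff0. Qed.

Lemma star1 : star 1%g = 1.
Proof. by apply: opP => f; rewrite starE fs_comp_var. Qed.

Lemma star_inj : injective star.
Proof. by move=> F H e; apply: fdiff_eq => i; rewrite -!star_var e. Qed.

Lemma starV F : star F^-1%g * star F = 1.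
Proof. by rewrite -starM mulVg star1. Qed.
Lemma starVr F : star F * star F^-1%g = 1.
Proof. by rewrite -starM mulgV star1. Qed.

Lemma starX F k : star (F ^+ k)%g = star F ^+ k.
Proof.
elim: k => [|k IH]; first by rewrite expg0 star1.
by rewrite expgS starM IH exprS.
Qed.

(** The images of the variables define the diffeomorphism; its linear part is
invertible because the inverse automorphism is also a substitution. *)
Lemma star_surj S T : multiplicative_op S -> multiplicative_op T ->
  S * T = 1 -> exists F, star F = S.
Proof.
move=> hS hT ST; pose F i := S (fs_var K i); pose H i := T (fs_var K i).
have F0 i : F i 0%MM = 0 by exact: op_var0.
have H0 i : H i 0%MM = 0 by exact: op_var0.
have FP : is_fdiff F.
  rewrite /is_fdiff; apply/andP; split; first by apply/forallP => i; rewrite F0.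
  have := linear_part_comp F0 H0.
  have -> : (fun i => fs_comp (F i) H) = @fs_var K n.
    by apply/funext => i; rewrite -multiplicative_opE // -[T _]/((S * T) _) ST.
  by rewrite linear_part_var => /esym/mulmx1_unit[].
exists (FDiff FP); apply: eq_multiplicative_op => // [|i]; first exact: star_mult.
by rewrite star_var.
Qed.

End Substitution.

(** * Exponential polynomials *)

Section ExponentialPolynomials.
Variable K : numFieldType.
Implicit Types (a b : nat -> K) (p q : {poly K}) (s : seq K) (l mu : K).

Let shift p : {poly K} := p \Po ('X + 1%:P).

Let size_shift p : size (shift p) = size p.
Proof. by rewrite size_comp_poly2 // size_XaddC. Qed.

Let lead_shift p : lead_coef (shift p) = lead_coef p.
Proof.
by rewrite lead_coef_comp ?size_XaddC // lead_coefXaddC expr1n mulr1.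
Qed.

Let shiftE p (m : nat) : (shift p).[m%:R] = p.[m.+1%:R].
Proof. by rewrite horner_comp !hornerE -natr1. Qed.

Let coef_shift l mu p :
  (l *: shift p - mu *: p)`_(size p).-1 = (l - mu) * lead_coef p.
Proof.
rewrite coefB !coefZ -{1}size_shift -!lead_coefE lead_shift.
by rewrite mulrBl.
Qed.

Lemma poly_nat_eq0 p : (forall m : nat, p.[m%:R] = 0) -> p = 0.
Proof.
move=> h; apply/eqP; apply: contraT => p0.
have := @max_poly_roots K p [seq i%:R | i <- iota 0 (size p)] p0.
rewrite size_map size_iota ltnn => ->//.
  by apply/allP => x /mapP[i _ ->]; apply/rootP.
by rewrite map_inj_uniq ?iota_uniq // => i j /eqP; rewrite eqr_nat => /eqP.
Qed.

(** The operator [a m |-> a m.+1 - mu * a m] lowers the degree of the polynomial attached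
to [mu] and preserves the leading terms attached to the other bases up to a nonzero
factor, which allows an induction on that degree. *)
Lemma exp_poly_indep s (P : K -> {poly K}) : uniq s -> 0 \notin s ->
  (forall m, \sum_(l <- s) l ^+ m * (P l).[m%:R] = 0) ->
  forall l, l \in s -> P l = 0.
Proof.
elim: s P => [//|mu s IH] P /= /andP[mus us].
rewrite inE negb_or eq_sym => /andP[mu0 s0].
have [d] := ubnP (size (P mu)); elim: d P => // d IHd P; rewrite ltnS => Pd hP.
have fin : (P mu = 0) -> forall l, l \in mu :: s -> P l = 0.
  move=> Pmu; suff hs l : l \in s -> P l = 0.
    by move=> l; rewrite inE => /orP[/eqP -> //|]; apply: hs.
  apply: IH => // m; have := hP m.
  by rewrite big_cons Pmu horner0 mulr0 add0r.
have [/fin //|Pmu0] := eqVneq (P mu) 0.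
pose Q l := l *: shift (P l) - mu *: P l.
have sz : (0 < size (P mu))%N by rewrite lt0n size_poly_eq0.
have Qd : (size (Q mu) < d)%N.
  apply: leq_trans Pd; rewrite -(prednK sz) ltnS; apply/leq_sizeP => j.
  rewrite leq_eqVlt => /orP[/eqP <-|]; first by rewrite coef_shift subrr mul0r.
  rewrite (prednK sz) => hj; apply/leq_sizeP: j hj.
  rewrite (leq_trans (size_polyD _ _)) // geq_max size_polyN.
  by rewrite !(leq_trans (size_scale_leq _ _)) // size_shift.
have hQ m : \sum_(l <- mu :: s) l ^+ m * (Q l).[m%:R] = 0.
  transitivity (\sum_(l <- mu :: s) l ^+ m.+1 * (P l).[m.+1%:R]
     - mu * \sum_(l <- mu :: s) l ^+ m * (P l).[m%:R]); last first.
    by rewrite !hP mulr0 subr0.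
  rewrite mulr_sumr -sumrB; apply: eq_bigr => l _.
  rewrite /Q hornerD hornerN !hornerZ shiftE mulrBr exprSr !mulrA.
  by congr (_ - _); rewrite [l ^+ m * mu]mulrC.
have Q0 := IHd Q Qd hQ.
have Ps l : l \in s -> P l = 0.
  move=> ls; have := Q0 l; rewrite inE ls orbT => /(_ isT) /(congr1 (fun p => p`_(size (P l)).-1)).
  rewrite coef_shift coef0 => /eqP; rewrite mulf_eq0 lead_coef_eq0 subr_eq0.
  by case/orP => /eqP // e; rewrite -e ls in mus.
apply: fin; apply: poly_nat_eq0 => m; have := hP m.
rewrite big_cons big1_seq => [|l /= /Ps ->]; last by rewrite horner0 mulr0.
by rewrite addr0 => /eqP; rewrite mulf_eq0 expf_eq0 (negbTE mu0) andbF => /eqP.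
Qed.

(** [spec a p]: the sequence [a] is the exponential polynomial
[m |-> \sum l ^+ m * q_l.[m]], and [p = \sum q_l] is what remains of it when
all the bases [l] are replaced by [1]. *)
Definition spec a p := exists e : seq (K * {poly K}),
  [/\ all (fun x => x.1 != 0) e,
      forall m, a m = \sum_(x <- e) x.1 ^+ m * x.2.[m%:R]
    & p = \sum_(x <- e) x.2].

Lemma spec_ext a b p : spec a p -> (forall m, a m = b m) -> spec b p.
Proof. by move=> [l [? h ?]] e; exists l; split => // m; rewrite -e. Qed.

Lemma spec_geom l q : l != 0 -> spec (fun m => l ^+ m * q.[m%:R]) q.
Proof. by move=> l0; exists [:: (l, q)]; split=> /= [|m|]; rewrite ?l0 // big_seq1. Qed.

Lemma spec_const c : spec (fun _ => c) c%:P.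
Proof.
by apply: spec_ext (spec_geom _ (oner_neq0 K)) _ => m; rewrite expr1n mul1r hornerC.
Qed.

Lemma specD a b p q : spec a p -> spec b q -> spec (fun m => a m + b m) (p + q).
Proof.
move=> [e [e0 ea ->]] [f [f0 fb ->]]; exists (e ++ f); split => [|m|].
- by rewrite all_cat e0.
- by rewrite big_cat /= -ea -fb.
- by rewrite big_cat.
Qed.

Lemma specM a b p q : spec a p -> spec b q -> spec (fun m => a m * b m) (p * q).
Proof.
move=> [e [e0 ea ->]] [f [f0 fb ->]].
exists [seq (x.1 * y.1, x.2 * y.2) | x <- e, y <- f]; split => [|m|].
- apply/allP => _ /allpairsP[[x y] /= [xe yf ->]] /=.
  by rewrite mulf_neq0 //; [apply: (allP e0 x)|apply: (allP f0 y)].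
- rewrite big_allpairs_dep /= ea fb mulr_suml; apply: eq_bigr => x _.
  rewrite mulr_sumr; apply: eq_bigr => y _.
  by rewrite hornerM exprMn mulrACA.
- rewrite big_allpairs_dep /= mulr_suml; apply: eq_bigr => x _.
  by rewrite mulr_sumr.
Qed.

Lemma specZ c a p : spec a p -> spec (fun m => c * a m) (c *: p).
Proof. by rewrite -mul_polyC; apply: specM; apply: spec_const. Qed.

Lemma spec_sum (I : Type) (r : seq I) (P : pred I) (F : I -> nat -> K)
    (G : I -> {poly K}) : (forall i, P i -> spec (F i) (G i)) ->
  spec (fun m => \sum_(i <- r | P i) F i m) (\sum_(i <- r | P i) G i).
Proof.
move=> h; elim: r => [|i r IH].
  have := spec_const 0; rewrite polyC0 big_nil => hc.
  by apply: spec_ext hc _ => m; rewrite big_nil.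
rewrite big_cons; case: ifP => Pi; last first.
  by apply: spec_ext IH _ => m; rewrite big_cons Pi.
by apply: spec_ext (specD (h i Pi) IH) _ => m; rewrite big_cons Pi.
Qed.

Let partition_seq (V : nmodType) (e : seq (K * {poly K})) (F : K * {poly K} -> V) :
  \sum_(x <- e) F x =
  \sum_(l <- undup [seq x.1 | x <- e]) \sum_(x <- e | x.1 == l) F x.
Proof.
rewrite (exchange_big_dep xpredT) //=; apply: eq_big_seq => x xe.
rewrite (eq_bigl (pred1 x.1)) => [|l]; last by rewrite /= eq_sym.
by rewrite -big_filter filter_pred1_uniq ?undup_uniq ?mem_undup ?map_f // big_seq1.
Qed.

Lemma spec0 p : spec (fun _ => 0) p -> p = 0.
Proof.
case=> e [e0 ha ->]; rewrite partition_seq big1_seq // => l /= le.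
apply: (@exp_poly_indep _ (fun l => \sum_(x <- e | x.1 == l) x.2)) le.
- exact: undup_uniq.
- by rewrite mem_undup; apply/mapP => -[x /(allP e0) /eqP x0 /esym].
- move=> m; rewrite [RHS](ha m) partition_seq; apply: eq_bigr => l' _.
  rewrite horner_sum mulr_sumr; apply: eq_bigr => x /eqP -> //.
Qed.

(** Exponential polynomials with distinct bases are linearly independent, so that the
specialization is determined by the values of the sequence. *)
Lemma spec_uniq a p q : spec a p -> spec a q -> p = q.
Proof.
move=> ap /(specZ (-1)) aq; apply/eqP; rewrite -subr_eq0; apply/eqP.
rewrite -scaleN1r; apply: spec0.
by apply: spec_ext (specD ap aq) _ => m; rewrite mulN1r subrr.
Qed.

End ExponentialPolynomials.

(** * Truncations of the logarithm and of the exponential *)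

Section PolynomialCalculus.
Variable K : numClosedFieldType.
Implicit Types (p q r : {poly K}) (z : K).

(** The idempotents of the primary decomposition modulo [p], built by splitting off one
root after the other with Bezout relations. *)
Lemma poly_partition_of_unity p : p != 0 -> exists N (e : seq (K * {poly K})),
  p %| (1 - \sum_(x <- e) x.2) /\
  forall x, x \in e -> p %| ('X - x.1%:P) ^+ N * x.2.
Proof.
have [d] := ubnP (size p); elim: d p => // d IH p; rewrite ltnS => pd p0.
have [sp|sp] := leqP (size p) 1.
  have : size p == 1%N by rewrite eqn_leq sp lt0n size_poly_eq0.
  rewrite size_poly_eq1 => /eqp_dvdl pE.
  by exists 0%N, [::]; split => //; rewrite pE dvd1p.
have [z pz] : exists z, root p z by apply/closed_rootP; rewrite neq_ltn sp orbT.
have [a [r]] := multiplicity_XsubC p z; rewrite p0 /= => rz pE.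
have a0 : (0 < a)%N.
  by case: a pE => // pE; move: pz; rewrite pE expr0 mulr1 (negbTE rz).
have r0 : r != 0 by apply: contraNneq rz => ->; rewrite root0.
have rd : (size r < d)%N.
  apply: leq_trans pd; rewrite pE size_Mmonic ?monic_exp ?monicXsubC //.
  by rewrite size_exp_XsubC addnS /= -[X in (X < _)%N]addn0 ltn_add2l.
have [N [e [e1 eN]]] := IH r rd r0.
have : coprimep r (('X - z%:P) ^+ a) by rewrite coprimep_expr // coprimep_XsubC.
case/Bezout_eq1_coprimepP => -[v u] /= uv.
pose w := u * ('X - z%:P) ^+ a.
exists (N + a)%N, ((z, v * r) :: [seq (x.1, w * x.2) | x <- e]); split.
  rewrite big_cons big_map /= -mulr_sumr -uv -/w.
  have -> : v * r + w - (v * r + w * \sum_(x <- e) x.2) =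
    w * (1 - \sum_(x <- e) x.2).
    by rewrite mulrBr mulr1 opprD addrACA subrr add0r.
  by rewrite pE mulrC; apply: dvdp_mul => //; rewrite dvdp_mull.
move=> x; rewrite inE => /orP[/eqP -> /=|/mapP[y ye -> /=]].
  rewrite pE exprD; set b := _ ^+ a.
  by have -> : ('X - z%:P) ^+ N * b * (v * r) = ('X - z%:P) ^+ N * v * (r * b);
    [ring|rewrite dvdp_mull].
rewrite pE exprD /w; set b := _ ^+ a; set c := ('X - y.1%:P) ^+ a.
have -> : ('X - y.1%:P) ^+ N * c * (u * b * y.2)
  = (('X - y.1%:P) ^+ N * y.2) * (c * u * b) by ring.
by apply: dvdp_mul; [apply: eN|rewrite dvdp_mull].
Qed.

(** The binomial coefficient ['C(i, j)] as a polynomial in [i]. *)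
Fixpoint binp j : {poly K} :=
  if j is j'.+1 then (j%:R^-1) *: (('X - j'%:R%:P) * binp j') else 1.

Lemma binpE j (i : nat) : (binp j).[i%:R] = 'C(i, j)%:R.
Proof.
elim: j => [|j IH]; first by rewrite hornerC bin0.
have j0 : j.+1%:R != 0 :> K by rewrite pnatr_eq0.
rewrite hornerZ hornerM IH hornerXsubC; apply: (mulfI j0).
rewrite mulVKf // -natrM mul_bin_left natrM.
have [ji|ij] := leqP j i; first by rewrite natrB.
by rewrite bin_small // !mulr0.
Qed.

Lemma binp_coef0 j : (binp j)`_0 = (j == 0%N)%:R.
Proof. by rewrite -horner_coef0 -[0]/(0%:R) binpE; case: j. Qed.

(** The coefficients of [ln (1 + x)], which is the derivative at [i = 0] of the binomial
series of [(1 + x) ^ i]. *)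
Definition logc j : K := (binp j)`_1.

Lemma logc0 : logc 0 = 0. Proof. by rewrite /logc coef1. Qed.

Lemma logcS j : j.+1%:R * logc j.+1 + j%:R * logc j = (j == 0%N)%:R.
Proof.
have j0 : j.+1%:R != 0 :> K by rewrite pnatr_eq0.
rewrite /logc coefZ mulVKf // mulrBl coefB coefXM coefCM /=.
by rewrite subrK binp_coef0.
Qed.

Definition logp N : {poly K} := \poly_(j < N) logc j.
Definition expp N : {poly K} := \poly_(j < N) (j`!%:R)^-1.

Lemma deriv_expp N : (expp N.+1)^`() = expp N.
Proof.
apply/polyP => i; rewrite coef_deriv !coef_poly ltnS; case: ifP; rewrite ?mul0rn //.
move=> _; rewrite -[_^-1 *+ _]mulr_natr factS natrM invfM mulrAC mulVf ?mul1r ?pnatr_eq0 //.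
Qed.

Lemma exppS N : expp N.+1 = expp N + (N`!%:R)^-1 *: 'X^N.
Proof. by rewrite /expp !poly_def big_ord_recr. Qed.

Lemma logp_mulX N : exists L, logp N = L * 'X.
Proof.
exists (\poly_(j < N.-1) logc j.+1); apply/polyP => j.
rewrite coefMX !coef_poly; case: j => [|j] /=; first by rewrite logc0 if_same.
by rewrite ltn_predRL.
Qed.

(** Up to the order of truncation, the composite [h] satisfies [(1 + x) h' = h] and has
constant term [1], and this determines its coefficients. *)
Lemma expp_log N i : (i < N)%N ->
  (expp N \Po logp N)`_i = (1 + 'X : {poly K})`_i.
Proof.
case: N => // N; set h := _ \Po _ => iN.
have XnP p : (forall j, (j < N)%N -> p`_j = 0) -> exists q, p = q * 'X^N.
  move=> hp; exists (drop_poly N p); rewrite -[LHS](poly_take_drop N).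
  suff -> : take_poly N p = 0 by rewrite add0r.
  by apply/polyP => j; rewrite coef_take_poly coef0; case: ifP => // /hp.
have [w wE] : exists w, (1 + 'X) * (logp N.+1)^`() - 1 = w * 'X^N.
  apply: XnP => j jN; rewrite coefB mulrDl mul1r coefD coefXM !coef_deriv coef1.
  rewrite !coef_poly !ltnS jN -(logcS j) mulr_natl.
  case: j jN => [|j] jN /=; first by rewrite mul0r addr0 subrr.
  by rewrite (ltnW jN) mulr_natl subrr.
have [L LE] := logp_mulX N.+1.
have hE j : (j < N)%N -> ((1 + 'X) * h^`())`_j = h`_j.
  move=> jN; rewrite {1}/h deriv_comp deriv_expp mulrCA.
  have -> : expp N \Po logp N.+1 = h - (N`!%:R)^-1 *: logp N.+1 ^+ N.
    by rewrite /h exppS comp_polyD comp_polyZ comp_Xn_poly addrK.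
  rewrite -[(1 + 'X) * _](subrK 1) wE mulrDr mulr1 coefD mulrA coefMXn jN add0r.
  by rewrite coefB LE exprMn coefZ coefMXn jN mulr0 subr0.
have h0 : h`_0 = 1.
  rewrite -horner_coef0 horner_comp LE hornerMX mulr0 horner_coef0 coef_poly /=.
  by rewrite fact0 invr1.
have hS j : (j < N)%N -> j.+1%:R * h`_j.+1 = (1 - j%:R) * h`_j.
  move=> jN; have := hE j jN; rewrite mulrDl mul1r coefD coefXM !coef_deriv.
  move=> e; rewrite mulrBl mul1r -{1}e mulr_natl; case: (j) {e jN} => [|l] /=.
    by rewrite mul0r subr0 addr0.
  by rewrite mulr_natl addrK.
elim: i iN => [|[|i] IH] iN.
- by rewrite h0 coefD coef1 coefX addr0.
- have := hS 0%N iN; rewrite h0 subr0 !mul1r => ->.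
  by rewrite coefD coef1 coefX add0r.
- have := hS i.+1 iN; rewrite IH ?(ltnW iN) // coefD coef1 coefX add0r.
  rewrite coefD coef1 coefX add0r /=.
  have i0 : i.+2%:R != 0 :> K by rewrite pnatr_eq0.
  move=> e; apply: (mulfI i0); rewrite e mulr0.
  by case: (i) => [|k]; rewrite ?subrr ?mul0r ?mulr0.
Qed.

(** The product [exp x * exp (- x)] has derivative zero up to the order of truncation. *)
Lemma expp_opp N i : (0 < i < N)%N -> (expp N * (expp N \Po (- 'X)))`_i = 0.
Proof.
case: N => [|N]; first by rewrite ltn0 andbF.
case: i => // i; rewrite ltnS /= => iN.
have i0 : i.+1%:R != 0 :> K by rewrite pnatr_eq0.
apply: (mulfI i0); rewrite mulr0 mulr_natl -coef_deriv derivM deriv_comp deriv_expp.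
rewrite derivN derivX exppS comp_polyD comp_polyZ comp_Xn_poly exprNn.
set u := expp N; set v := _ \Po _.
rewrite -!mul_polyC; set c := _%:P; set e := (-1) ^+ N.
have -> : u * (v + c * (e * 'X^N)) + (u + c * 'X^N) * (v * -1) =
  (u * c * e - c * v) * 'X^N by ring.
by rewrite coefMXn -ltnS iN.
Qed.

End PolynomialCalculus.

(** * Operators modulo a power of the maximal ideal *)

Section LevelMatrices.
Variables (K : numClosedFieldType) (n : nat).
Local Notation A := (fseries K n).
Local Notation op := (op K n).
Implicit Types (f g h : A) (p q : {poly K}) (S T X Y : op) (k N m : nat).

Section Level.
Variable k : nat.
Local Notation D := ('X_{1..n < k.+1}).
(** A predecessor, so that the square matrices of size [level_dim.+1] form a nonzero ring. *)
Definition level_dim := #|{: D}|.-1.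
Local Notation N := level_dim.+1.

Fact level_dimE : N = #|{: D}|.
Proof.
have h0 : (mdeg (0%MM : 'X_{1..n}) < k.+1)%N by rewrite mdeg0.
by rewrite prednK //; apply/card_gt0P; exists (BMultinom h0).
Qed.

Let lv (j : 'I_N) : 'X_{1..n} := (enum_val (cast_ord level_dimE j) : D).
Definition lrow f : 'rV[K]_N := \row_j f (lv j).
Definition lmx T : 'M[K]_N :=
  \matrix_(i, j) T (fs_of_mpoly 'X_[lv i]) (lv j).

Lemma op_coef_level T f (a : 'X_{1..n}) : (mdeg a < k.+1)%N ->
  T f a = \sum_(b : D) f b * T (fs_of_mpoly 'X_[b]) a.
Proof.
move=> ak; have := op_vanish T (@vanish_trunc _ _ k f) ak.
rewrite raddfB /= fsBE => /eqP; rewrite subr_eq0 => /eqP ->.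
rewrite /fs_trunc linear_sum /= linear_sum fs_sumE; apply: eq_bigr => b _.
by rewrite 2!linearZ.
Qed.

Lemma lrow_op T f : lrow (T f) = lrow f *m lmx T.
Proof.
apply/rowP => j; rewrite !mxE (@op_coef_level _ _ (lv j)) ?bmdeg //.
rewrite (reindex (fun i => enum_val (cast_ord level_dimE i) : D)) /=; last first.
  apply: onW_bij; apply: bij_comp; first exact: enum_val_bij.
  by exists (cast_ord (esym level_dimE)) => i; rewrite ?cast_ordK ?cast_ordKV.
by apply: eq_bigr => i _; rewrite !mxE.
Qed.

Lemma lrow_eq0 f : lrow f = 0 <-> vanish k.+1 f.
Proof.
split=> h => [a ak|]; last by apply/rowP => j; rewrite !mxE h ?bmdeg.
have := congr1 (fun v : 'rV_N => v 0 (cast_ord (esym level_dimE) (enum_rank (BMultinom ak)))) h.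
by rewrite !mxE /lv cast_ordKV enum_rankK.
Qed.

Lemma lrow_surj (v : 'rV_N) : exists f, lrow f = v.
Proof.
exists (fun a => if insub a is Some b then v 0 (cast_ord (esym level_dimE) (enum_rank (b : D))) else 0).
by apply/rowP => j; rewrite !mxE /lv valK enum_valK cast_ordK.
Qed.

Fact lmx_linear : linear lmx.
Proof. by move=> c S T; apply/matrixP => i j; rewrite !mxE. Qed.
HB.instance Definition _ := GRing.isLinear.Build K op _ _ lmx lmx_linear.

Lemma lmx_ext (M M' : 'M[K]_N) :
  (forall f, lrow f *m M = lrow f *m M') -> M = M'.
Proof.
move=> h; apply/row_matrixP => i; rewrite !rowE.
by have [f <-] := lrow_surj (delta_mx 0 i).
Qed.

Lemma lmxM S T : lmx (S * T) = lmx S *m lmx T.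
Proof. by apply: lmx_ext => f; rewrite -lrow_op mulmxA -!lrow_op. Qed.

Lemma lmx1 : lmx 1 = 1%:M.
Proof. by apply: lmx_ext => f; rewrite -lrow_op mulmx1. Qed.

Lemma lmx_eq0 T : lmx T = 0 <-> small k.+1 T.
Proof.
split=> [h f|h]; first by apply/lrow_eq0; rewrite lrow_op h mulmx0.
by apply: lmx_ext => f; rewrite -lrow_op mulmx0; apply/lrow_eq0/h.
Qed.

Lemma lmx_horner T p : lmx (horner_alg T p) = horner_mx (lmx T) p.
Proof.
elim/poly_ind: p => [|p c IH]; first by rewrite !rmorph0 linear0.
rewrite !rmorphD !rmorphM /= horner_algC horner_algX horner_mx_X horner_mx_C.
by rewrite [LHS]linearD /= lmxM IH linearZ /= lmx1 scalemx1.
Qed.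

End Level.

Lemma horner_algE T p N : (size p <= N)%N ->
  horner_alg T p = \sum_(i < N) p`_i *: T ^+ i.
Proof.
move=> pN; rewrite -[LHS]/((map_poly (in_alg op) p).[T]).
rewrite (@horner_coef_wide _ N) ?size_map_poly //.
by apply: eq_bigr => i _; rewrite coef_map /= mulr_algl.
Qed.

Lemma horner_alg_commr S T p : S * T = T * S ->
  S * horner_alg T p = horner_alg T p * S.
Proof.
move=> h; elim/poly_ind: p => [|p c IH]; first by rewrite rmorph0 mulr0 mul0r.
rewrite rmorphD rmorphM /= horner_algC horner_algX mulrDr mulrDl mulrA IH.
by rewrite -!mulrA h -scalerAr mulr1 -scalerAl mul1r.
Qed.

Lemma horner_alg_comp T p q :
  horner_alg T (p \Po q) = horner_alg (horner_alg T q) p.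
Proof.
elim/poly_ind: p => [|p c IH]; first by rewrite comp_poly0 !rmorph0.
rewrite comp_polyD comp_polyM comp_polyX comp_polyC !rmorphD !rmorphM /= IH.
by rewrite !horner_algC horner_algX.
Qed.

(** The partition of unity attached to the characteristic polynomial of a level matrix,
which annihilates it by the Cayley-Hamilton theorem. *)
Lemma level_decomposition k T : exists N (e : seq (K * {poly K})),
  small k (1 - \sum_(x <- e) horner_alg T x.2) /\
  forall x, x \in e -> small k (horner_alg T (('X - x.1%:P) ^+ N * x.2)).
Proof.
pose p := char_poly (lmx k T).
have p0 : p != 0 by rewrite monic_neq0 // char_poly_monic.
have ann q : p %| q -> small k (horner_alg T q).
  move=> /dvdpP[r ->]; apply: (small_leq (leqnSn k)); apply/lmx_eq0; rewrite lmx_horner rmorphM /=.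
  by rewrite Cayley_Hamilton mulr0.
have [N [e [e1 eN]]] := poly_partition_of_unity p0.
exists N, e; split => [|x xe]; last by apply: ann; apply: eN.
by have := ann _ e1; rewrite rmorphB rmorph1 raddf_sum.
Qed.

End LevelMatrices.

(** * Logarithms of automorphisms *)

Section LogExp.
Variables (K : numClosedFieldType) (n : nat).
Local Notation A := (fseries K n).
Local Notation op := (op K n).
Implicit Types (f g h v : A) (p q : {poly K}) (S T X Y : op) (k N m : nat) (l : K).

Definition spec_fs (u : nat -> A) (u0 u1 : A) :=
  forall a, exists p, [/\ spec (fun i => u i a) p, p`_0 = u0 a & p`_1 = u1 a].

Lemma spec_fs_uniq u u0 u1 w0 w1 :
  spec_fs u u0 u1 -> spec_fs u w0 w1 -> u0 = w0 /\ u1 = w1.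
Proof.
move=> hu hw; split; apply/funext => a.
all: have [p [hp p0 p1]] := hu a; have [q [hq q0 q1]] := hw a.
all: by have e := spec_uniq hp hq; rewrite -?p0 -?q0 -?p1 -?q1 e.
Qed.

Lemma spec_fs_ext u w u0 u1 : (forall i, u i = w i) ->
  spec_fs u u0 u1 -> spec_fs w u0 u1.
Proof.
move=> e h a; have [p [hp p0 p1]] := h a; exists p; split => //.
by apply: spec_ext hp _ => i; rewrite e.
Qed.

Lemma spec_fs_const f : spec_fs (fun _ => f) f 0.
Proof.
by move=> a; exists (f a)%:P; split; [exact: spec_const|rewrite coefC|rewrite coefC].
Qed.

Lemma coefM0 p q : (p * q)`_0 = p`_0 * q`_0.
Proof. by rewrite coefM big_ord_recl big_ord0 addr0 subnn. Qed.

Lemma coefM1 p q : (p * q)`_1 = p`_0 * q`_1 + p`_1 * q`_0.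
Proof. by rewrite coefM !big_ord_recl big_ord0 addr0. Qed.

Lemma fsME f g a : (f * g) a =
  \sum_(b : 'X_{1..n < (mdeg a).+1, (mdeg a).+1} | a == (b.1 + b.2)%MM) f b.1 * g b.2.
Proof.
rewrite -[LHS]/((fs_trunc (mdeg a) f * fs_trunc (mdeg a) g)@_a) mcoeffM.
apply: eq_bigr => b _; rewrite !fs_truncK //.
  by have := bmdeg b.2; rewrite ltnS.
by have := bmdeg b.1; rewrite ltnS.
Qed.

Lemma spec_fsM u u0 u1 w w0 w1 : spec_fs u u0 u1 -> spec_fs w w0 w1 ->
  spec_fs (fun i => u i * w i) (u0 * w0) (u0 * w1 + u1 * w0).
Proof.
move=> hu hw a; pose p b := projT1 (cid (hu b)); pose q b := projT1 (cid (hw b)).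
have pP b : [/\ spec (fun i => u i b) (p b), (p b)`_0 = u0 b & (p b)`_1 = u1 b].
  exact: (projT2 (cid (hu b))).
have qP b : [/\ spec (fun i => w i b) (q b), (q b)`_0 = w0 b & (q b)`_1 = w1 b].
  exact: (projT2 (cid (hw b))).
exists (\sum_(b : 'X_{1..n < (mdeg a).+1, (mdeg a).+1} | a == (b.1 + b.2)%MM)
  p b.1 * q b.2); split.
- have ps b : spec (fun i => u i b) (p b) by have [] := pP b.
  have qs b : spec (fun i => w i b) (q b) by have [] := qP b.
  apply: spec_ext (spec_sum _ (fun (b : 'X_{1..n < _, _}) _ =>
    specM (ps b.1) (qs b.2))) _ => i.
  by rewrite fsME.
- rewrite coef_sum fsME; apply: eq_bigr => b _; rewrite coefM0.
  by have [_ -> _] := pP b.1; have [_ -> _] := qP b.2.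
- rewrite coef_sum fsDE !fsME -big_split; apply: eq_bigr => b _; rewrite coefM1.
  by have [_ -> ->] := pP b.1; have [_ -> ->] := qP b.2.
Qed.

(** The entries of the operators [U i] are exponential polynomials in [i] which
specialize to those of [U0 + t U1] modulo [t ^ 2]. *)
Definition spec_op (U : nat -> op) (U0 U1 : op) :=
  forall f, spec_fs (fun i => U i f) (U0 f) (U1 f).

Lemma spec_op_uniq U U0 U1 V0 V1 :
  spec_op U U0 U1 -> spec_op U V0 V1 -> U0 = V0 /\ U1 = V1.
Proof.
move=> hU hV; split; apply: opP => f.
  by have [] := spec_fs_uniq (hU f) (hV f).
by have [] := spec_fs_uniq (hU f) (hV f).
Qed.

Lemma spec_op_ext U V U0 U1 : (forall i, U i = V i) ->
  spec_op U U0 U1 -> spec_op V U0 U1.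
Proof. by move=> e h f; apply: spec_fs_ext (h f) => i; rewrite e. Qed.

Lemma spec_op_const S : spec_op (fun _ => S) S 0.
Proof. by move=> f; apply: spec_fs_const. Qed.

Lemma spec_opM U U0 U1 V V0 V1 : spec_op U U0 U1 -> spec_op V V0 V1 ->
  spec_op (fun i => U i * V i) (U0 * V0) (U0 * V1 + U1 * V0).
Proof.
move=> hU hV f a.
have hu := hU f; pose x b : A := fs_of_mpoly 'X_[b].
pose p b := projT1 (cid (hu b)); pose q b := projT1 (cid (hV (x b) a)).
have pP b : [/\ spec (fun i => U i f b) (p b), (p b)`_0 = U0 f b & (p b)`_1 = U1 f b].
  exact: (projT2 (cid (hu b))).
have qP b : [/\ spec (fun i => V i (x b) a) (q b), (q b)`_0 = V0 (x b) a
    & (q b)`_1 = V1 (x b) a].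
  exact: (projT2 (cid (hV (x b) a))).
exists (\sum_(b : 'X_{1..n < (mdeg a).+1}) p b * q b); split.
- have ps b : spec (fun i => U i f b) (p b) by have [] := pP b.
  have qs b : spec (fun i => V i (x b) a) (q b) by have [] := qP b.
  apply: spec_ext (spec_sum _ (fun (b : 'X_{1..n < _}) _ =>
    specM (ps b) (qs b))) _ => i.
  by rewrite opME [RHS]op_coef.
- rewrite coef_sum opME op_coef; apply: eq_bigr => b _; rewrite coefM0.
  by have [_ -> _] := pP b; have [_ -> _] := qP b.
- rewrite coef_sum opDE !opME fsDE (op_coef V1) (op_coef V0) -big_split.
  apply: eq_bigr => b _; rewrite coefM1.
  by have [_ -> ->] := pP b; have [_ -> ->] := qP b.
Qed.

Definition op_unit T := exists S, S * T = 1 /\ T * S = 1.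

(** Generalized eigenvectors modulo the [k]-th power of the maximal ideal. *)
Definition geigen k T l N v := vanish k (((T - l%:A) ^+ N) v).

Lemma geigen_leq k T l N M v : (N <= M)%N -> geigen k T l N v -> geigen k T l M v.
Proof.
by move=> /subnKC <- h; rewrite /geigen exprD opME; apply: op_vanish.
Qed.

Lemma geigen_comm k T l N v S : S * T = T * S -> geigen k T l N v ->
  geigen k T l N (S v).
Proof.
move=> ST h; rewrite /geigen -opME.
have -> : S * (T - l%:A) ^+ N = (T - l%:A) ^+ N * S.
  apply: commrX; rewrite /GRing.comm mulrBr mulrBl ST.
  by rewrite -scalerAl -scalerAr mulr1 mul1r.
by rewrite opME; apply: op_vanish.
Qed.

(** The eigenvalue [0] can be discarded because a unit has no generalized eigenvector
for it. *)
Lemma unit_decomposition k T : op_unit T -> exists N (e : seq (K * {poly K})),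
  small k (1 - \sum_(x <- e) horner_alg T x.2) /\
  forall x, x \in e -> x.1 != 0 /\ forall f, geigen k T x.1 N (horner_alg T x.2 f).
Proof.
move=> [S [ST TS]]; have [N [e [e1 eN]]] := level_decomposition k T.
exists N, [seq x <- e | x.1 != 0]; split => [|x]; last first.
  rewrite mem_filter => /andP[x0 xe]; split => // f.
  have := eN x xe f; rewrite mulrC rmorphM /= rmorphXn rmorphB /=.
  by rewrite horner_algX horner_algC.
have -> : 1 - \sum_(x <- [seq x <- e | x.1 != 0]) horner_alg T x.2 =
    (1 - \sum_(x <- e) horner_alg T x.2) + \sum_(x <- e | x.1 == 0) horner_alg T x.2.
  rewrite big_filter [\sum_(x <- e) _](bigID (fun x => x.1 == 0)) /=.
  by rewrite opprD addrA addrAC subrK.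
apply: smallD => //; rewrite big_seq_cond; apply: small_sum => x /andP[xe /eqP x0].
have := eN x xe; rewrite x0 subr0 rmorphM rmorphXn /= horner_algX => h.
have STN : S ^+ N * T ^+ N = 1.
  rewrite -exprMn_comm; first by rewrite ST expr1n.
  by rewrite /GRing.comm ST TS.
by rewrite -[horner_alg _ _]mul1r -STN -mulrA; apply: smallMl.
Qed.

Lemma sum_ord_trim (V : nmodType) N M (F : nat -> V) : (N <= M)%N ->
  (forall j, (N <= j)%N -> F j = 0) -> \sum_(j < M) F j = \sum_(j < N) F j.
Proof.
move=> NM F0; rewrite (big_ord_widen M F NM) [RHS]big_mkcond.
by apply: eq_bigr => j _; case: ltnP => // /F0.
Qed.

Definition unip_part T l : op := l^-1 *: (T - l%:A).

Lemma unip_partE T l : l != 0 -> T = l *: (1 + unip_part T l).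
Proof.
by move=> l0; rewrite scalerDr /unip_part scalerA divff // scale1r addrC subrK.
Qed.

Lemma unip_part_comm T l S : S * T = T * S -> S * unip_part T l = unip_part T l * S.
Proof.
move=> ST; rewrite /unip_part -scalerAr -scalerAl mulrBr mulrBl ST.
by rewrite -[S * _%:A]scalerAr -[_%:A * S]scalerAl mulr1 mul1r.
Qed.

Lemma unip_part_vanish k T l N v : geigen k T l N v ->
  vanish k ((unip_part T l ^+ N) v).
Proof. by move=> h; rewrite /unip_part exprZn opZE; apply: vanishZ. Qed.

(** This is the binomial expansion of [(l (1 + y)) ^ i], where [y] is nilpotent on [v]. *)
Lemma geigen_spec k T l N v a : l != 0 -> geigen k T l N v -> (mdeg a < k)%N ->
  spec (fun i => (T ^+ i) v a)
    (\sum_(j < N) ((unip_part T l ^+ j) v a) *: binp K j).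
Proof.
move=> l0 hv ak; set y := unip_part T l.
have y0 j : (N <= j)%N -> (y ^+ j) v a = 0.
  move=> /subnKC <-; rewrite exprD opME.
  by have := op_vanish (y ^+ (j - N)) (unip_part_vanish hv) ak.
apply: spec_ext (spec_geom _ l0) _ => i.
have -> : (T ^+ i) v a = l ^+ i * \sum_(j < i.+1) (y ^+ j) v a * 'C(i, j)%:R.
  rewrite [in LHS](unip_partE T l0) -/y exprZn exprDn_comm; last exact: commr_sym (commr1 _).
  rewrite opZE fsZE op_sumE fs_sumE; congr (_ * _); apply: eq_bigr => j _.
  rewrite expr1n mul1r mulr_natr; elim: ('C(_, _)) => [|c IH]; first by rewrite !mulr0n.
  by rewrite !mulrS opDE fsDE IH.
congr (_ * _); rewrite horner_sum.
under eq_bigr do rewrite hornerZ binpE.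
pose F j := (y ^+ j) v a * 'C(i, j)%:R.
rewrite -[RHS](@sum_ord_trim _ i.+1 (N + i.+1) F) ?leq_addl //.
  rewrite -[LHS](@sum_ord_trim _ N (N + i.+1) F) ?leq_addr // => j Nj.
  by rewrite /F y0 ?mul0r.
by move=> j ij; rewrite /F bin_small ?mulr0.
Qed.

Lemma unit_spec T f a : op_unit T ->
  exists p, spec (fun i => (T ^+ i) f a) p /\ p`_0 = f a.
Proof.
move=> Tu; have [N [e [e1 eN]]] := unit_decomposition (mdeg a).+1 Tu.
pose c (x : K * {poly K}) := horner_alg T x.2 f.
pose P (x : K * {poly K}) := \sum_(j < N) ((unip_part T x.1 ^+ j) (c x) a) *: binp K j.
have fE S : S f a = \sum_(x <- e) S (c x) a.
  have := op_vanish S (e1 f) (ltnSn _); rewrite opBE op1E raddfB /= fsBE => /eqP.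
  by rewrite subr_eq0 op_sumE raddf_sum fs_sumE => /eqP.
exists (\sum_(x <- e) P x); split.
  apply: (spec_ext (a := fun i => \sum_(x <- e) (T ^+ i) (c x) a)) => [|i]; last by rewrite fE.
  rewrite big_seq; have := @spec_sum K _ e (fun x => x \in e)
    (fun x i => (T ^+ i) (c x) a) P.
  move=> h; apply: spec_ext (h _) _ => [x xe|i]; last by rewrite -big_seq.
  have [x0 xN] := eN x xe; exact: (geigen_spec x0 (xN f) (ltnSn _)).
rewrite coef_sum -[f]op1E fE; apply: eq_big_seq => x xe; rewrite coef_sum.
have [x0 xN] := eN x xe; have {}xN := xN f.
case: N P eN xN => [|N] P eN xN.
  by rewrite big_ord0 (xN a (ltnSn _)).
rewrite big_ord_recl big1 ?addr0 => [|j _]; last by rewrite coefZ binp_coef0 mulr0.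
by rewrite coefZ binp_coef0 mulr1 expr0.
Qed.

Fact log_exists T : op_unit T -> exists X, spec_op (fun i => T ^+ i) 1 X.
Proof.
move=> Tu; pose p f a := projT1 (cid (unit_spec f a Tu)).
have pP f a : spec (fun i => (T ^+ i) f a) (p f a) /\ (p f a)`_0 = f a.
  exact: (projT2 (cid (unit_spec f a Tu))).
pose X f : A := fun a => (p f a)`_1.
have XP : filtered X.
  split=> [c f g|k f fk a ak].
    apply/funext => a; rewrite fsDE fsZE /X -coefZ -coefD.
    suff -> : p (c *: f + g) a = c *: p f a + p g a by [].
    apply: (@spec_uniq _ (fun i => (T ^+ i) (c *: f + g) a)).
      by have [] := pP (c *: f + g) a.
    have [hf _] := pP f a; have [hg _] := pP g a.
    by apply: spec_ext (specD (specZ c hf) hg) _ => i; rewrite linearP.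
  suff : p f a = 0 by rewrite /X => ->; rewrite coef0.
  apply: spec0; have [hf _] := pP f a; apply: spec_ext hf _ => i.
  by have := op_vanish (T ^+ i) fk ak.
by exists (Op XP) => f a; exists (p f a); have [? ?] := pP f a; split.
Qed.

(** Replacing the eigenvalues of [T] by [1] in its powers leaves the one-parameter group
of the unipotent part of [T]; the logarithm is its derivative at [0]. This
description uses no choice of coordinates or of truncation, which makes its
functoriality immediate. *)
Definition oplog T : op :=
  if pselect (exists X, spec_op (fun i => T ^+ i) 1 X) is left ex
  then projT1 (cid ex) else 0.

Lemma oplog_spec T : op_unit T -> spec_op (fun i => T ^+ i) 1 (oplog T).
Proof.
move=> /log_exists ex; rewrite /oplog; case: pselect => // e.
exact: (projT2 (cid e)).
Qed.

(** Functoriality: as its matrix coefficients are determined by those of the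
powers of [T], the logarithm commutes with every intertwining operator. *)
Lemma oplog_intertwine S T T' : op_unit T -> op_unit T' ->
  S * T' = T * S -> S * oplog T' = oplog T * S.
Proof.
move=> Tu Tu' ST.
have := spec_opM (spec_op_const S) (oplog_spec Tu').
rewrite mulr1 mul0r addr0 => h1.
have := spec_opM (oplog_spec Tu) (spec_op_const S).
rewrite mul1r mulr0 add0r => h2.
have e i : T ^+ i * S = S * T' ^+ i.
  elim: i => [|i IH]; first by rewrite !expr0 mulr1 mul1r.
  by rewrite exprSr -mulrA -ST mulrA IH -mulrA -exprSr.
by have [_] := spec_op_uniq h1 (spec_op_ext e h2).
Qed.

Lemma oplog_comm T : op_unit T -> oplog T * T = T * oplog T.
Proof. by move=> Tu; rewrite (@oplog_intertwine T T T). Qed.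

Definition derivation_op X := forall f g, X (f * g) = X f * g + f * X g.

(** Differentiate the multiplicativity of the powers of [T]. *)
Lemma oplog_derivation T : op_unit T -> multiplicative_op T ->
  derivation_op (oplog T).
Proof.
move=> Tu [T1 TM] f g.
have h1 := spec_fsM (oplog_spec Tu f) (oplog_spec Tu g).
have TMi i : (T ^+ i) f * (T ^+ i) g = (T ^+ i) (f * g).
  by elim: i => [//|i IH]; rewrite !opXSE -TM IH.
have [_ ->] := spec_fs_uniq (oplog_spec Tu (f * g)) (spec_fs_ext TMi h1).
by rewrite !op1E addrC.
Qed.

End LogExp.

(** * Exponentials and semisimple parts *)

Section Exponential.
Variables (K : numClosedFieldType) (n : nat).
Local Notation A := (fseries K n).
Local Notation op := (op K n).
Implicit Types (f g h v : A) (p q : {poly K}) (S T X Y : op) (k N m : nat) (l : K).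

Lemma op_commX S T i : S * T = T * S -> S * T ^+ i = T ^+ i * S.
Proof. exact: commrX. Qed.

(** The first-order coefficient of the binomial expansion of the powers of [T]. *)
Lemma geigen_oplog k T l N v : op_unit T -> l != 0 -> geigen k T l N v ->
  vanish k (oplog T v - horner_alg (unip_part T l) (logp K N) v).
Proof.
move=> Tu l0 hv a ak; rewrite fsBE; apply/eqP; rewrite subr_eq0; apply/eqP.
have [p [hp _ <-]] := oplog_spec Tu v a.
rewrite (spec_uniq hp (geigen_spec l0 hv ak)) coef_sum.
rewrite (@horner_algE _ _ _ _ N) ?size_poly // op_sumE fs_sumE.
by apply: eq_bigr => j _; rewrite coefZ coef_poly ltn_ord opZE fsZE mulrC.
Qed.

Lemma geigen_oplogX k T l N v i : op_unit T -> l != 0 -> geigen k T l N v ->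
  vanish k ((oplog T ^+ i) v - (horner_alg (unip_part T l) (logp K N) ^+ i) v).
Proof.
move=> Tu l0 hv; set L := horner_alg _ _.
have LT : L * T = T * L by rewrite -horner_alg_commr // unip_part_comm.
elim: i => [|i IH]; first by rewrite !expr0 subrr.
rewrite !opXSE.
have -> : oplog T ((oplog T ^+ i) v) - L ((L ^+ i) v) =
  oplog T ((oplog T ^+ i) v - (L ^+ i) v) + (oplog T ((L ^+ i) v) - L ((L ^+ i) v)).
  by rewrite raddfB addrA subrK.
apply: vanishD; first exact: op_vanish.
apply: geigen_oplog => //; apply: geigen_comm hv.
by apply/esym/op_commX/esym.
Qed.

Lemma geigen_oplog_horner k T l N v p : op_unit T -> l != 0 -> geigen k T l N v ->
  vanish k (horner_alg (oplog T) p v -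
            horner_alg (unip_part T l) (p \Po logp K N) v).
Proof.
move=> Tu l0 hv; rewrite horner_alg_comp !(@horner_algE _ _ _ p _ (leqnn _)).
rewrite !op_sumE -sumrB; apply: vanish_sum => i _.
by rewrite !opZE -scalerBr; apply/vanishZ/geigen_oplogX.
Qed.

Lemma vanish_horner k X p N v : (forall i, (i < N)%N -> p`_i = 0) ->
  vanish k ((X ^+ N) v) -> vanish k (horner_alg X p v).
Proof.
move=> p0 h; rewrite (@horner_algE _ _ _ _ _ (leqnn _)) op_sumE.
apply: vanish_sum => i _; rewrite opZE.
have [iN|Ni] := ltnP i N; first by rewrite p0 // scale0r.
by apply: vanishZ; rewrite -(subnKC Ni) exprD opME; apply: op_vanish.
Qed.

Definition nilp_op X := forall k, exists N, small k (X ^+ N).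

(** On generalized eigenvectors the logarithm is a power series without constant term in
a nilpotent operator. *)
Lemma oplog_nilp T : op_unit T -> nilp_op (oplog T).
Proof.
move=> Tu k; have [N [e [e1 eN]]] := unit_decomposition k Tu; exists N => f.
have := op_vanish (oplog T ^+ N) (e1 f); rewrite opBE op1E raddfB /= => h.
rewrite -[_ f](subrK ((oplog T ^+ N) ((\sum_(x <- e) horner_alg T x.2) f))).
apply: vanishD => //; rewrite op_sumE raddf_sum big_seq.
apply: vanish_sum => x xe; have [x0 xN] := eN x xe.
have := geigen_oplog_horner 'X^N Tu x0 (xN f).
rewrite /= rmorphXn /= horner_algX => hx.
rewrite -[X in vanish _ X](subrK (horner_alg (unip_part T x.1) ('X^N \Po logp K N) (horner_alg T x.2 f))).
apply: vanishD => //; apply: (@vanish_horner _ _ _ N); last exact: unip_part_vanish.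
move=> i iN; rewrite comp_Xn_poly.
by have [L ->] := logp_mulX K N; rewrite exprMn coefMXn iN.
Qed.

Definition exp_trunc N X : op := horner_alg X (expp K N).

Lemma exp_trunc_leq k X N M : (N <= M)%N -> small k (X ^+ N) ->
  small k (exp_trunc M X - exp_trunc N X).
Proof.
move=> NM h f; rewrite /exp_trunc -rmorphB /=.
apply: (@vanish_horner _ _ _ N); last exact: h.
by move=> i iN; rewrite coefB !coef_poly iN (leq_trans iN NM) subrr.
Qed.

(** Truncations agree modulo a power of the maximal ideal once the omitted powers of [X]
are small, so that they converge coefficientwise. *)
Fact exp_exists X : nilp_op X -> exists E : op,
  forall k N, small k (X ^+ N) -> small k (E - exp_trunc N X).
Proof.
move=> nX; pose N k := projT1 (cid (nX k)).
have NP k : small k (X ^+ N k) := projT2 (cid (nX k)).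
have eqE k M M' : small k (X ^+ M) -> small k (X ^+ M') ->
    small k (exp_trunc M X - exp_trunc M' X).
  move=> hM hM'; case/orP: (leq_total M M') => le.
    by rewrite -opprB; apply/smallN/exp_trunc_leq.
  exact: exp_trunc_leq.
pose E f : A := fun a => exp_trunc (N (mdeg a).+1) X f a.
have EE k M f : small k (X ^+ M) -> vanish k (E f - exp_trunc M X f).
  move=> hM a ak; rewrite fsBE /E -fsBE -opBE.
  by apply: (@eqE (mdeg a).+1) => //; apply: small_leq hM.
have EP : filtered E.
  split=> [c f g|k f fk a ak]; last first.
    by have := op_vanish (exp_trunc (N (mdeg a).+1) X) fk ak.
  by apply/funext => a; rewrite fsDE fsZE /E linearP.
by exists (Op EP) => k M hM f; rewrite opBE; apply: EE.
Qed.

Definition opexp X : op :=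
  if pselect (nilp_op X) is left nX then projT1 (cid (exp_exists nX)) else 1.

Lemma opexpE k N X : nilp_op X -> small k (X ^+ N) ->
  small k (opexp X - exp_trunc N X).
Proof.
by move=> nX; rewrite /opexp; case: pselect => // nX'; case: cid => E /= h; apply: h.
Qed.

Lemma nilp_opN X : nilp_op X -> nilp_op (- X).
Proof.
move=> nX k; have [N hN] := nX k; exists N.
by rewrite exprNn -signr_odd; apply: smallMl.
Qed.

Lemma nilp_op0 : nilp_op 0.
Proof. by move=> k; exists 1%N; rewrite expr1; apply: small0. Qed.

Lemma small_sub_eq S T : (forall k, small k (S - T)) -> S = T.
Proof. by move=> h; apply/eqP; rewrite -subr_eq0; apply/eqP/small_eq0. Qed.

Lemma small_subM k S S' T T' : small k (S - S') -> small k (T - T') ->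
  small k (S * T - S' * T').
Proof.
move=> hS hT; have -> : S * T - S' * T' = (S - S') * T + S' * (T - T').
  by rewrite mulrBl mulrBr addrA subrK.
by apply: smallD; [apply: smallMr|apply: smallMl].
Qed.

Lemma small_trans k S T Y : small k (S - T) -> small k (T - Y) -> small k (S - Y).
Proof. by move=> h1 h2; rewrite -[S](subrK T) -addrA; apply: smallD. Qed.

Lemma small_sym k S T : small k (S - T) -> small k (T - S).
Proof. by move=> h; rewrite -opprB; apply: smallN. Qed.

Lemma opexp0 : opexp 0 = 1.
Proof.
apply: small_sub_eq => k.
have h : small k (0 ^+ 1 : op) by rewrite expr1; apply: small0.
have := opexpE nilp_op0 h; rewrite /exp_trunc.
rewrite (@horner_algE _ _ _ _ 1) ?size_poly // big_ord1 coef_poly /= expr0.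
by rewrite invr1 scale1r.
Qed.

Lemma opexp_intertwine S X Y : nilp_op X -> nilp_op Y -> S * Y = X * S ->
  S * opexp Y = opexp X * S.
Proof.
move=> nX nY SXY; apply: small_sub_eq => k.
have [N hN] := nX k; have [M hM] := nY k; pose P := maxn N M.
have hX : small k (X ^+ P) by apply: smallX_leq hN; apply: leq_maxl.
have hY : small k (Y ^+ P) by apply: smallX_leq hM; apply: leq_maxr.
have e i : X ^+ i * S = S * Y ^+ i.
  elim: i => [|i IH]; first by rewrite !expr0 mulr1 mul1r.
  by rewrite exprSr -mulrA -SXY mulrA IH -mulrA -exprSr.
have eT : exp_trunc P X * S = S * exp_trunc P Y.
  rewrite /exp_trunc !(@horner_algE _ _ _ (expp K P) P) ?size_poly //.
  rewrite mulr_suml mulr_sumr; apply: eq_bigr => i _.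
  by rewrite -scalerAl e -scalerAr.
apply: (@small_trans _ _ (S * exp_trunc P Y)).
  by rewrite -mulrBr; apply/smallMl/opexpE.
by rewrite -eT -mulrBl; apply/smallMr/small_sym/opexpE.
Qed.

Lemma opexpNr X : nilp_op X -> opexp X * opexp (- X) = 1.
Proof.
move=> nX; apply: small_sub_eq => k; have [N hN] := nX k.
have hN1 : small k (X ^+ N.+1) by apply: smallX_leq hN.
have hN' : small k ((- X) ^+ N.+1) by rewrite exprNn -signr_odd; apply: smallMl.
apply: (small_trans (small_subM (opexpE nX hN1) (opexpE (nilp_opN nX) hN'))).
have -> : exp_trunc N.+1 (- X) = horner_alg X (expp K N.+1 \Po (- 'X)).
  by rewrite horner_alg_comp rmorphN /= horner_algX.
rewrite /exp_trunc -rmorphM -(rmorph1 (horner_alg X)) -rmorphB /= => f.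
apply: (@vanish_horner _ _ _ N.+1); last exact: hN1.
case=> [_|i iN]; last by rewrite coefB coef1 expp_opp ?subr0.
rewrite coefB coef1 coefM0 -!horner_coef0 horner_comp !hornerE oppr0.
by rewrite horner_coef0 coef_poly /= invr1 mulr1 subrr.
Qed.

Lemma opexpNl X : nilp_op X -> opexp (- X) * opexp X = 1.
Proof. by move=> nX; have := opexpNr (nilp_opN nX); rewrite opprK. Qed.

(** By the Leibniz rule the exponential series of [X] at [f * g] is the Cauchy product of
those at [f] and [g]. *)
Lemma opexp_multiplicative X : nilp_op X -> derivation_op X ->
  multiplicative_op (opexp X).
Proof.
move=> nX dX.
have X1 : X 1 = 0.
  have := dX 1 1; rewrite !mulr1 mul1r => /eqP.
  by rewrite -subr_eq subrr eq_sym => /eqP.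
have dXi i f g : (X ^+ i) (f * g) =
    \sum_(j < i.+1) ((X ^+ j) f * (X ^+ (i - j)) g) *+ 'C(i, j).
  elim: i => [|i IH]; first by rewrite big_ord1.
  rewrite opXSE IH raddf_sum.
  under eq_bigr do rewrite raddfMn /= dX -!opXSE mulrnDl.
  rewrite big_split /= big_ord_recr /= [X in _ + X]big_ord_recl /=.
  rewrite [RHS]big_ord_recl [in RHS]big_ord_recr /= !subn0 !subnn !bin0 !binn.
  rewrite [bump 0 i]/bump /= add1n [LHS]addrC -!addrA; congr (_ + _).
  rewrite addrA; congr (_ + _); rewrite -big_split /=.
  apply: eq_bigr => j _; rewrite /bump /= !add1n binS mulrnDr -subSn //.
split.
  apply/eqP; rewrite -subr_eq0; apply/eqP; apply: vanish_eq0 => k.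
  have [N hN] := nX k; have hN1 : small k (X ^+ N.+1) by apply: smallX_leq hN.
  have := opexpE nX hN1 1; rewrite opBE.
  rewrite /exp_trunc (@horner_algE _ _ _ _ N.+1) ?size_poly // op_sumE.
  rewrite big_ord_recl big1 => [|i _]; last by rewrite opZE exprS opME X1 raddf0 scaler0.
  by rewrite opZE coef_poly /= invr1 scale1r addr0.
move=> f g; apply/eqP; rewrite -subr_eq0; apply/eqP; apply: vanish_eq0 => k.
have [N hN] := nX k; pose M := (N + N)%N.
have hM : small k (X ^+ M) by apply: smallX_leq hN; apply: leq_addr.
have hf := opexpE nX hN f; have hg := opexpE nX hN g; have hfg := opexpE nX hM (f * g).
rewrite !opBE in hf hg hfg.
pose u h : {poly A} := \poly_(i < N) (i`!%:R^-1 *: (X ^+ i) h).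
have uE h : exp_trunc N X h = (u h).[1].
  rewrite /exp_trunc (@horner_algE _ _ _ _ N) ?size_poly // op_sumE.
  rewrite (@horner_coef_wide _ N) ?size_poly //; apply: eq_bigr => i _.
  by rewrite expr1n mulr1 opZE !coef_poly ltn_ord.
have uk h i : vanish k ((u h)`_i - i`!%:R^-1 *: (X ^+ i) h).
  rewrite coef_poly; case: ltnP => iN; first by rewrite subrr.
  by rewrite sub0r; apply/vanishN/vanishZ; exact: (smallX_leq iN hN h).
have h : vanish k (exp_trunc M X (f * g) - exp_trunc N X f * exp_trunc N X g).
  have sM : (size (u f * u g)%R <= M)%N.
    apply: leq_trans (size_polyMleq _ _) _; apply: leq_trans (leq_pred _) _.
    by rewrite leq_add ?size_poly.
  rewrite !uE -hornerM (@horner_coef_wide _ M) //.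
  rewrite /exp_trunc (@horner_algE _ _ _ _ M) ?size_poly // op_sumE -sumrB.
  apply: vanish_sum => i _; rewrite opZE coef_poly ltn_ord expr1n mulr1 dXi coefM.
  rewrite scaler_sumr -sumrB; apply: vanish_sum => j _.
  have -> : i`!%:R^-1 *: ((X ^+ j) f * (X ^+ (i - j)) g *+ 'C(i, j)) =
      (j`!%:R^-1 *: (X ^+ j) f) * ((i - j)`!%:R^-1 *: (X ^+ (i - j)) g) :> A.
    rewrite -scalerAl -scalerAr scalerA -[_ *+ 'C(_, _)]scaler_nat scalerA.
    have ji : (j <= i)%N by rewrite -ltnS.
    congr (_ *: _); rewrite -(bin_fact ji) !natrM !invfM mulrAC mulVf ?mul1r //.
    by rewrite pnatr_eq0 -lt0n bin_gt0.
  rewrite -opprB; apply: vanishN.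
  set x := (u f)`_j; set y := (u g)`_(i - j); set x' := _ *: _; set y' := _ *: _.
  have -> : x * y - x' * y' = (x - x') * y + x' * (y - y').
    by rewrite mulrBl mulrBr addrA subrK.
  by apply: vanishD; [apply: vanishMr|apply: vanishMl]; apply: uk.
set F := opexp X f; set G := opexp X g; rewrite -/F -/G in hf hg.
set f' := exp_trunc N X f in hf h; set g' := exp_trunc N X g in hg h.
have -> : opexp X (f * g) - F * G =
  (opexp X (f * g) - exp_trunc M X (f * g)) + (exp_trunc M X (f * g) - f' * g')
  - ((F - f') * G + f' * (G - g')).
  by rewrite mulrBl mulrBr; ring.
apply: vanishB; apply: vanishD => //; first exact: vanishMr.
exact: vanishMl.
Qed.

(** If [l] is nonzero, [T] acts as [l (1 + y)] with [y] nilpotent on [v], and its logarithm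
as [ln (1 + y)]: dividing [T] by the exponential [1 + y] leaves [l]. *)
Lemma geigen_semisimple k T l N v : op_unit T -> geigen k T l N v ->
  vanish k ((T * opexp (- oplog T)) v - l *: v).
Proof.
move=> Tu hv; set X := oplog T.
have nX : nilp_op X := oplog_nilp Tu.
have [l0|l0] := eqVneq l 0.
  have [S [ST TS]] := Tu.
  suff v0 : vanish k v by apply: vanishB; [apply: op_vanish|apply: vanishZ].
  move: hv; rewrite /geigen l0 scale0r subr0 => hv.
  have e : T ^+ N * S ^+ N = 1.
    rewrite -exprMn_comm ?TS ?expr1n //.
    by rewrite /GRing.comm ST TS.
  by rewrite -[v]op1E -e opME; apply: op_vanish.
have XT : X * T = T * X := oplog_comm Tu.
have nXN := nilp_opN nX.
have c : T * opexp (- X) = opexp (- X) * T.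
  by apply: opexp_intertwine => //; rewrite mulrN mulNr XT.
have [M hM] := nX k; pose P := maxn N M.
have hP : small k (X ^+ P) by apply: smallX_leq hM; apply: leq_maxr.
have hvP : geigen k T l P v by apply: geigen_leq hv; apply: leq_maxl.
have e1 : vanish k (opexp X v - (1 + unip_part T l) v).
  have -> : opexp X v - (1 + unip_part T l) v = (opexp X - exp_trunc P X) v +
      (exp_trunc P X v - horner_alg (unip_part T l) (expp K P \Po logp K P) v) +
      (horner_alg (unip_part T l) (expp K P \Po logp K P) v - (1 + unip_part T l) v).
    by rewrite opBE; ring.
  apply: vanishD; last first.
    have -> : 1 + unip_part T l = horner_alg (unip_part T l) (1 + 'X).
      by rewrite rmorphD rmorph1 /= horner_algX.
    rewrite -opBE -rmorphB; apply: (@vanish_horner _ _ _ P).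
      by move=> i iP; rewrite coefB expp_log // subrr.
    exact: unip_part_vanish.
  apply: vanishD; first exact: opexpE.
  exact: geigen_oplog_horner.
have -> : (T * opexp (- X)) v - l *: v =
    - (l *: opexp (- X) (opexp X v - (1 + unip_part T l) v)).
  rewrite raddfB /= -[opexp (- X) (opexp X v)]opME opexpNr // op1E.
  rewrite scalerBr opprB -linearZ /= scalerDr scalerA divff // scale1r.
  by rewrite [l *: v + _]addrC subrK.
by apply/vanishN/vanishZ/op_vanish.
Qed.

End Exponential.

(** * The Lie algebra of a nilpotent group *)

Section LieAlgebra.
Variables (K : numClosedFieldType) (n : nat).
Local Notation A := (fseries K n).
Local Notation op := (op K n).
Local Notation fdiff := (fdiff K n).
Implicit Types (U V : nat -> op) (S T X Y Z : op) (k N m i : nat) (l : K) (x y : fdiff) (s : seq fdiff).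

Lemma star_unit x : op_unit (star x).
Proof. by exists (star x^-1%g); rewrite starV starVr. Qed.

Definition fdlog x : op := oplog (star x).

Definition ad X Y := X * Y - Y * X.
(** The first-order part of the commutator of [x] with a one-parameter group tangent to
[Y]. *)
Definition shiftAd x Y := Y - star x^-1%g * Y * star x.

Lemma spec_opB U (U0 U1 : op) V (V0 V1 : op) : spec_op U U0 U1 -> spec_op V V0 V1 ->
  spec_op (fun i => U i - V i) (U0 - V0) (U1 - V1).
Proof.
move=> hU hV f a; have [p [hp p0 p1]] := hU f a; have [q [hq q0 q1]] := hV f a.
exists (p + (-1) *: q); split.
- apply: spec_ext (specD hp (specZ (-1) hq)) _ => i.
  by rewrite mulN1r opBE fsBE.
- by rewrite coefD coefZ mulN1r p0 q0 opBE fsBE.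
- by rewrite coefD coefZ mulN1r p1 q1 opBE fsBE.
Qed.

Lemma spec_opMc U (U0 U1 : op) S T : spec_op U U0 U1 ->
  spec_op (fun i => S * U i * T) (S * U0 * T) (S * U1 * T).
Proof.
move=> h; have := spec_opM (spec_opM (spec_op_const S) h) (spec_op_const T).
by rewrite mulr0 mul0r addr0 add0r.
Qed.

Lemma spec_star x : spec_op (fun i => star (x ^+ i)%g) 1 (fdlog x).
Proof.
by apply: spec_op_ext (oplog_spec (star_unit x)) => i; rewrite starX.
Qed.

Lemma spec_starV x : spec_op (fun i => star (x ^- i)%g) 1 (- fdlog x).
Proof.
have hV : spec_op (fun i => star (x ^- i)%g) 1 (fdlog x^-1%g).
  by apply: spec_op_ext (spec_star x^-1%g) => i; rewrite expVgn.
suff -> : - fdlog x = fdlog x^-1%g by [].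
have := spec_opM (spec_star x) hV; rewrite !mul1r mulr1 => h.
have [_ /eqP] := spec_op_uniq (spec_op_ext (fun i => etrans (esym (starM _ _))
  (etrans (congr1 _ (mulgV _)) (star1 _ _))) h) (spec_op_const 1).
by rewrite addrC addr_eq0 => /eqP ->; rewrite opprK.
Qed.

Lemma spec_commg x (w : nat -> fdiff) Y :
  spec_op (fun i => star (w i)) 1 Y -> spec_op (fun i => star (w i)^-1%g) 1 (- Y) ->
  spec_op (fun i => star [~ x, w i]%g) 1 (shiftAd x Y) /\
  spec_op (fun i => star [~ x, w i]^-1%g) 1 (- shiftAd x Y).
Proof.
move=> h h'; rewrite /shiftAd; split.
  have := spec_opM (spec_opMc (star x^-1%g) (star x) h') h.
  rewrite !mulr1 starV !mul1r mulrN mulNr => H.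
  apply: spec_op_ext H => i.
  by rewrite commgEl /conjg -!starM !mulgA.
have := spec_opM h' (spec_opMc (star x^-1%g) (star x) h).
rewrite mulr1 starV !mul1r mulr1 opprB => H.
apply: spec_op_ext H => i.
by rewrite commgEl /conjg -!starM !invgM !invgK !mulgA.
Qed.

Variables (G : set fdiff) (c : nat).
Hypotheses (gG : subgroup G) (nilG : lower_central_series G c = [set 1%g]%classic).

Let Gs s := forall x, x \in s -> G x.

Let Gs_cons x s : Gs (x :: s) -> G x /\ Gs s.
Proof.
by move=> h; split => [|y ys]; apply: h; rewrite inE ?eqxx // ys orbT.
Qed.

Let Gs_cat s1 s2 : Gs (s1 ++ s2) -> Gs s1 /\ Gs s2.
Proof. by move=> h; split=> x xs; apply: h; rewrite mem_cat xs ?orbT. Qed.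

Let Gs_catI s1 s2 : Gs s1 -> Gs s2 -> Gs (s1 ++ s2).
Proof. by move=> h1 h2 x; rewrite mem_cat => /orP[/h1|/h2]. Qed.

Let GX x i : G x -> G (x ^+ i)%g.
Proof.
move=> Gx; elim: i => [|i IH]; first by rewrite expg0; apply: subgroup1.
by rewrite expgS; apply: subgroupM.
Qed.

Definition shiftAds s Y := foldr shiftAd Y s.
Definition ads s Y := foldr (fun x => ad (fdlog x)) Y s.

(** The iterated commutators of [c] elements of [G] with the powers of [y] are trivial,
and this is their first-order part in the exponent of [y]. *)
Lemma shiftAds_log s y : Gs s -> G y -> size s = c -> shiftAds s (fdlog y) = 0.
Proof.
move=> hs Gy sc.
pose w i := foldr (fun x z => [~ x, z]%g) (y ^+ i)%g s.
have [h1 h2] : spec_op (fun i => star (w i)) 1 (shiftAds s (fdlog y)) /\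
    spec_op (fun i => star (w i)^-1%g) 1 (- shiftAds s (fdlog y)).
  rewrite /w; elim: (s) => [|x s' [IH1 IH2]] /=; last exact: spec_commg.
  by split; [exact: spec_star|exact: spec_starV].
have w1 i : w i = 1%g.
  suff : [set 1%g]%classic (w i) by [].
  rewrite -nilG -sc /w; elim: (s) hs => [_|x s' IH] /=; first exact: GX.
  by move=> /Gs_cons[Gx Gs']; apply: mem_commutator => //; apply: IH.
have h3 : spec_op (fun i => star (w i)) 1 0.
  by apply: spec_op_ext (spec_op_const 1) => i; rewrite w1 star1.
by have [_] := spec_op_uniq h1 h3.
Qed.

Fact ad0 X : ad X 0 = 0. Proof. by rewrite /ad mulr0 mul0r subrr. Qed.
Lemma adD X Y Z : ad X (Y + Z) = ad X Y + ad X Z.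
Proof. by rewrite /ad mulrDr mulrDl opprD addrACA. Qed.
Lemma adZ X a Y : ad X (a *: Y) = a *: ad X Y.
Proof. by rewrite /ad -scalerAr -scalerAl scalerBr. Qed.
Lemma adDl X Y Z : ad (X + Y) Z = ad X Z + ad Y Z.
Proof. by rewrite /ad mulrDl mulrDr opprD addrACA. Qed.
Lemma adZl X a Y : ad (a *: X) Y = a *: ad X Y.
Proof. by rewrite /ad -scalerAr -scalerAl scalerBr. Qed.
Lemma adN X Y : ad X Y = - ad Y X. Proof. by rewrite /ad opprB. Qed.
Lemma ad_jacobi X Y Z : ad (ad X Y) Z = ad X (ad Y Z) - ad Y (ad X Z).
Proof.
by apply: opP => f; rewrite /ad !(opBE, opME) !raddfB /= ; ring.
Qed.
Lemma spec_op_ad X U (U0 U1 : op) : spec_op U U0 U1 ->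
  spec_op (fun i => ad X (U i)) (ad X U0) (ad X U1).
Proof.
move=> h; have := spec_opB (spec_opMc X 1 h) (spec_opMc 1 X h).
by rewrite !mulr1 !mul1r => h'; apply: spec_op_ext h' => i; rewrite mulr1 mul1r.
Qed.

Fact ads0 s : ads s 0 = 0.
Proof. by elim: s => //= x s ->; rewrite ad0. Qed.
Lemma adsD s Y Z : ads s (Y + Z) = ads s Y + ads s Z.
Proof. by elim: s => //= x s ->; rewrite adD. Qed.
Lemma adsZ s a Y : ads s (a *: Y) = a *: ads s Y.
Proof. by elim: s => //= x s ->; rewrite adZ. Qed.

(** Differentiating [x ^ i] at [i = 0] turns one factor [shiftAd] after the other into a
bracket. *)
Lemma ads_shiftAds s1 s2 y : Gs s1 -> Gs s2 -> G y -> (size s1 + size s2)%N = c ->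
  ads s1 (shiftAds s2 (fdlog y)) = 0.
Proof.
elim/last_ind: s1 s2 => [|s1 x IH] s2 h1 h2 Gy sc; first exact: shiftAds_log.
move: h1; rewrite -cats1 => /Gs_cat[h1 hx]; have Gx : G x by apply: hx; rewrite inE.
rewrite /ads foldr_cat /= -/(ads _ _); set Z := shiftAds s2 _.
have h0 i : ads s1 (shiftAd (x ^+ i)%g Z) = 0.
  apply: (IH ((x ^+ i)%g :: s2)) => //; last by rewrite -sc size_rcons addSnnS.
  by rewrite -cat1s; apply: Gs_catI => // y'; rewrite inE => /eqP ->; apply: GX.
have hs : spec_op (fun i => shiftAd (x ^+ i)%g Z) (Z - Z) (ad (fdlog x) Z).
  have h3 := spec_opM (spec_opMc 1 Z (spec_starV x)) (spec_star x).
  have h4 := spec_opB (spec_op_const Z) h3.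
  rewrite !mul1r !mulr1 sub0r mulNr opprB in h4.
  by apply: spec_op_ext h4 => i; rewrite /shiftAd mul1r.
have {}hs : spec_op (fun i => ads s1 (shiftAd (x ^+ i)%g Z)) 0 (ads s1 (ad (fdlog x) Z)).
  elim: (s1) => [|x' s' IHs] /=; first by rewrite -(subrr Z).
  by rewrite -(ad0 (fdlog x')); apply: spec_op_ad.
have hc : spec_op (fun i => ads s1 (shiftAd (x ^+ i)%g Z)) 0 0.
  by apply: spec_op_ext (spec_op_const 0) => i; rewrite h0.
by have [_] := spec_op_uniq hs hc.
Qed.

Lemma ads_log s y : Gs s -> G y -> (c <= size s)%N -> ads s (fdlog y) = 0.
Proof.
move=> hs Gy cs; have := hs; rewrite -{1}(cat_take_drop (size s - c) s).
move=> /Gs_cat[h1 h2]; rewrite -(cat_take_drop (size s - c) s) /ads foldr_cat.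
rewrite -[X in foldr _ X (take _ _)]/(ads _ (shiftAds [::] (fdlog y))).
rewrite ads_shiftAds //; last by rewrite size_drop subKn // addn0.
exact: ads0.
Qed.

(** The spans of the brackets of more than [i] logarithms of elements of [G]: the lower
central series of the Lie algebra [lie] that they generate. Right-normed brackets
suffice by the Jacobi identity. *)
Inductive fil : nat -> op -> Prop :=
| fil_log x : G x -> fil 0 (fdlog x)
| fil_ad i x Y : G x -> fil i Y -> fil i.+1 (ad (fdlog x) Y)
| fil_weak i Y : fil i.+1 Y -> fil i Y
| fil0 i : fil i 0
| filD i Y Z : fil i Y -> fil i Z -> fil i (Y + Z)
| filZ i a Y : fil i Y -> fil i (a *: Y).

Definition lie := fil 0.

Lemma fil_leq i j Y : (i <= j)%N -> fil j Y -> fil i Y.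
Proof.
move=> /subnK <-; elim: (j - i)%N => // k IH h; apply: IH.
by apply: fil_weak.
Qed.

Lemma fil_lie i Y : fil i Y -> lie Y.
Proof. exact: fil_leq. Qed.

Lemma filN i Y : fil i Y -> fil i (- Y).
Proof. by rewrite -scaleN1r; apply: filZ. Qed.

Lemma filB i Y Z : fil i Y -> fil i Z -> fil i (Y - Z).
Proof. by move=> h1 h2; apply: filD => //; apply: filN. Qed.

Lemma fil_eq0 Y : fil c Y -> Y = 0.
Proof.
suff h i Z : fil i Z -> forall s, Gs s -> (c <= i + size s)%N -> ads s Z = 0.
  by move=> hY; apply: (h _ _ hY [::]); rewrite ?addn0 // => ?.
elim=> {i Z} [x Gx s hs cs|i x Z Gx hZ IH s hs cs|i Z hZ IH s hs cs|i s _ _|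
  i Y1 Y2 _ IH1 _ IH2 s hs cs|i a Z _ IH s hs cs].
- exact: ads_log.
- have := IH (rcons s x); rewrite -cats1 /ads foldr_cat; apply.
    by apply: Gs_catI => // y; rewrite inE => /eqP ->.
  by rewrite size_cat addnA addn1 -addSn.
- by apply: IH => //; apply: leq_trans cs _; rewrite addSn.
- exact: ads0.
- by rewrite adsD IH1 ?IH2 ?addr0.
- by rewrite adsZ IH ?scaler0.
Qed.

Lemma fil_bracket i Y Z : lie Y -> fil i Z -> fil i.+1 (ad Y Z).
Proof.
suff h j : fil j Y -> forall i' Z', fil i' Z' -> fil i'.+1 (ad Y Z') by move=> /h; apply.
elim=> {j Y} [x Gx|j x Y Gx _ IH|j Y _ IH|j|j Y1 Y2 _ IH1 _ IH2|j a Y _ IH] i' Z' hZ.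
- exact: fil_ad.
- rewrite ad_jacobi; apply: filB; first by apply/fil_weak/fil_ad/IH.
  by apply/fil_weak/IH/fil_ad.
- exact: IH.
- by rewrite /ad mul0r mulr0 subrr; apply: fil0.
- by rewrite adDl; apply: filD; [apply: IH1|apply: IH2].
- by rewrite adZl; apply: filZ; apply: IH.
Qed.

Lemma lie_bracket Y Z : lie Y -> lie Z -> lie (ad Y Z).
Proof. by move=> hY hZ; apply/fil_weak/fil_bracket. Qed.

Lemma iter_ad_lie Y Z : lie Y -> lie Z -> iter c (ad Y) Z = 0.
Proof.
move=> hY hZ; apply: fil_eq0; elim: c => [//|i IH]; exact: fil_bracket.
Qed.

(** Commuting the factors [T - l] past [Y] one at a time replaces [Y] by brackets of [T]
with [Y], which are eventually small. *)
Lemma geigen_ad k T l m N Y v : small k (iter m (ad T) Y) -> geigen k T l N v ->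
  geigen k T l (N + m) (Y v).
Proof.
have [d] := ubnP (N + m)%N; elim: d m N Y v => // d IH m N Y v; rewrite ltnS => hd.
case: m hd => [|m] hd hY hv; first by apply: op_vanish; exact: (hY v).
case: N hd hv => [|N] hd hv.
  by rewrite /geigen -opME; apply: op_vanish.
have e : (T - l%:A) * Y = Y * (T - l%:A) + ad T Y.
  rewrite /ad mulrBl mulrBr -scalerAl -scalerAr mul1r mulr1.
  by rewrite [RHS]addrC addrA subrK.
rewrite /geigen addSn exprS opME -[(T - l%:A) (Y v)]/((Y * (T - l%:A)) v).
have -> : Y * (T - l%:A) = (T - l%:A) * Y - ad T Y by rewrite e addrK.
rewrite opBE raddfB /=; apply: vanishB.
  apply: (IH m.+1 N Y) => //.
  by move: hv; rewrite /geigen exprS.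
rewrite -addSnnS; apply: (IH m N.+1 (ad T Y)) => //.
  by rewrite addSnnS.
by rewrite -iterSr.
Qed.

(** [S] acts by scalars on the generalized eigenspaces of [T], and [Y] preserves them. *)
Lemma small_commute k T S Y m : op_unit T ->
  (forall l N v, geigen k T l N v -> vanish k (S v - l *: v)) ->
  small k (iter m (ad T) Y) -> small k (ad S Y).
Proof.
move=> Tu hS hY f; have [N [e [e1 eN]]] := unit_decomposition k Tu.
have -> : f = (1 - \sum_(x <- e) horner_alg T x.2) f +
              \sum_(x <- e) horner_alg T x.2 f.
  by rewrite opBE op1E op_sumE subrK.
rewrite raddfD; apply: vanishD; first exact: (op_vanish (ad S Y) (e1 f)).
rewrite raddf_sum big_seq; apply: vanish_sum => x xe; have [_ /(_ f) hx] := eN x xe.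
set v := horner_alg T x.2 f in hx *.
have ev : ad S Y v = Y (S v - x.1 *: v) - (S (Y v) - x.1 *: Y v).
  by rewrite raddfB /= linearZ /= opprB addrA subrK.
change (vanish k (ad S Y v)); rewrite ev.
apply: vanishB; first by apply/op_vanish/(hS _ _ _ hx).
by apply: (hS _ (N + m)%N); apply: geigen_ad.
Qed.

Definition semisimple_part T := T * opexp (- oplog T).

(** Iterated brackets of [star x] with a logarithm vanish because [G] is nilpotent. *)
Lemma lie_semisimple x Y : G x -> lie Y -> ad (semisimple_part (star x)) Y = 0.
Proof.
move=> Gx; set S := semisimple_part _.
have hlog y : G y -> ad S (fdlog y) = 0.
  move=> Gy; apply: small_eq0 => k.
  apply: (@small_commute _ (star x) _ _ c (star_unit x)).
    by move=> l N v; apply: geigen_semisimple; exact: star_unit.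
  have e Z : ad (star x) Z = star x * shiftAd x Z.
    by rewrite /shiftAd mulrBr !mulrA starVr mul1r.
  have -> : iter c (ad (star x)) (fdlog y) =
      star x ^+ c * shiftAds (nseq c x) (fdlog y).
    elim: (c) => [|i IH] /=; first by rewrite expr0 mul1r.
    rewrite IH e /shiftAd exprS.
    have cx : star x^-1%g * star x ^+ i = star x ^+ i * star x^-1%g.
      by apply: commrX; rewrite /GRing.comm starV starVr.
    rewrite -[RHS]mulrA; congr (_ * _); rewrite mulrBr; congr (_ - _).
    by rewrite !mulrA cx.
  rewrite shiftAds_log ?size_nseq ?mulr0 //.
  by move=> z /nseqP[->].
elim=> {Y} [y Gy|i y Y Gy _ IH|i Y _ IH|i|i Y1 Y2 _ IH1 _ IH2|i a Y _ IH].
- exact: hlog.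
- have e : ad S (ad (fdlog y) Y) = ad (ad S (fdlog y)) Y + ad (fdlog y) (ad S Y).
    by rewrite ad_jacobi subrK.
  by rewrite e IH ad0 addr0 hlog // /ad mul0r mulr0 subrr.
- exact: IH.
- exact: ad0.
- by rewrite adD IH1 IH2 addr0.
- by rewrite adZ IH scaler0.
Qed.

End LieAlgebra.

(** * Nilpotency of the elements of the Lie algebra *)

Section Traces.
Variable K : numClosedFieldType.

Lemma mxtrace_single_eigenvalue m (M : 'M[K]_m) (mu : K) :
  (forall a, eigenvalue M a -> a = mu) -> \tr M = m%:R * mu.
Proof.
case: m M => [|m] M hM; first by rewrite /mxtrace big_ord0 mul0r.
have [r rE] := closed_field_poly_normal (char_poly M).
move: rE; rewrite (monicP (char_poly_monic M)) scale1r => rE.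
have sr : size r = m.+1.
  by apply: succn_inj; rewrite -(size_char_poly M) rE size_prod_XsubC.
have rmu z : z \in r -> z = mu.
  by move=> zr; apply: hM; rewrite eigenvalue_root_char rE root_prod_XsubC.
apply: oppr_inj; rewrite -char_poly_trace // rE.
have -> : m.+1.-1 = (size r).-1 by rewrite sr.
rewrite coefPn_prod_XsubC ?sr //; congr (- _).
rewrite (eq_big_seq (fun _ => mu)) => [|z /rmu //].
by rewrite big_const_seq count_predT sr iter_addr_0 mulr_natl.
Qed.

End Traces.

Section Engel.
Variables (K : numClosedFieldType) (n : nat).
Local Notation A := (fseries K n).
Local Notation op := (op K n).
Local Notation fdiff := (fdiff K n).
Implicit Types (S T X Y Z : op) (k N m i : nat) (l : K) (x y : fdiff).

Lemma lmxX k T N (v : 'rV[K]_(level_dim n k).+1) (a : K) :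
  v *m lmx k T = a *: v -> v *m lmx k (T ^+ N) = a ^+ N *: v.
Proof.
move=> va; elim: N => [|N IH]; first by rewrite !expr0 lmx1 mulmx1 scale1r.
by rewrite !exprSr lmxM mulmxA IH -scalemxAl va scalerA.
Qed.

Lemma lmx_ad k X Y :
  lmx k (ad X Y) = lmx k X *m lmx k Y - lmx k Y *m lmx k X.
Proof. by rewrite /ad linearB /= !lmxM. Qed.

Lemma nilp_eigenvalue k X a : nilp_op X -> eigenvalue (lmx k X) a -> a = 0.
Proof.
move=> nX /eigenvalueP[v va v0]; have [N /lmx_eq0 hN] := nX k.+1.
have := lmxX N va; rewrite hN mulmx0 => /esym/eqP.
by rewrite scaler_eq0 (negbTE v0) orbF expf_eq0 => /andP[_ /eqP].
Qed.

Variables (G : set fdiff) (c : nat).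
Hypotheses (gG : subgroup G) (nilG : lower_central_series G c = [set 1%g]%classic).
Local Notation lie := (lie G).

(** A nilpotent Lie algebra preserves the generalized eigenspaces of each of its
elements [Y]. On the one for [mu], logarithms of automorphisms have trace zero
because they are nilpotent, and so do brackets; thus [Y] has trace zero, while
[mu] is its only eigenvalue. *)
Lemma lie_eigenvalue k Y mu : lie Y -> eigenvalue (lmx k Y) mu -> mu = 0.
Proof.
move=> lY emu; set M := lmx k Y in emu *.
have p0 : char_poly M != 0 by rewrite monic_neq0 ?char_poly_monic.
have [a [r]] := multiplicity_XsubC (char_poly M) mu; rewrite p0 /= => rmu pE.
pose V := kermx (lmx k ((Y - mu%:A) ^+ a)); pose B := row_base V.
have freeB : row_free B by apply: row_base_free.
have VP m (W : 'M_(m, _)) : (W <= V)%MS = (W *m lmx k ((Y - mu%:A) ^+ a) == 0).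
  by rewrite sub_kermx.
have stab f N : geigen k.+1 Y mu N f -> geigen k.+1 Y mu a f.
  move=> hf.
  have : coprimep r (('X - mu%:P) ^+ N) by rewrite coprimep_expr // coprimep_XsubC.
  case/Bezout_eq1_coprimepP => -[u w] /= uw.
  have e : (Y - mu%:A) ^+ a =
      horner_alg Y (char_poly M * u) + (Y - mu%:A) ^+ N * horner_alg Y (w * ('X - mu%:P) ^+ a).
    have eN j : (Y - mu%:A) ^+ j = horner_alg Y (('X - mu%:P) ^+ j).
      by rewrite rmorphXn rmorphB /= horner_algX horner_algC.
    rewrite !eN -rmorphM -rmorphD /= pE; congr (horner_alg Y _).
    rewrite -[LHS]mul1r -uw; set b := _ ^+ a; set d := _ ^+ N; ring.
  rewrite /geigen e opDE; apply: vanishD; last by rewrite opME; apply: op_vanish.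
  suff h : small k.+1 (horner_alg Y (char_poly M * u)) by apply: h.
  apply/lmx_eq0; rewrite lmx_horner rmorphM /= -/M Cayley_Hamilton.
  by rewrite mul0r.
have stabT T : lie T -> (V *m lmx k T <= V)%MS.
  move=> lT; apply/row_subP => i; rewrite row_mul.
  have [f fE] := lrow_surj (row i V); rewrite -fE -lrow_op VP -lrow_op.
  apply/eqP/lrow_eq0; apply: (@stab _ (a + c)); apply: geigen_ad.
    by rewrite (iter_ad_lie gG nilG) //; apply: small0.
  apply/lrow_eq0; rewrite lrow_op fE; apply/eqP; rewrite -VP; exact: row_sub.
have stabB T : lie T -> stablemx B (lmx k T).
  by move=> lT; rewrite (eqmxMr _ (eq_row_base V)) eq_row_base stabT.
pose t T := \tr (conjmx B (lmx k T)).
have tD S T : t (S + T) = t S + t T.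
  by rewrite /t /conjmx linearD /= mulmxDr mulmxDl linearD.
have tZ b T : t (b *: T) = b * t T.
  by rewrite /t /conjmx linearZ /= -scalemxAr -scalemxAl linearZ.
have t0 i T : fil G i T -> t T = 0.
  elim=> {i T} [x Gx|i x T Gx hT _|//|i|i S T _ hS _ hT|i b T _ hT].
  - rewrite /t (@mxtrace_single_eigenvalue _ _ _ 0) ?mulr0 // => b hb.
    apply: (@nilp_eigenvalue k (fdlog x)); first exact/oplog_nilp/star_unit.
    by apply: eigenvalue_conjmx hb; [apply/stabB/fil_log|].
  - have lx : lie (fdlog x) by apply: fil_log.
    have lT := fil_lie hT.
    rewrite /t lmx_ad /conjmx mulmxBr mulmxBl linearB /= -!/(conjmx B _).
    rewrite !conjmxM ?inE ?stabB // mxtrace_mulC subrr //.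
  - by rewrite -(scale0r (0 : op)) tZ mul0r.
  - by rewrite tD hS hT addr0.
  - by rewrite tZ hT mulr0.
have := t0 _ _ lY; rewrite /t (@mxtrace_single_eigenvalue _ _ _ mu).
  move/eqP; rewrite mulf_eq0 pnatr_eq0 mxrank_eq0 => /orP[/eqP V0|/eqP //].
  case/eigenvalueP: emu => v vmu v0.
  suff : (v <= V)%MS by rewrite V0 submx0 (negbTE v0).
  have [f fE] := lrow_surj v; rewrite VP -fE -lrow_op; apply/eqP/lrow_eq0.
  apply: (@stab _ 1%N); apply/lrow_eq0; rewrite lrow_op fE expr1 linearB linearZ /= lmx1.
  by rewrite mulmxBr vmu -scalemxAr mulmx1 subrr.
move=> b /eigenvalueP[w wb w0].
have wB0 : w *m B != 0 by rewrite mulmx_free_eq0.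
have wM : (w *m B) *m M = b *: (w *m B).
  have BM : B *m M = conjmx B M *m B by rewrite /conjmx mulmxKpV // stabB.
  by rewrite -mulmxA BM mulmxA wb scalemxAl.
have wV : (w *m B <= V)%MS by rewrite (submx_trans (submxMl _ _)) // eq_row_base.
have wM' : (w *m B) *m lmx k (Y - mu%:A) = (b - mu) *: (w *m B).
  by rewrite linearB linearZ /= lmx1 mulmxBr wM -scalemxAr mulmx1 scalerBl.
move: wV; rewrite VP (lmxX a wM') scaler_eq0 (negbTE wB0) orbF expf_eq0.
by rewrite subr_eq0 => /andP[_ /eqP].
Qed.

(** All eigenvalues vanish, so that the characteristic polynomial is a power of ['X]. *)
Lemma lie_small k Y : lie Y -> small k.+1 (Y ^+ (level_dim n k).+1).
Proof.
move=> lY; apply/lmx_eq0.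
have [r rE] := closed_field_poly_normal (char_poly (lmx k Y)).
move: rE; rewrite (monicP (char_poly_monic _)) scale1r => rE.
have sr : size r = (level_dim n k).+1.
  by apply: succn_inj; rewrite -(size_char_poly (lmx k Y)) rE size_prod_XsubC.
have r0 z : z \in r -> z = 0.
  move=> zr; apply: (@lie_eigenvalue k _ _ lY).
  by rewrite eigenvalue_root_char rE root_prod_XsubC.
have pE : char_poly (lmx k Y) = 'X^((level_dim n k).+1).
  rewrite rE (eq_big_seq (fun _ => 'X)) => [|z /r0 ->]; last by rewrite subr0.
  by rewrite big_const_seq count_predT sr iter_mulr_1.
have := Cayley_Hamilton (lmx k Y); rewrite pE -lmx_horner rmorphXn /=.
by rewrite horner_algX.
Qed.

Lemma lie_nilp Y : lie Y -> nilp_op Y.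
Proof.
move=> lY k; exists (level_dim n k).+1; apply: (small_leq (leqnSn k)).
exact: lie_small.
Qed.

End Engel.

(** * The Campbell-Hausdorff product *)

Section RingBracket.
Variable R : nzRingType.
Implicit Types (x y z : R).

Definition rbr x y := x * y - y * x.

Lemma iter_rad0 x j : iter j (rbr x) 0 = 0.
Proof. by elim: j => //= j ->; rewrite /rbr mulr0 mul0r subrr. Qed.

(** This collects the derivative of [L] on the right in the derivative of a power of [L]. *)
Lemma mulr_exp_rad x y b : y * x ^+ b =
  \sum_(j < b.+1) ((-1) ^+ j * (x ^+ (b - j) * iter j (rbr x) y)) *+ 'C(b, j).
Proof.
elim: b => [|b IH]; first by rewrite big_ord1 !expr0 mulr1 !mul1r.
rewrite exprSr mulrA IH mulr_suml.
have e (j : 'I_b.+1) : ((-1) ^+ j * (x ^+ (b - j) * iter j (rbr x) y)) *+ 'C(b, j) * x =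
    ((-1) ^+ j * (x ^+ (b - j).+1 * iter j (rbr x) y)) *+ 'C(b, j) +
    ((-1) ^+ j.+1 * (x ^+ (b - j) * iter j.+1 (rbr x) y)) *+ 'C(b, j).
  rewrite mulrnAl -mulrnDl; congr (_ *+ _).
  rewrite [iter j.+1 _ _]iterS {2}/rbr exprSr exprS mulN1r !mulNr.
  rewrite -!mulrA -mulrBr; congr (_ * _).
  rewrite -mulrBr; congr (_ * _).
  by rewrite opprB addrC subrK.
under eq_bigr do rewrite e.
rewrite big_split /= addrC big_ord_recr /= [X in _ + X]big_ord_recl /=.
rewrite [RHS]big_ord_recl [in RHS]big_ord_recr /= !subn0 !subnn !bin0 !binn.
rewrite [bump 0 b]/bump /= add1n [LHS]addrC -!addrA; congr (_ + _).
rewrite addrA; congr (_ + _); rewrite -big_split /=.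
by apply: eq_bigr => j _; rewrite /bump /= !add1n binS mulrnDr -subSn.
Qed.

End RingBracket.

Lemma deriv_exp_rad (R : nzRingType) (L : {poly R}) b : (L ^+ b)^`() =
  \sum_(j < b) ((-1) ^+ j * (L ^+ (b - j.+1) * iter j (rbr L) L^`())) *+ 'C(b, j.+1).
Proof.
elim: b => [|b IH]; first by rewrite expr0 derivC big_ord0.
rewrite exprS derivM IH mulr_exp_rad mulr_sumr.
have -> : \sum_(i < b) L * ((-1) ^+ i * (L ^+ (b - i.+1) * iter i (rbr L) L^`())
      *+ 'C(b, i.+1)) =
    \sum_(i < b.+1) ((-1) ^+ i * (L ^+ (b - i) * iter i (rbr L) L^`())) *+ 'C(b, i.+1).
  rewrite big_ord_recr /= bin_small // mulr0n addr0; apply: eq_bigr => i _.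
  rewrite mulrnAr; congr (_ *+ _).
  have -> : L * ((-1) ^+ i * (L ^+ (b - i.+1) * iter i (rbr L) L^`())) =
      (-1) ^+ i * (L * (L ^+ (b - i.+1) * iter i (rbr L) L^`())).
    by rewrite !mulrA; congr (_ * _ * _); apply: commr_sign.
  by rewrite [L * (_ * _)]mulrA -exprS subnSK.
rewrite -big_split /=; apply: eq_bigr => i _.
by rewrite -mulrnDr subSS binS addnC.
Qed.

Lemma sum_ord_shift (V : nmodType) M j (F : nat -> V) :
  \sum_(b < M | (j < b)%N) F (b - j.+1)%N = \sum_(i < M - j.+1) F i.
Proof.
have [jM|Mj] := ltnP j M; last first.
  rewrite (eqP (leqW Mj : (M - j.+1)%N == 0%N)) big_ord0 big1 // => b jb.
  by have := ltn_trans jb (ltn_ord b); rewrite ltnNge Mj.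
rewrite -(big_mkord (fun b => (j < b)%N) (fun b => F (b - j.+1)%N)).
rewrite (@big_cat_nat _ _ _ j.+1) //= big_nat_cond big1 ?add0r; last first.
  by move=> i /andP[/andP[_ ij] ji]; move: ij; rewrite ltnS leqNgt ji.
rewrite big_nat_cond (eq_bigl (fun i => (j.+1 <= i < M)%N && true)) -?big_nat_cond.
  by rewrite -{1}[j.+1]add0n big_addn big_mkord; apply: eq_bigr => i _; rewrite addnK.
by move=> i /=; case: (ltnP j i) => //; rewrite ?andbT ?andbF.
Qed.

Section PolyOperators.
Variables (K : numClosedFieldType) (n : nat).
Local Notation A := (fseries K n).
Local Notation op := (op K n).
Implicit Types (S T X Y Z : op) (p q P Q L : {poly op}) (k N M m i j : nat) (a b : K).

Definition pscale a p : {poly op} := (a%:A : op) *: p.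
Local Notation "a %*: p" := (pscale a p) (at level 40).

Lemma coef_pscale a p i : (a %*: p)`_i = a *: p`_i.
Proof. by rewrite coefZ mulr_algl. Qed.

Lemma pscaleAl a p q : (a %*: p) * q = a %*: (p * q).
Proof. by rewrite /pscale scalerAl. Qed.

Lemma pscaleAr a p q : p * (a %*: q) = a %*: (p * q).
Proof.
apply/polyP => i; rewrite coef_pscale !coefM scaler_sumr; apply: eq_bigr => j _.
by rewrite coef_pscale scalerAr.
Qed.

Lemma pscaleA a b p : a %*: (b %*: p) = (a * b) %*: p.
Proof. by apply/polyP => i; rewrite !coef_pscale scalerA. Qed.

Lemma pscaleBr a p q : a %*: (p - q) = a %*: p - a %*: q.
Proof. by rewrite /pscale scalerBr. Qed.

Lemma pscale_sumr a (I : Type) (r : seq I) (F : I -> {poly op}) :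
  a %*: (\sum_(x <- r) F x) = \sum_(x <- r) a %*: F x.
Proof. by rewrite /pscale scaler_sumr. Qed.

Lemma deriv_pscale a p : (a %*: p)^`() = a %*: p^`().
Proof. by rewrite /pscale derivZ. Qed.

Lemma pscale_nat m p : m%:R %*: p = p *+ m.
Proof. by apply/polyP => i; rewrite coef_pscale coefMn scaler_nat. Qed.

Lemma pscale_sign j p : (-1) ^+ j * p = ((-1) ^+ j) %*: p.
Proof.
rewrite -signr_odd -[in RHS]signr_odd mulr_sign; apply/polyP => i.
by rewrite coef_pscale; case: (odd j); rewrite ?expr0 ?expr1 ?scale1r ?scaleN1r ?coefN.
Qed.

Definition psmall k p := forall i, small k p`_i.

Lemma psmall0 k : psmall k 0.
Proof. by move=> i; rewrite coef0; apply: small0. Qed.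
Lemma psmallD k p q : psmall k p -> psmall k q -> psmall k (p + q).
Proof. by move=> hp hq i; rewrite coefD; apply: smallD. Qed.
Lemma psmallB k p q : psmall k p -> psmall k q -> psmall k (p - q).
Proof. by move=> hp hq i; rewrite coefB; apply: smallB. Qed.
Lemma psmallMl k p q : psmall k q -> psmall k (p * q).
Proof. by move=> hq i; rewrite coefM; apply: small_sum => j _; apply: smallMl. Qed.
Lemma psmallMr k p q : psmall k p -> psmall k (p * q).
Proof. by move=> hq i; rewrite coefM; apply: small_sum => j _; apply: smallMr. Qed.
Lemma psmall_scale k a p : psmall k p -> psmall k (a %*: p).
Proof. by move=> hp i; rewrite coef_pscale; apply: smallZ. Qed.
Lemma psmall_sum k (I : Type) (r : seq I) (B : pred I) (F : I -> {poly op}) :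
  (forall x, B x -> psmall k (F x)) -> psmall k (\sum_(x <- r | B x) F x).
Proof.
by move=> h; elim/big_ind: _ => //; [exact: psmall0|move=> p q; exact: psmallD].
Qed.

Definition pexp N L : {poly op} := \sum_(b < N) (b`!%:R^-1) %*: L ^+ b.

Lemma pexp_leq k N M L : (N <= M)%N -> psmall k (L ^+ N) ->
  psmall k (pexp M L - pexp N L).
Proof.
move=> /subnKC <- h; rewrite /pexp big_split_ord /= addrAC subrr add0r.
by apply: psmall_sum => i _; apply: psmall_scale; rewrite exprD; apply: psmallMr.
Qed.

(** The coefficients of [(1 - exp (- z)) / z]. *)
Definition dexpc j : K := (-1) ^+ j / (j.+1)`!%:R.

Definition dexp d L P := \sum_(j < d) dexpc j %*: iter j (rbr L) P.

(** The formula [(exp L)' = exp L * dexp (ad L) L'] for truncated series. *)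
Lemma deriv_pexp k N d L : psmall k (L ^+ N) ->
  (forall j, (d <= j)%N -> iter j (rbr L) L^`() = 0) ->
  psmall k ((pexp (N + d) L)^`() - pexp N L * dexp d L L^`()).
Proof.
move=> hN hd; pose W j := iter j (rbr L) L^`().
pose F (b j : nat) := dexpc j %*: (((b - j.+1)`!%:R^-1 %*: L ^+ (b - j.+1)) * W j).
have e1 : (pexp (N + d) L)^`() = \sum_(b < N + d) \sum_(j < b) F b j.
  rewrite /pexp raddf_sum; apply: eq_bigr => b _.
  rewrite [LHS]deriv_pscale deriv_exp_rad pscale_sumr; apply: eq_bigr => j _.
  rewrite /F pscaleAl pscale_sign -pscale_nat !pscaleA -/(W j).
  congr (_ %*: _); rewrite /dexpc.
  have E : b`!%:R = 'C(b, j.+1)%:R * (j.+1`!%:R * (b - j.+1)`!%:R) :> K.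
    by rewrite -!natrM bin_fact.
  have c0 : 'C(b, j.+1)%:R != 0 :> K by rewrite pnatr_eq0 -lt0n bin_gt0.
  have u0 : j.+1`!%:R != 0 :> K by rewrite pnatr_eq0 -lt0n fact_gt0.
  have v0 : (b - j.+1)`!%:R != 0 :> K by rewrite pnatr_eq0 -lt0n fact_gt0.
  rewrite E; move: c0 u0 v0; move: _%:R (j.+1`!%:R) ((b - j.+1)`!%:R) => x y z x0 y0 z0.
  by field; rewrite x0 y0 z0.
have e2 : (pexp (N + d) L)^`() =
    \sum_(j < d) dexpc j %*: (pexp (N + d - j.+1) L * W j).
  rewrite e1 (eq_bigr (fun b : 'I_(N + d) => \sum_(j < N + d | (j < b)%N) F b j)); last first.
    by move=> b _; rewrite (big_ord_widen _ _ (ltnW (ltn_ord b))).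
  rewrite (exchange_big_dep xpredT) //= -[RHS](@sum_ord_trim _ d (N + d)
    (fun j => dexpc j %*: (pexp (N + d - j.+1) L * W j))) ?leq_addl //; last first.
    by move=> j dj; rewrite /W hd // mulr0 /pscale scaler0.
  apply: eq_bigr => j _; rewrite /F /pscale -scaler_sumr; congr (_ *: _).
  rewrite -mulr_suml; congr (_ * _).
  exact: (@sum_ord_shift _ _ j (fun i => (i`!%:R^-1)%:A *: L ^+ i)).
rewrite e2 /dexp mulr_sumr -sumrB; apply: psmall_sum => j _.
rewrite pscaleAr -pscaleBr -mulrBl; apply/psmall_scale/psmallMr.
apply: pexp_leq => //; rewrite -addnBA //; apply: leq_addr.
Qed.

End PolyOperators.

Section CampbellHausdorff.
Variables (K : numClosedFieldType) (n : nat).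
Local Notation A := (fseries K n).
Local Notation op := (op K n).
Local Notation fdiff := (fdiff K n).
Implicit Types (S T X Y Z : op) (p q P Q L : {poly op}) (k N M m i j : nat) (a b : K).
Local Notation "a %*: p" := (pscale a p) (at level 40).

(** The primitive without constant term. *)
Definition pint p : {poly op} := \poly_(i < (size p).+1) (i%:R^-1 *: p`_i.-1).

Lemma coef_pint0 p : (pint p)`_0 = 0.
Proof. by rewrite coef_poly /= invr0 scale0r. Qed.

Lemma coef_pintS p i : (pint p)`_i.+1 = i.+1%:R^-1 *: p`_i.
Proof.
rewrite coef_poly ltnS; case: ltnP => // h.
by rewrite nth_default ?scaler0.
Qed.

Lemma deriv_pint p : (pint p)^`() = p.
Proof.
apply/polyP => i; rewrite coef_deriv coef_pintS -scaler_nat scalerA divff ?scale1r ?pnatr_eq0 //.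
Qed.

Lemma horner_alg_exp p a N : (p ^+ N).[a%:A] = p.[a%:A] ^+ N.
Proof.
elim: N => [|N IH]; first by rewrite !expr0 hornerC.
rewrite !exprSr hornerM_comm ?IH // /comm_poly.
by rewrite mulr_algl -scalerAr mulr1.
Qed.

(** Apply to each entry that a polynomial over [K] vanishing at the natural numbers is
zero. *)
Lemma psmall_values k p : (forall a, small k p.[a%:A]) -> psmall k p.
Proof.
move=> h i f x xk; pose q : {poly K} := \poly_(j < size p) (p`_j f x).
have : q = 0.
  apply: poly_nat_eq0 => m; rewrite (@horner_coef_wide _ (size p)) ?size_poly //.
  have := h m%:R f x xk; rewrite horner_coef op_sumE fs_sumE => e; rewrite -[RHS]e.
  apply: eq_bigr => j _; rewrite coef_poly ltn_ord.
  by rewrite exprZn expr1n -scalerAr mulr1 opZE fsZE mulrC.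
move/(congr1 (fun r : {poly K} => r`_i)); rewrite coef_poly coef0.
by case: ltnP => // si _; rewrite nth_default.
Qed.

Definition linear_pred (h : op -> Prop) :=
  [/\ h 0, forall X Y, h X -> h Y -> h (X + Y) & forall a X, h X -> h (a *: X)].

Definition pcoef (h : op -> Prop) p := forall i, h p`_i.

Section Pcoef.
Variable h : op -> Prop.
Hypothesis hlin : linear_pred h.

Lemma linear_pred_sum (I : Type) (r : seq I) (B : pred I) (F : I -> op) :
  (forall x, B x -> h (F x)) -> h (\sum_(x <- r | B x) F x).
Proof. by case: hlin => h0 hD _ hF; elim/big_ind: _. Qed.

Lemma linear_predN X : h X -> h (- X).
Proof. by case: hlin => _ _ hZ /(hZ (-1)); rewrite scaleN1r. Qed.

Lemma pcoefD p q : pcoef h p -> pcoef h q -> pcoef h (p + q).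
Proof. by case: hlin => _ hD _ hp hq i; rewrite coefD; apply: hD. Qed.
Lemma pcoefN p : pcoef h p -> pcoef h (- p).
Proof. by move=> hp i; rewrite coefN; apply: linear_predN. Qed.
Lemma pcoefB p q : pcoef h p -> pcoef h q -> pcoef h (p - q).
Proof. by move=> hp hq; apply: pcoefD => //; apply: pcoefN. Qed.
Lemma pcoefC X : h X -> pcoef h X%:P.
Proof. by case: hlin => h0 _ _ hX i; rewrite coefC; case: ifP. Qed.
Lemma pcoef_scale a p : pcoef h p -> pcoef h (a %*: p).
Proof. by case: hlin => _ _ hZ hp i; rewrite coef_pscale; apply: hZ. Qed.
Lemma pcoef_sum (I : Type) (r : seq I) (B : pred I) (F : I -> {poly op}) :
  (forall x, B x -> pcoef h (F x)) -> pcoef h (\sum_(x <- r | B x) F x).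
Proof. by move=> hF i; rewrite coef_sum; apply: linear_pred_sum => x Bx; apply: hF. Qed.
Lemma pcoef_pint p : pcoef h p -> pcoef h (pint p).
Proof.
case: hlin => h0 _ hZ hp [|i]; first by rewrite coef_pint0.
by rewrite coef_pintS; apply: hZ.
Qed.
Lemma pcoef_deriv p : pcoef h p -> pcoef h p^`().
Proof.
by case: hlin => _ _ hZ hp i; rewrite coef_deriv -scaler_nat; apply: hZ.
Qed.
Lemma pcoef_horner p a : pcoef h p -> h p.[a%:A].
Proof.
case: hlin => _ _ hZ hp; rewrite horner_coef; apply: linear_pred_sum => i _.
by rewrite exprZn expr1n -scalerAr mulr1; apply: hZ.
Qed.

End Pcoef.

Lemma pcoef_rad (h h1 h2 : op -> Prop) p q : linear_pred h2 ->
  (forall X Y, h X -> h1 Y -> h2 (ad X Y)) ->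
  pcoef h p -> pcoef h1 q -> pcoef h2 (rbr p q).
Proof.
move=> l2 had hp hq i; rewrite coefB coefM [in X in _ - X]coefMr -sumrB.
by apply: linear_pred_sum => // j _; apply: had.
Qed.

Variables (G : set fdiff) (c : nat).
Hypotheses (gG : subgroup G) (nilG : lower_central_series G c = [set 1%g]%classic).
Local Notation lie := (lie G).
Local Notation fil := (fil G).

Lemma fil_linear i : linear_pred (fil i).
Proof. by split; [exact: fil0|exact: filD|exact: filZ]. Qed.

(** The equation [dexp (ad L) L' = Y] is solved by iteration: each step gains one
bracket, so that the iteration becomes stationary in a nilpotent Lie algebra. *)
Fixpoint picard X Y i : {poly op} :=
  if i is i'.+1 then
    X%:P + pint (Y%:P - \sum_(j < c)
      dexpc K j.+1 %*: iter j.+1 (rbr (picard X Y i')) (picard X Y i')^`())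
  else X%:P.

Section Subalgebra.
Variables h h' : op -> Prop.
Hypotheses (hlin : linear_pred h) (h'lin : linear_pred h').
Hypotheses (hlie : forall X, h X -> lie X) (had : forall X Y, h X -> h Y -> h (ad X Y)).
Hypothesis had' : forall X Y, h X -> h Y -> h' (ad X Y).

Let pcoef_iter_rad L P j : pcoef h L -> pcoef h P -> pcoef h (iter j (rbr L) P).
Proof.
by move=> hL hP; elim: j => //= j IH; apply: pcoef_rad hL IH.
Qed.

Let picard_coef X Y i : h X -> h Y -> pcoef h (picard X Y i).
Proof.
move=> hX hY; elim: i => [|i IH] /=; first exact: pcoefC.
apply: pcoefD => //; first exact: pcoefC.
apply: pcoef_pint => //; apply: pcoefB => //; first exact: pcoefC.
apply: pcoef_sum => // j _; apply: pcoef_scale => //.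
by apply: (@pcoef_iter_rad _ _ j.+1) => //; apply: pcoef_deriv.
Qed.

Let pcoef_lie p : pcoef h p -> pcoef lie p.
Proof. by move=> hp i; apply: hlie. Qed.

Let iter_rad_diff i j L L1 P P1 :
  pcoef lie L -> pcoef lie L1 -> pcoef lie P -> pcoef lie P1 ->
  pcoef (fil i) (L1 - L) -> pcoef (fil i) (P1 - P) ->
  pcoef (fil i.+1) (iter j.+1 (rbr L1) P1 - iter j.+1 (rbr L) P).
Proof.
move=> hL hL1 hP hP1 dL dP.
have lit j' : pcoef lie (iter j' (rbr L) P).
  elim: j' => //= j' IH; apply: pcoef_rad hL IH; first exact: fil_linear.
  exact: lie_bracket.
have step Q Q1 : pcoef lie Q -> pcoef (fil i) (Q1 - Q) ->
    pcoef (fil i.+1) (rbr L1 Q1 - rbr L Q).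
  move=> hQ dQ.
  have -> : rbr L1 Q1 - rbr L Q = rbr L1 (Q1 - Q) - rbr Q (L1 - L).
    have radC x y : rbr x y = - rbr y x :> {poly op} by rewrite /rbr opprB.
    have radBr x y z : rbr x (y - z) = rbr x y - rbr x z :> {poly op}.
      by rewrite /rbr mulrBr mulrBl !opprB addrACA [RHS]addrACA [- (x * z) - _]addrC.
    rewrite !radBr [rbr Q L1]radC [rbr Q L]radC.
    move: (rbr L1 Q1) (rbr L1 Q) (rbr L Q) => x y z.
    by rewrite opprB opprK [- z + y]addrC addrA subrK.
  apply: pcoefB; first exact: fil_linear.
    apply: pcoef_rad hL1 dQ; first exact: fil_linear.
    by move=> X Y hX hY; apply: fil_bracket.
  apply: pcoef_rad hQ dL; first exact: fil_linear.
  by move=> X Y hX hY; apply: fil_bracket.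
elim: j => [|j IH]; first exact: step.
rewrite [iter _ (rbr L1) _]iterS [X in _ - X]iterS; apply: step => // l.
by apply: fil_weak; apply: IH.
Qed.

Let picard_diff X Y i : h X -> h Y ->
  pcoef (fil i) (picard X Y i.+1 - picard X Y i).
Proof.
move=> hX hY; elim: i => [|i IH].
  move=> l; have h1 := pcoef_lie (picard_coef 1 hX hY) l.
  have h2 := pcoef_lie (picard_coef 0 hX hY) l.
  by rewrite coefB; apply: filB.
set L1 := picard X Y i.+1; pose L := picard X Y i.
pose F P := \sum_(j < c) dexpc K j.+1 %*: iter j.+1 (rbr P) P^`().
have -> : picard X Y i.+2 - L1 = pint (Y%:P - F L1) - pint (Y%:P - F L).
  rewrite -[picard X Y i.+2]/(X%:P + pint (Y%:P - F L1)).
  by rewrite /L1 -[picard X Y i.+1]/(X%:P + pint (Y%:P - F L)) opprD addrACA subrr add0r.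
have lL : pcoef lie L by apply/pcoef_lie/picard_coef.
have lL1 : pcoef lie L1 by apply/pcoef_lie/picard_coef.
have -> p q : pint p - pint q = pint (p - q).
  apply/polyP => -[|l]; first by rewrite coefB !coef_pint0 subrr.
  by rewrite coefB !coef_pintS coefB scalerBr.
apply: pcoef_pint; first exact: fil_linear.
have -> : Y%:P - F L1 - (Y%:P - F L) = - (F L1 - F L).
  by rewrite opprB addrC addrA subrK opprB.
apply: pcoefN; first exact: fil_linear.
rewrite /F -sumrB; apply: pcoef_sum; first exact: fil_linear.
move=> j _; rewrite -pscaleBr; apply: pcoef_scale; first exact: fil_linear.
apply: iter_rad_diff => //; try by apply: pcoef_deriv => //; exact: fil_linear.
by rewrite -derivB; apply: pcoef_deriv => //; exact: fil_linear.
Qed.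

(** The exponential of [L] and [exp X * exp (t Y)] satisfy the same differential equation
[E' = E Y], and have the same value at [t = 0], when [L] starts at [X] and solves
[dexp (ad L) L' = Y]. The coefficients of the solution lie in [h], and it is [X + t Y]
modulo brackets. The value of [L] at [t = 1] is [Z]. *)
Lemma opexp_mul X Y : h X -> h Y -> exists Z,
  [/\ h Z, opexp X * opexp Y = opexp Z & h' (Z - (X + Y))].
Proof.
move=> hX hY; pose L := picard X Y c.
have hL : pcoef h L by apply: picard_coef.
have LE : L = X%:P + pint (Y%:P - \sum_(j < c) dexpc K j.+1 %*: iter j.+1 (rbr L) L^`()).
  have : picard X Y c.+1 - L = 0.
    apply/polyP => i; rewrite coef0; apply: (fil_eq0 gG nilG); exact: picard_diff.
  by move/eqP; rewrite subr_eq0 => /eqP {1}<-.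
have hL' : pcoef h L^`() by apply: pcoef_deriv.
have nilL j : (c.+1 <= j)%N -> iter j (rbr L) L^`() = 0.
  move=> cj; apply/polyP => i; rewrite coef0; apply: (fil_eq0 gG nilG).
  apply: (fil_leq (ltnW cj)).
  elim: j {cj} i => [|j IH] i; first exact: hlie.
  apply: (@pcoef_rad lie (fil j)); [exact: fil_linear| |exact: pcoef_lie|exact: IH].
  by move=> U V hU hV; apply: fil_bracket.
have dL : dexp c.+1 L L^`() = Y%:P.
  rewrite /dexp big_ord_recl /dexpc /= expr0 divr1.
  have -> : 1 %*: L^`() = L^`().
    by apply/polyP => i; rewrite coef_pscale scale1r.
  rewrite {1}LE derivD derivC add0r deriv_pint; apply: subrK.
exists L.[1]; have L1 : L.[1] = L.[(1 : K)%:A] by rewrite scale1r.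
have hZ : h L.[1] by rewrite L1; apply: pcoef_horner.
have lX := hlie hX; have lY := hlie hY; have lZ := hlie hZ.
have nX := lie_nilp gG nilG lX; have nY := lie_nilp gG nilG lY.
have nZ := lie_nilp gG nilG lZ.
split => //; last first.
  have -> : L.[1] - (X + Y) = - (pint (\sum_(j < c)
      dexpc K j.+1 %*: iter j.+1 (rbr L) L^`())).[(1 : K)%:A].
    rewrite {1}LE hornerD hornerC opprD addrACA subrr add0r.
    have -> p q : pint (p - q) = pint p - pint q.
      apply/polyP => -[|l]; first by rewrite coefB !coef_pint0 subrr.
      by rewrite coefB !coef_pintS coefB scalerBr.
    rewrite hornerD hornerN scale1r addrAC; set I := pint _.
    suff -> : I.[1] = Y by rewrite subrr add0r.
    have -> : I = Y *: 'X; last by rewrite hornerZ hornerX mulr1.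
    apply/polyP => -[|[|l]]; rewrite ?coef_pint0 ?coef_pintS coefZ coefX ?mulr0 //.
      by rewrite coefC /= invr1 scale1r mulr1.
    by rewrite coefC /= scaler0 ?mulr0.
  apply: linear_predN => //; apply: pcoef_horner => //; apply: pcoef_pint => //.
  apply: pcoef_sum => // j _; apply: pcoef_scale => //; rewrite iterS.
  by apply: (pcoef_rad h'lin had' hL); apply: pcoef_iter_rad.
suff e : opexp L.[1] * opexp (- Y) = opexp X.
  by rewrite -e -mulrA opexpNl // mulr1.
apply: small_sub_eq => k; pose M := (level_dim n k).+1.
apply: (small_leq (leqnSn k)).
pose Q : {poly op} := (- Y) *: 'X.
have Qh a : Q.[a%:A] = - (a *: Y) by rewrite hornerZ hornerX -scalerAr mulr1 scalerN.
have LM : psmall k.+1 (L ^+ M).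
  apply: psmall_values => a; rewrite horner_alg_exp; apply: (lie_small gG nilG).
  by apply: hlie; apply: (pcoef_horner hlin).
have QM : psmall k.+1 (Q ^+ M).
  apply: psmall_values => a; rewrite horner_alg_exp Qh; apply: (lie_small gG nilG).
  by apply/filN/filZ.
have Q' : Q^`() = - Y%:P by rewrite derivZ derivX alg_polyC polyCN.
have cQ : Q * Y%:P = Y%:P * Q.
  apply/polyP => i; rewrite coefMC coefCM !coefZ coefX.
  by case: eqP; rewrite ?mulr1 ?mulr0 ?mul0r // mulNr mulrN.
have dQ j : (1 <= j)%N -> iter j (rbr Q) Q^`() = 0.
  case: j => // j _; elim: j => [|j IH]; last by rewrite iterS IH; exact: (iter_rad0 Q 1).
  by rewrite /= Q' /rbr mulrN mulNr cQ subrr.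
pose w := pexp (M + c.+1) L; pose v := pexp (M + 1) Q.
have hw : psmall k.+1 (w^`() - pexp M L * Y%:P).
  by rewrite -dL; apply: deriv_pexp.
have hv : psmall k.+1 (v^`() - - (Y%:P * pexp M Q)).
  have := deriv_pexp QM dQ; rewrite -/v /dexp big_ord1 /dexpc expr0 divr1 /= Q'.
  have -> : 1 %*: - Y%:P = - Y%:P :> {poly op}.
    by apply/polyP => i; rewrite coef_pscale scale1r.
  suff -> : pexp M Q * - Y%:P = - (Y%:P * pexp M Q) by [].
  rewrite mulrN; congr (- _); rewrite /pexp mulr_suml mulr_sumr.
  apply: eq_bigr => i _; rewrite pscaleAl pscaleAr; congr (_ %*: _).
  by apply/esym/commrX/esym.
have hW : psmall k.+1 (w * v)^`().
  have -> : (w * v)^`() = (w^`() - pexp M L * Y%:P) * v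
      + w * (v^`() - - (Y%:P * pexp M Q))
      + (pexp M L * Y%:P * (v - pexp M Q) - (w - pexp M L) * (Y%:P * pexp M Q)).
    rewrite derivM !mulrBl !mulrBr !mulrN !opprK !mulrA.
    move: (w^`() * v) (pexp M L * Y%:P * v) (w * v^`()) (w * Y%:P * pexp M Q)
      (pexp M L * Y%:P * pexp M Q) => x y z t u.
    have -> : y - u - (t - u) = y - t by rewrite opprB addrA subrK.
    by rewrite addrACA subrK addrK.
  apply: psmallD; first by apply: psmallD; [apply: psmallMr|apply: psmallMl].
  by apply: psmallB; [apply: psmallMl|apply: psmallMr]; apply: pexp_leq => //; apply: leq_addr.
have ph N P a : (pexp N P).[a%:A] = exp_trunc N P.[a%:A].
  rewrite /exp_trunc (@horner_algE _ _ _ _ N) ?size_poly // horner_sum.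
  apply: eq_bigr => i _; rewrite hornerZ horner_alg_exp mulr_algl.
  by rewrite coef_poly ltn_ord.
have Wh a : (w * v).[a%:A] =
    exp_trunc (M + c.+1) L.[a%:A] * exp_trunc (M + 1) (- (a *: Y)).
  rewrite hornerM_comm ?ph ?Qh // /comm_poly.
  by rewrite mulr_algl -scalerAr mulr1.
have W01 : small k.+1 ((w * v).[(1 : K)%:A] - (w * v).[(0 : K)%:A]).
  rewrite scale1r scale0r horner_coef0.
  rewrite (@horner_coef_wide _ (size (w * v)).+1) ?leqnSn //.
  rewrite big_ord_recl expr0 mulr1 addrC addKr.
  apply: small_sum => i _; rewrite expr1n mulr1.
  have i0 : (lift ord0 i)%:R != 0 :> K by rewrite pnatr_eq0.
  have := hW i; rewrite coef_deriv => /(smallZ i.+1%:R^-1).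
  by rewrite -scaler_nat scalerA mulVf // scale1r.
have hN T N : lie T -> (M <= N)%N -> small k.+1 (opexp T - exp_trunc N T).
  move=> lT MN; apply: opexpE; first exact: (lie_nilp gG nilG).
  by apply: smallX_leq MN _; apply: (lie_small gG nilG).
have l0 : lie 0 by exact: fil0.
move: W01; rewrite !Wh -L1 scale1r !scale0r oppr0 => W01.
have L0 : L.[0] = X.
  by rewrite LE hornerD hornerC horner_coef0 coef_pint0 addr0.
rewrite L0 in W01.
have -> : opexp X = opexp X * opexp 0 by rewrite opexp0 mulr1.
apply: small_trans (small_trans _ W01) (small_sym _); apply: small_subM.
all: by apply: hN; rewrite ?leq_addr //; apply: filN.
Qed.

End Subalgebra.

End CampbellHausdorff.

(** * Solubility of nilpotent Lie algebras of derivations *)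

Section ClearDenominators.
Variable R : idomainType.
Local Open Scope quotient_scope.

Lemma fraction_denom (x : {fraction R}) :
  exists d : R, exists e : R, d != 0 /\ tofrac d * x = tofrac e.
Proof.
elim/quotW: x => x; exists \d_x, \n_x; split; first exact: denom_ratioP.
rewrite -[_ * _]/(FracField.mul _ _) !piE; apply/eqmodP.
rewrite /= FracField.equivfE /FracField.mulf.
by rewrite !numden_Ratio ?mul1r ?mulr1 ?denom_ratioP ?oner_eq0 //= mulrC.
Qed.

Lemma common_denom m (x : 'I_m -> {fraction R}) : exists2 d : R, d != 0 &
  exists e : 'I_m -> R, forall i, tofrac d * x i = tofrac (e i).
Proof.
pose dd i := projT1 (cid (fraction_denom (x i))).
have dP i : exists e, dd i != 0 /\ tofrac (dd i) * x i = tofrac e.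
  exact: (projT2 (cid (fraction_denom (x i)))).
exists (\prod_i dd i).
  by apply/prodf_neq0 => i _; have [? []] := dP i.
have h i : exists e : R, tofrac (\prod_i dd i) * x i = tofrac e.
  have [e [_ ex]] := dP i.
  exists ((\prod_(j | j != i) dd j) * e).
  by rewrite (bigD1 i) //= !tofracM -ex mulrAC mulrC mulrA.
by exists (fun i => projT1 (cid (h i))) => i; case: (cid (h i)).
Qed.

End ClearDenominators.

Section SolubleLie.
Variables (K : numClosedFieldType) (n : nat).
Local Notation A := (fseries K n).
Local Notation F := {fraction A}.
Local Notation op := (op K n).
Local Notation fdiff := (fdiff K n).
Implicit Types (f g a b : A) (S T X Y Z : op) (m : nat).

Fact mulop_subproof a : filtered (fun f => a * f).
Proof.
split=> [c f g|k f fk]; last exact: vanishMl.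
by rewrite mulrDr scalerAr.
Qed.
Definition mulop a : op := Op (mulop_subproof a).

Lemma derivation_op_eq0 X : derivation_op X -> (forall i, X (fs_var K i) = 0) -> X = 0.
Proof.
move=> dX X0.
have X1 : X 1 = 0.
  have := dX 1 1; rewrite !mulr1 mul1r => /eqP.
  by rewrite -subr_eq subrr eq_sym => /eqP.
have XM f g : X f = 0 -> X g = 0 -> X (f * g) = 0.
  by move=> Xf Xg; rewrite dX Xf Xg mul0r mulr0 addr0.
have Xexp f i : X f = 0 -> X (f ^+ i) = 0.
  by move=> Xf; elim: i => [|i IH]; rewrite ?expr0 // exprS XM.
apply: eq_op_mpoly => p; rewrite op0E (mpolyE p) !linear_sum big1 // => m _.
rewrite /= !linearZ /= mpolyXE_id rmorph_prod /=.
suff -> : X (\prod_(i < n) fs_of_mpoly ('X_i ^+ m i)) = 0 by rewrite scaler0.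
elim/big_ind: _ => // i _; rewrite rmorphXn /= fs_of_mpolyX; exact: Xexp.
Qed.

Definition opcoord X : 'rV[A]_n := \row_i X (fs_var K i).

Lemma scaled_opcoord a X j : (a *: opcoord X) 0 j = a * X (fs_var K j).
Proof. by rewrite !mxE. Qed.

Section Span.
Variables (m : nat) (Z : 'I_m -> op).

Definition span_mx : 'M[F]_(m, n) := \matrix_(i, j) tofrac (opcoord (Z i) 0 j).

(** Spans are taken over the field of fractions, where ranks are available. *)
Definition in_span (v : 'rV[A]_n) := (map_mx (@tofrac A) v <= span_mx)%MS.

Lemma in_span0 : in_span 0.
Proof. by rewrite /in_span map_mx0 sub0mx. Qed.

Lemma in_spanD v w : in_span v -> in_span w -> in_span (v + w).
Proof. by rewrite /in_span map_mxD => hv hw; rewrite addmx_sub. Qed.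

Lemma in_spanZ a v : in_span v -> in_span (a *: v).
Proof. by rewrite /in_span map_mxZ => hv; rewrite scalemx_sub. Qed.

Lemma in_spanB v w : in_span v -> in_span w -> in_span (v - w).
Proof.
by move=> hv hw; apply: in_spanD => //; rewrite -scaleN1r; apply: in_spanZ.
Qed.

Lemma in_span_sum (I : Type) (r : seq I) (P : pred I) (v : I -> 'rV[A]_n) :
  (forall x, P x -> in_span (v x)) -> in_span (\sum_(x <- r | P x) v x).
Proof. by move=> h; elim/big_ind: _ => //; [exact: in_span0|exact: in_spanD]. Qed.

Lemma in_span_scaled a v : a != 0 -> in_span (a *: v) -> in_span v.
Proof. by move=> a0; rewrite /in_span map_mxZ eqmx_scale // tofrac_eq0. Qed.

Lemma in_span_denom v : in_span v ->
  exists2 a, a != 0 & exists b : 'I_m -> A, a *: v = \sum_i b i *: opcoord (Z i).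
Proof.
case/submxP => D vD; have [a a0 [b hb]] := common_denom (fun i => D 0 i).
exists a => //; exists b; apply/rowP => j; apply/eqP.
rewrite -tofrac_eq; apply/eqP; rewrite !mxE summxE rmorphM rmorph_sum /=.
have := congr1 (fun w : 'rV[F]_n => w 0 j) vD; rewrite !mxE => ->.
rewrite mulr_sumr; apply: eq_bigr => i _.
by rewrite !mxE rmorphM /= mulrA hb.
Qed.

Hypothesis dZ : forall i, derivation_op (Z i).

Lemma combination_op X a (b : 'I_m -> A) : derivation_op X ->
  a *: opcoord X = \sum_i b i *: opcoord (Z i) ->
  forall f, a * X f = \sum_i b i * Z i f.
Proof.
move=> dX e f; pose D := X * mulop a - \sum_i Z i * mulop (b i).
have DE g : D g = a * X g - \sum_i b i * Z i g by rewrite /D opBE op_sumE.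
suff D0 : D = 0 by apply/eqP; rewrite -subr_eq0 -DE D0.
apply: derivation_op_eq0 => [g h|i].
  rewrite !DE dX.
  have -> : \sum_i b i * Z i (g * h) = (\sum_i b i * Z i g) * h + g * (\sum_i b i * Z i h).
    rewrite mulr_suml mulr_sumr -big_split; apply: eq_bigr => i _ /=.
    by rewrite dZ; ring.
  by ring.
rewrite DE; have := congr1 (fun v : 'rV[A]_n => v 0 i) e.
rewrite mxE summxE mxE => ->; rewrite -sumrB big1 // => j _.
by rewrite !mxE subrr.
Qed.

(** Modulo the brackets of the [Z i], a derivation only acts on the coefficients of a
combination. *)
Lemma bracket_combination X Y a (b : 'I_m -> A) :
  derivation_op X -> derivation_op Y ->
  a *: opcoord X = \sum_i b i *: opcoord (Z i) ->
  (a * a) *: opcoord (ad Y X) = a *: \sum_i b i *: opcoord (ad Y (Z i)) -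
    \sum_i (a * Y (b i) - Y a * b i) *: opcoord (Z i).
Proof.
move=> dX dY e; have h := combination_op dX e; apply/rowP => j.
rewrite !(mxE, summxE) /ad !opBE !opME; set x := fs_var K j.
have hY : a * Y (X x) = \sum_i (Y (b i) * Z i x + b i * Y (Z i x)) - Y a * X x.
  have := dY a (X x); rewrite h raddf_sum /= => e1.
  apply: (addrI (Y a * X x)); rewrite -e1 addrC subrK.
  by apply: eq_bigr => i _; rewrite dY.
transitivity (a * (a * X (Y x)) - a * (a * Y (X x))); first by ring.
rewrite hY h mulrBr mulrCA h !mulr_sumr -!sumrB; apply: eq_bigr => i _.
transitivity (a * (b i * (Z i (Y x) - Y (Z i x))) - (a * Y (b i) - Y a * b i) * Z i x).
  by move: (Y (Z i x)) (Z i (Y x)) (Z i x) (Y (b i)) (Y a) => *; ring.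
by apply: (congr2 (fun u v => a * u - v)); apply/esym/scaled_opcoord.
Qed.

End Span.

(** Choose a family of maximal rank. *)
Lemma spanning_family (P : op -> Prop) : exists m (Z : 'I_m -> op),
  (forall i, P (Z i)) /\ forall X, P X -> in_span Z (opcoord X).
Proof.
pose Q d := `[< exists m (Z : 'I_m -> op), (forall i, P (Z i)) /\
  \rank (span_mx Z) = d >].
have exQ : exists d, Q d.
  exists (\rank (span_mx (fun i : 'I_0 => (0 : op)))); apply/asboolP.
  by exists 0%N, (fun _ => 0); split => // -[].
have Qle d : Q d -> (d <= n)%N by move=> /asboolP[m [Z [_ <-]]]; apply: rank_leq_col.
have [d /asboolP[m [Z [PZ rZ]]] dmax] := ex_maxnP exQ Qle.
exists m, Z; split => // X PX; rewrite /in_span.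
pose Z' (i : 'I_(m + 1)) := if split i is inl j then Z j else X.
have Z'l (i : 'I_m) : Z' (lshift 1 i) = Z i.
  by rewrite /Z'; have := unsplitK (inl i : 'I_m + 'I_1); rewrite /= => ->.
have Z'r (i : 'I_1) : Z' (rshift m i) = X.
  by rewrite /Z'; have := unsplitK (inr i : 'I_m + 'I_1); rewrite /= => ->.
have Z'E : span_mx Z' = col_mx (span_mx Z) (map_mx (@tofrac A) (opcoord X)).
  apply/matrixP => i j; have [k ->|k ->] := split_ordP i.
    by rewrite col_mxEu !mxE Z'l.
  by rewrite col_mxEd !mxE Z'r.
have le1 : (span_mx Z <= span_mx Z')%MS.
  rewrite Z'E; apply/submxP; exists (row_mx 1%:M 0).
  by rewrite mul_row_col mul1mx mul0mx addr0.
have le2 : (map_mx (@tofrac A) (opcoord X) <= span_mx Z')%MS.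
  by rewrite Z'E; apply/submxP; exists (row_mx 0 1%:M); rewrite mul_row_col mul1mx mul0mx add0r.
have Qr : Q (\rank (span_mx Z')).
  apply/asboolP; exists (m + 1)%N, Z'; split => // i.
  by rewrite /Z'; case: split.
apply: contraT => nX.
have : (span_mx Z < span_mx Z')%MS.
  by rewrite ltmxE le1 /=; apply: contra nX => /(submx_trans le2).
by move/rank_ltmx; rewrite rZ ltnNge dmax.
Qed.

Inductive bracket_span (h : op -> Prop) : op -> Prop :=
| bracket_span_ad X Y : h X -> h Y -> bracket_span h (ad X Y)
| bracket_span0 : bracket_span h 0
| bracket_spanD X Y : bracket_span h X -> bracket_span h Y -> bracket_span h (X + Y)
| bracket_spanZ (a : K) X : bracket_span h X -> bracket_span h (a *: X).

Variables (G : set fdiff) (c : nat).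
Hypotheses (gG : subgroup G) (nilG : lower_central_series G c = [set 1%g]%classic).
Local Notation lie := (lie G).

Definition lie_derived j := iter j bracket_span lie.

Lemma lie_derived_linear j : linear_pred (lie_derived j).
Proof.
case: j => [|j]; first exact: fil_linear.
by split; [exact: bracket_span0|exact: bracket_spanD|exact: bracket_spanZ].
Qed.

Lemma lie_derived_sub j X : lie_derived j X -> lie X.
Proof.
elim: j X => // j IH X; elim=> {X} [X Y /IH lX /IH lY||X Y _ lX _ lY|a X _ lX].
- exact: lie_bracket.
- exact: fil0.
- exact: filD.
- exact: filZ.
Qed.

Lemma lie_derived_ad j X Y : lie_derived j X -> lie_derived j Y ->
  lie_derived j.+1 (ad X Y).
Proof. exact: bracket_span_ad. Qed.

Lemma lie_derivedS j X : lie_derived j.+1 X -> lie_derived j X.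
Proof.
elim: j X => [|j IH] X; first exact: (@lie_derived_sub 1).
elim=> {X} [X Y /IH lX /IH lY||X Y _ lX _ lY|a X _ lX].
- exact: bracket_span_ad.
- exact: bracket_span0.
- exact: bracket_spanD.
- exact: bracket_spanZ.
Qed.

Lemma lie_derivation X : lie X -> derivation_op X.
Proof.
elim=> {X} [x Gx|i x Y Gx _ dY|//|i|i Y Z _ dY _ dZ|i a Y _ dY] f g.
- apply: oplog_derivation; [exact: star_unit|exact: star_mult].
- have dx : derivation_op (fdlog x).
    by apply: oplog_derivation; [exact: star_unit|exact: star_mult].
  by rewrite /ad !opBE !opME !(dx, dY) !raddfD /= !(dx, dY); ring.
- by rewrite !op0E mul0r mulr0 addr0.
- by rewrite !opDE dY dZ; ring.
- by rewrite !opZE dY scalerDr scalerAl scalerAr.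
Qed.

Definition central_mod m (Z : 'I_m -> op) X :=
  lie X /\ forall Y, lie Y -> in_span Z (opcoord (ad Y X)).

(** An induction on the codimension of the span of [Z], which starts because derivations
are determined by [n] coordinates. By nilpotency, the elements which commute with the
Lie algebra modulo [Z] span a strictly larger space, with generators [Z'], and the
[d]-th derived algebra lies in it by induction. For [W] in that algebra, the bracket
with each element of [Z'] lies in the span of [Z], hence so do the combinations obtained
by differentiating the coefficients of [W] along the elements of [Z']. By linearity the
same holds for differentiation along the derived algebra, so that its brackets lie in
the span of [Z]. *)
Lemma lie_derived_span d m (Z : 'I_m -> op) : (forall i, central_mod Z (Z i)) ->
  (n - \rank (span_mx Z) <= d)%N ->
  forall X, lie_derived d X -> in_span Z (opcoord X).
Proof.
elim: d m Z => [|d IH] m Z hZ hd X hX.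
  have : row_full (span_mx Z).
    by rewrite -col_leq_rank -subn_eq0 -leqn0.
  by move=> full; rewrite /in_span submx_full.
have [full|] := pselect (forall Y, lie Y -> in_span Z (opcoord Y)).
  by apply: full; apply: lie_derived_sub hX.
move=> /existsNP[Y0 /not_implyP[lY0 nY0]].
have [i [Y1 [fY1 nY1]] hi] : exists2 i, (exists Y1, fil G i Y1 /\ ~ in_span Z (opcoord Y1))
    & forall Y, fil G i.+1 Y -> in_span Z (opcoord Y).
  pose Q i := `[< exists Y1, fil G i Y1 /\ ~ in_span Z (opcoord Y1) >].
  have exQ : exists i, Q i by exists 0%N; apply/asboolP; exists Y0.
  have Qc i : Q i -> (i <= c)%N.
    move=> /asboolP[Y [fY nY]]; rewrite leqNgt; apply/negP => ci; apply: nY.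
    rewrite (fil_eq0 gG nilG (fil_leq (ltnW ci) fY)).
    have -> : opcoord 0 = 0 by apply/rowP => j; rewrite !mxE.
    exact: in_span0.
  have [i /asboolP hi himax] := ex_maxnP exQ Qc; exists i => // Y fY.
  apply: contrapT => nY; have : Q i.+1 by apply/asboolP; exists Y.
  by move/himax; rewrite ltnn.
have [m' [Z' [cZ' Z'span]]] := spanning_family (central_mod Z).
have sZZ' : (span_mx Z <= span_mx Z')%MS.
  apply/row_subP => k; have := Z'span _ (hZ k); rewrite /in_span.
  suff -> : map_mx (@tofrac A) (opcoord (Z k)) = row k (span_mx Z) by [].
  by apply/rowP => j; rewrite !mxE.
have cY1 : central_mod Z Y1.
  split=> [|Y lY]; first exact: fil_lie fY1.
  by apply: hi; apply: fil_bracket.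
have ltr : (\rank (span_mx Z) < \rank (span_mx Z'))%N.
  apply: rank_ltmx; rewrite ltmxE sZZ' /=; apply/negP => h.
  by apply: nY1; apply: submx_trans (Z'span _ cY1) h.
have inZ' v : in_span Z v -> in_span Z' v by move=> h; apply: submx_trans h sZZ'.
have {}IH := IH _ Z'.
have hX' W : lie_derived d W -> in_span Z' (opcoord W).
  apply: IH => [k|]; last first.
    rewrite leq_subLR; move: hd; rewrite leq_subLR => /leq_trans; apply.
    by rewrite addnS -addSn leq_add2r.
  by split=> [|Y lY]; [case: (cZ' k)|apply: inZ'; case: (cZ' k) => _; apply].
have dZ' k : derivation_op (Z' k) by apply: lie_derivation; case: (cZ' k).
have main V W : lie_derived d V -> lie_derived d W -> in_span Z (opcoord (ad V W)).
  move=> hV hW; have lV := lie_derived_sub hV; have lW := lie_derived_sub hW.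
  have dV := lie_derivation lV; have dW := lie_derivation lW.
  have [a a0 [b hb]] := in_span_denom (hX' _ hW).
  have [a' a'0 [b' hb']] := in_span_denom (hX' _ hV).
  have brZ Y : lie Y -> in_span Z (a *: \sum_k b k *: opcoord (ad Y (Z' k))).
    move=> lY; apply/in_spanZ/in_span_sum => k _; apply: in_spanZ.
    by case: (cZ' k) => _; apply.
  have coef Y : lie Y -> in_span Z (opcoord (ad Y W)) ->
      in_span Z (\sum_k (a * Y (b k) - Y a * b k) *: opcoord (Z' k)).
    move=> lY hYW; have e := bracket_combination dZ' dW (lie_derivation lY) hb.
    have -> : \sum_k (a * Y (b k) - Y a * b k) *: opcoord (Z' k) =
      a *: \sum_k b k *: opcoord (ad Y (Z' k)) - (a * a) *: opcoord (ad Y W).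
      by rewrite e opprB addrC subrK.
    by apply: in_spanB; [apply: brZ|apply: in_spanZ].
  have coefZ k : in_span Z (\sum_l (a * Z' k (b l) - Z' k a * b l) *: opcoord (Z' l)).
    apply: coef; first by case: (cZ' k).
    rewrite adN; have [_ /(_ _ lW) h] := cZ' k.
    have -> : opcoord (- ad W (Z' k)) = (-1) *: opcoord (ad W (Z' k)).
      by apply/rowP => j; rewrite !mxE mulN1r.
    exact: in_spanZ.
  have combV := combination_op dZ' dV hb'.
  have coefV : in_span Z (\sum_l (a * V (b l) - V a * b l) *: opcoord (Z' l)).
    apply: (in_span_scaled a'0).
    have -> : a' *: \sum_l (a * V (b l) - V a * b l) *: opcoord (Z' l) =
      \sum_k b' k *: \sum_l (a * Z' k (b l) - Z' k a * b l) *: opcoord (Z' l).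
      under [RHS]eq_bigr do rewrite scaler_sumr.
      rewrite exchange_big scaler_sumr; apply: eq_bigr => l _ /=.
      under [RHS]eq_bigr do rewrite scalerA.
      rewrite scalerA -scaler_suml; congr (_ *: _).
      transitivity (a * (a' * V (b l)) - (a' * V a) * b l); first by ring.
      rewrite !combV mulr_sumr mulr_suml -sumrB.
      by apply: eq_bigr => k _; ring.
    by apply: in_span_sum => k _; apply: in_spanZ; apply: coefZ.
  apply: (@in_span_scaled _ _ (a * a)); first by rewrite mulf_neq0.
  rewrite (bracket_combination dZ' dW dV hb); apply: in_spanB => //.
  exact: brZ.
elim: hX => {X} [V W|| V W _ hV _ hW|x V _ hV].
- exact: main.
- by have -> : opcoord 0 = 0; [apply/rowP => j; rewrite !mxE|exact: in_span0].
- have -> : opcoord (V + W) = opcoord V + opcoord W by apply/rowP => j; rewrite !mxE.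
  exact: in_spanD.
- have -> : opcoord (x *: V) = (x%:A : A) *: opcoord V.
    by apply/rowP => j; rewrite !mxE opZE mulr_algl.
  exact: in_spanZ.
Qed.

Theorem lie_derived_eq0 X : lie_derived n X -> X = 0.
Proof.
move=> hX; pose Z0 (i : 'I_0) : op := 0.
have h0 i : central_mod Z0 (Z0 i) by case: i.
have := @lie_derived_span n 0 Z0 h0 (leq_subr _ _) X hX; rewrite /in_span.
have -> : span_mx Z0 = 0 by apply/matrixP => -[].
move=> /submx0null X0; apply: derivation_op_eq0 => [|i].
  exact/lie_derivation/(@lie_derived_sub n).
have := congr1 (fun v : 'rV[F]_n => v 0 i) X0; rewrite !mxE => /eqP.
by rewrite tofrac_eq0 => /eqP.
Qed.

End SolubleLie.

(** * Semisimple and linear parts of automorphisms *)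

Section JordanParts.
Variables (K : numClosedFieldType) (n : nat).
Local Notation A := (fseries K n).
Local Notation op := (op K n).
Local Notation fdiff := (fdiff K n).
Implicit Types (f g : A) (S T U X Y Z : op) (k N M : nat) (l : K) (x y : fdiff).

(** [S * U - l] is the sum of [(S - l) * U] and [l *: (U - 1)], which commute and are both
nilpotent on [v]. *)
Lemma geigen_mul_unip k S U l N M v : S * U = U * S -> small k ((U - 1) ^+ M) ->
  geigen k S l N v -> geigen k (S * U) l (N + M) v.
Proof.
move=> SU hU hv; rewrite /geigen.
have -> : S * U - l%:A = (S - l%:A) * U + l *: (U - 1).
  by rewrite mulrBl scalerBr -[l%:A * U]scalerAl mul1r addrA subrK.
have cU : (S - l%:A) * U = U * (S - l%:A).
  by rewrite mulrBl mulrBr SU -scalerAl -scalerAr mul1r mulr1.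
have cS : (S - l%:A) * (U - 1) = (U - 1) * (S - l%:A).
  by rewrite [LHS]mulrBr mulr1 cU [RHS]mulrBl mul1r.
have cUU : U * (U - 1) = (U - 1) * U by rewrite mulrBl mulrBr mul1r mulr1.
rewrite exprDn_comm; last first.
  rewrite /GRing.comm -scalerAr -scalerAl; congr (_ *: _).
  by rewrite -mulrA cUU mulrA cS mulrA.
rewrite op_sumE; apply: vanish_sum => i _.
suff h : vanish k ((((S - l%:A) * U) ^+ (N + M - i) * (l *: (U - 1)) ^+ i) v).
  by elim: 'C(_, _) => [|j IH]; rewrite ?mulr0n // mulrS opDE; apply: vanishD.
have [iM|Mi] := ltnP i M.
  rewrite opME; apply: op_vanish; rewrite exprMn_comm //.
  have NiM : (N <= N + M - i)%N by rewrite -addnBA ?leq_addr // ltnW.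
  rewrite -(subnKC NiM) exprD -mulrA opME; apply: op_vanish; exact: hv.
rewrite opME exprZn opZE; apply: vanishZ.
exact: (smallX_leq Mi hU).
Qed.

(** Decompose [v] along the generalized eigenspaces of [T], where the semisimple part is
scalar: the components for eigenvalues other than [l] are small. *)
Lemma semisimple_geigen k T l N v : op_unit T ->
  geigen k (semisimple_part T) l N v -> vanish k (semisimple_part T v - l *: v).
Proof.
move=> Tu; set S := semisimple_part T => hv.
have TS : T * S = S * T.
  have nX := nilp_opN (oplog_nilp Tu).
  have c : T * opexp (- oplog T) = opexp (- oplog T) * T.
    by apply: opexp_intertwine => //; rewrite mulrN mulNr oplog_comm.
  by rewrite /S /semisimple_part -mulrA c.
have [P [e [e1 eN]]] := unit_decomposition k Tu.
have -> : S v - l *: v = (S - l%:A) ((1 - \sum_(x <- e) horner_alg T x.2) v) +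
   \sum_(x <- e) (S - l%:A) (horner_alg T x.2 v).
  have -> : S v - l *: v = (S - l%:A) v by rewrite opBE opZE op1E.
  have vE : v = (1 - \sum_(x <- e) horner_alg T x.2) v + \sum_(x <- e) horner_alg T x.2 v.
    by rewrite opBE op1E op_sumE subrK.
  by rewrite {1}vE [LHS]raddfD; congr (_ + _); rewrite raddf_sum.
apply: vanishD; first exact: (op_vanish (S - l%:A) (e1 v)).
rewrite big_seq; apply: vanish_sum => x xe; have [_ /(_ v) hx] := eN x xe.
set w := horner_alg T x.2 v in hx *.
have hS : vanish k (S w - x.1 *: w) by apply: geigen_semisimple hx.
have hSi i : vanish k (((S - l%:A) ^+ i) w - (x.1 - l) ^+ i *: w).
  elim: i => [|i IH]; first by rewrite !expr0 scale1r op1E subrr.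
  rewrite opXSE.
  have -> : (S - l%:A) (((S - l%:A) ^+ i) w) - (x.1 - l) ^+ i.+1 *: w =
    (S - l%:A) (((S - l%:A) ^+ i) w - (x.1 - l) ^+ i *: w) +
    (x.1 - l) ^+ i *: (S w - x.1 *: w).
    have SE (a b : A) (d : K) : S (a - d *: b) = S a - d *: S b by rewrite [LHS]raddfB [X in _ - X]linearZ.
    have DE u : (S - l%:A) u = S u - l *: u by rewrite opBE opZE op1E.
    rewrite !DE exprSr; set p := (x.1 - l) ^+ i; set u := ((S - l%:A) ^+ i) w.
    rewrite SE !scalerBr !scalerA [l * p]mulrC mulrBr scalerBl.
    move: (S u) (l *: u) ((p * x.1) *: w) ((p * l) *: w) (p *: S w) => c1 c2 c3 c4 c5.
    by ring.
  by apply: vanishD; [apply: op_vanish|apply: vanishZ].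
have hw : vanish k (((S - l%:A) ^+ N) w).
  apply: (geigen_comm _ hv).
  by apply/esym; rewrite horner_alg_commr // TS.
have : vanish k ((x.1 - l) ^+ N *: w).
  rewrite -[X in vanish k X](subrK (((S - l%:A) ^+ N) w)); apply: vanishD => //.
  by rewrite -opprB; apply/vanishN/hSi.
rewrite opBE opZE op1E; have [<-|xl] := eqVneq x.1 l; first by [].
move=> /(vanishZ ((x.1 - l) ^- N)); rewrite scalerA mulVf ?scale1r => [h|].
  by apply: vanishB; [apply: op_vanish|apply: vanishZ].
by rewrite expf_neq0 // subr_eq0.
Qed.

Definition lin x : 'M[K]_n := linear_part x.

Lemma linM x y : lin (x * y)%g = lin x *m lin y.
Proof. by apply: linear_part_comp; apply: fdiff0. Qed.

Lemma lin1 : lin 1%g = 1%:M.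
Proof. exact: linear_part_var. Qed.

Lemma linV x : lin x *m lin x^-1%g = 1%:M.
Proof. by rewrite -linM mulgV lin1. Qed.

Definition linear_form (v : 'rV[K]_n) : A := \sum_i v 0 i *: fs_var K i.
Definition lrow1 f : 'rV[K]_n := \row_j f U_(j)%MM.

Lemma linear_form_vanish v : vanish 1 (linear_form v).
Proof. by apply: vanish_sum => i _; apply/vanishZ/vanish_var. Qed.

Lemma lrow1_linear_form v : lrow1 (linear_form v) = v.
Proof.
apply/rowP => j; rewrite mxE /linear_form fs_sumE (bigD1 j) //= big1 => [|i ij].
  by rewrite fsZE /fs_var eqxx mulr1 addr0.
by rewrite fsZE /fs_var eq_mnm1 eq_sym (negbTE ij) mulr0.
Qed.

Lemma vanish2P f : vanish 1 f -> lrow1 f = 0 <-> vanish 2 f.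
Proof.
move=> f1; split=> [h m|h]; last by apply/rowP => j; rewrite !mxE h ?mdeg1.
rewrite ltnS leq_eqVlt => /orP[/mdeg1P[j /eqP ->]|]; last exact: f1.
by have := congr1 (fun v : 'rV_n => v 0 j) h; rewrite !mxE.
Qed.

Lemma lrow1B f g : lrow1 (f - g) = lrow1 f - lrow1 g.
Proof. by apply/rowP => j; rewrite !mxE. Qed.

Lemma lrow1Z l f : lrow1 (l *: f) = l *: lrow1 f.
Proof. by apply/rowP => j; rewrite !mxE. Qed.

Lemma lrow1_star x f : vanish 1 f -> lrow1 (star x f) = lrow1 f *m lin x.
Proof.
move=> f1; have h : vanish 2 (f - linear_form (lrow1 f)).
  apply/vanish2P; first by apply: vanishB => //; apply: linear_form_vanish.
  by rewrite lrow1B lrow1_linear_form subrr.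
have e : lrow1 (star x f) = lrow1 (star x (linear_form (lrow1 f))).
  apply/eqP; rewrite -subr_eq0 -lrow1B -raddfB; apply/eqP/vanish2P.
    by apply: op_vanish; apply: vanish_leq h.
  exact: op_vanish.
rewrite e; apply/rowP => j; rewrite !mxE /linear_form linear_sum fs_sumE.
by apply: eq_bigr => i _; rewrite linearZ /= fsZE (fs_var_comp _ (fdiff0 x)) mxE [RHS]mulrC mulrC mxE.
Qed.

(** The linear part is the action on the quotient of the maximal ideal by its square. *)
Lemma geigen_lin x l N (v : 'rV[K]_n) :
  v *m iter N (mulmx (lin x - l%:M)) 1%:M = 0 <-> geigen 2 (star x) l N (linear_form v).
Proof.
have hS f : vanish 1 f -> lrow1 ((star x - l%:A) f) = lrow1 f *m (lin x - l%:M).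
  move=> f1; rewrite opBE opZE op1E lrow1B lrow1Z lrow1_star //.
  by rewrite mulmxBr mul_mx_scalar.
have hN f : vanish 1 f ->
    lrow1 (((star x - l%:A) ^+ N) f) = lrow1 f *m iter N (mulmx (lin x - l%:M)) 1%:M.
  elim: (N) f => [|i IH] f f1; first by rewrite expr0 /= mulmx1.
  rewrite exprS opME IH; last exact: op_vanish.
  by rewrite hS // mulmxA.
rewrite -{1}(lrow1_linear_form v) -hN; last exact: linear_form_vanish.
apply: vanish2P; apply: op_vanish; exact: linear_form_vanish.
Qed.

(** In a monomial, replacing one variable by its image changes that factor by a series of
order two. *)
Lemma tangent_id_vanish x j f : lin x = 1%:M -> vanish j f ->
  vanish j.+1 (star x f - f).
Proof.
move=> hx.
have hvar i : vanish 2 (x i - fs_var K i).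
  apply/vanish2P.
    by apply: vanishB; [apply/vanish1; apply: fdiff0|exact: vanish_var].
  rewrite -star_var; apply/eqP; rewrite lrow1B lrow1_star; last exact: vanish_var.
  by rewrite hx mulmx1 subrr.
pose R d (f g : A) := [/\ vanish d f, vanish d g & vanish d.+1 (f - g)].
have RM d e f1 g1 f2 g2 : R d f1 g1 -> R e f2 g2 -> R (d + e)%N (f1 * f2) (g1 * g2).
  move=> [a1 b1 c1] [a2 b2 c2]; split; [exact: vanishM|exact: vanishM|].
  have -> : f1 * f2 - g1 * g2 = (f1 - g1) * f2 + g1 * (f2 - g2).
    by rewrite mulrBl mulrBr addrA subrK.
  by apply: vanishD; [rewrite -addSn|rewrite -addnS]; apply: vanishM.
have Rmon (m : 'X_{1..n}) : R (mdeg m) (star x (fs_of_mpoly 'X_[m])) (fs_of_mpoly 'X_[m]).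
  move: (star x) (star_mult x) (star_var x) => T hT Tv.
  rewrite mpolyXE_id rmorph_prod /= multiplicative_op_prod //.
  rewrite mdegE; elim/big_rec3: _ => [|i d g1 f1 _ hR].
    by split; rewrite ?subrr.
  rewrite rmorphXn /= fs_of_mpolyX multiplicative_opX // Tv.
  apply: (RM) => //; elim: (m i) => [|c IH]; first by split; rewrite ?expr0 ?subrr.
  rewrite !exprS -add1n; apply: (RM) => //; split => //.
    by apply/vanish1; apply: fdiff0.
  exact: vanish_var.
move=> fj; rewrite -(subrK (fs_of_mpoly (fs_trunc j f)) f).
set r := f - _; set p := fs_of_mpoly _.
have rj : vanish j.+1 r by apply: vanish_trunc.
have -> : star x (r + p) = star x r + star x p by exact: raddfD.
rewrite opprD addrACA; apply: vanishD.
  by apply: vanishB => //; apply: op_vanish.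
rewrite /p /fs_trunc [fs_of_mpoly _]linear_sum [star x _]linear_sum -sumrB; apply: vanish_sum => a _.
rewrite 2!linearZ -scalerBr.
have [aj|ja] := ltnP (mdeg a) j; first by rewrite fj ?scale0r.
by apply: vanishZ; have [_ _] := Rmon a; apply: vanish_leq; rewrite ltnS.
Qed.

Lemma tangent_id_small x k : lin x = 1%:M -> small k ((star x - 1) ^+ k).
Proof.
move=> hx f; suff h i : vanish i (((star x - 1) ^+ i) f) by apply: h.
by elim: i => [//|i IH]; rewrite opXSE opBE op1E; apply: tangent_id_vanish.
Qed.

End JordanParts.

(** * Splitting off the exponentials *)

Section ExponentialGroups.
Variables (K : numClosedFieldType) (n : nat).
Local Notation A := (fseries K n).
Local Notation op := (op K n).
Local Notation fdiff := (fdiff K n).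
Implicit Types (f v : A) (S T U X Y Z : op) (j k N M : nat) (l : K) (a e g h p s w x y z : fdiff).

Variables (G : set fdiff) (c : nat).
Hypotheses (gG : subgroup G) (nilG : lower_central_series G c = [set 1%g]%classic).
Local Notation lie := (lie G).
Local Notation lie_derived := (lie_derived G).

Definition exp_group j : set fdiff :=
  [set x | exists2 Z, lie_derived j Z & star x = opexp Z].

Lemma star_exp_inv x Z : lie Z -> star x = opexp Z -> star x^-1%g = opexp (- Z).
Proof.
move=> lZ xZ; have nZ := lie_nilp gG nilG lZ.
by rewrite -[LHS]mulr1 -(opexpNr nZ) -xZ mulrA starV mul1r.
Qed.

Lemma lie_derived_mul j X Y : lie_derived j X -> lie_derived j Y ->
  exists Z, [/\ lie_derived j Z, opexp X * opexp Y = opexp Z &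
    lie_derived j.+1 (Z - (X + Y))].
Proof.
have hlin := lie_derived_linear G.
move=> hX hY; apply: (opexp_mul gG nilG (hlin j) (hlin j.+1) _ _ _ hX hY).
- exact: lie_derived_sub.
- by move=> U V hU hV; apply/lie_derivedS/lie_derived_ad.
- by move=> U V; apply: lie_derived_ad.
Qed.

Lemma exp_group_subgroup j : subgroup (exp_group j).
Proof.
have [h0 hD hZ] := lie_derived_linear G j.
apply/subgroupP; split=> [|x y [X hX xX] [Y hY yY]|x [X hX xX]].
- by exists 0; rewrite ?opexp0 ?star1.
- have [Z [hZ' XYZ _]] := lie_derived_mul hX hY.
  by exists Z; rewrite // starM xX yY.
- exists (- X); first by rewrite -scaleN1r; apply: hZ.
  by apply: star_exp_inv => //; apply: lie_derived_sub hX.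
Qed.

(** The Campbell-Hausdorff product is the sum modulo brackets, so that the logarithm of a
commutator is a combination of brackets. *)
Lemma exp_group_comm j x y : exp_group j x -> exp_group j y ->
  exp_group j.+1 [~ x, y]%g.
Proof.
move=> [X hX xX] [Y hY yY]; have lX := lie_derived_sub hX; have lY := lie_derived_sub hY.
have [h0 hD hZ] := lie_derived_linear G j.+1.
have hN V : lie_derived j V -> lie_derived j (- V).
  by move=> hV; apply: (linear_predN (lie_derived_linear G j) hV).
have [Z1 [hZ1 e1 d1]] := lie_derived_mul (hN _ hX) (hN _ hY).
have [Z2 [hZ2 e2 d2]] := lie_derived_mul hX hY.
have [Z3 [hZ3 e3 d3]] := lie_derived_mul hZ1 hZ2.
exists Z3.
  have -> : Z3 = (Z3 - (Z1 + Z2)) + (Z1 - (- X - Y)) + (Z2 - (X + Y)).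
    by apply: opP => f; rewrite !(opDE, opBE, opNE); ring.
  by apply: (hD) => //; apply: (hD).
rewrite commgEl /conjg !starM xX yY (star_exp_inv lX xX) (star_exp_inv lY yY).
by rewrite !mulrA e1 -mulrA e2 e3.
Qed.

Lemma exp_group_trivial x : exp_group n x -> x = 1%g.
Proof.
move=> [Z /(lie_derived_eq0 gG nilG) -> xZ]; apply: star_inj.
by rewrite xZ opexp0 star1.
Qed.

Lemma exp_groupS j x : exp_group j.+1 x -> exp_group j x.
Proof. by case=> Z /lie_derivedS hZ xZ; exists Z. Qed.

Lemma exp_group_sub0 j x : exp_group j x -> exp_group 0 x.
Proof. by elim: j => // j IH /exp_groupS. Qed.

Lemma fdlog_exp g : G g -> exists2 u, exp_group 0 u & star u = opexp (fdlog g).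
Proof.
move=> Gg; have lg : lie (fdlog g) by apply: fil_log.
have nX := lie_nilp gG nilG lg; have dX := lie_derivation lg.
have lN : lie (- fdlog g) by apply: filN.
have [u uE] := star_surj (opexp_multiplicative nX dX)
  (opexp_multiplicative (lie_nilp gG nilG lN) (lie_derivation lN)) (opexpNr nX).
by exists u => //; exists (fdlog g).
Qed.

Definition commutes_lie S := forall Y, lie Y -> S * Y = Y * S.

(** The elements of [G], corrected by exponentials so as to commute with the Lie
algebra. The semisimple parts of the elements of [G] are among them. *)
Definition gamma : set fdiff :=
  [set x | commutes_lie (star x) /\ exists2 e, exp_group 0 e & G (x * e)%g].

Lemma gamma_exp_commute x e : gamma x -> exp_group 0 e -> commute x e.
Proof.
move=> [cx _] [Z lZ eZ]; apply: star_inj; rewrite !starM eZ.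
have nZ := lie_nilp gG nilG lZ.
exact: opexp_intertwine (cx _ lZ).
Qed.

Lemma gamma_subgroup : subgroup gamma.
Proof.
have gE := exp_group_subgroup 0.
apply/subgroupP; split=> [|x y hx hy|x hx].
- split; first by move=> Y _; rewrite star1 mul1r mulr1.
  by exists 1%g; rewrite ?mulg1; apply: subgroup1.
- have [cx [e he xe]] := hx; have [cy [e' he' ye]] := hy; split.
    by move=> Y lY; rewrite starM -mulrA (cy _ lY) !mulrA (cx _ lY).
  exists (e * e')%g; first exact: subgroupM.
  have ey := gamma_exp_commute hy he.
  suff -> : (x * y * (e * e') = x * e * (y * e'))%g by apply: subgroupM.
  by rewrite -!mulgA; congr (_ * _)%g; rewrite !mulgA ey.
- have [cx [e he xe]] := hx; split.
    move=> Y lY; rewrite -[LHS]mulr1 -(starVr x) mulrA -[_ * Y * _]mulrA.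
    by rewrite -(cx _ lY) (mulrA _ (star x)) starV mul1r.
  exists e^-1%g; first exact: subgroupV.
  suff -> : (x^-1 * e^-1 = (x * e)^-1)%g by apply: subgroupV.
  by rewrite (gamma_exp_commute hx he) invgM.
Qed.

Lemma semisimple_in_gamma g u : G g -> exp_group 0 u -> star u = opexp (fdlog g) ->
  gamma (g * u^-1)%g /\ star (g * u^-1)%g = semisimple_part (star g).
Proof.
move=> Gg Eu uE; have lg : lie (fdlog g) by apply: fil_log.
have sE : star (g * u^-1)%g = semisimple_part (star g).
  by rewrite starM (star_exp_inv lg uE).
split=> //; split.
  move=> Y lY; apply/eqP; rewrite -subr_eq0 sE.
  by rewrite -/(ad _ Y) (lie_semisimple gG nilG).
by exists u; rewrite // mulgVK.
Qed.

(** [G] lies in the product of the commuting groups [gamma] and [exp_group 0], where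
commutators are computed factorwise. *)
Lemma derived_gamma j x : derived_series G j x ->
  exists p e, [/\ derived_series gamma j p, exp_group j e & x = (p * e)%g].
Proof.
have gGam := gamma_subgroup.
have cke j' p e : derived_series gamma j' p -> exp_group j' e -> commute p e.
  by move=> /(derived_sub gGam) gk /exp_group_sub0; apply: gamma_exp_commute.
elim: j x => [|j IH] x.
  move=> Gx; have [u Eu uE] := fdlog_exp Gx.
  have [gx _] := semisimple_in_gamma Gx Eu uE.
  by exists (x * u^-1)%g, u; rewrite mulgVK.
pose S : set fdiff := fun x => exists p e, [/\ derived_series gamma j.+1 p, exp_group j.+1 e &
  x = (p * e)%g].
have gD := derived_subgroup j.+1 gGam; have gE := exp_group_subgroup j.+1.
apply: (@commutator_subgroup_min _ _ _ S).
  apply/subgroupP; split=> [|y z [p [e [hp he ->]]] [p' [e' [hp' he' ->]]]|y [p [e [hp he ->]]]].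
  - by exists 1%g, 1%g; split; [exact: (subgroup1 gD)|exact: (subgroup1 gE)|rewrite mulg1].
  - exists (p * p')%g, (e * e')%g; split; [exact: (subgroupM gD)|exact: (subgroupM gE)|].
    by rewrite -!mulgA; congr (_ * _)%g; rewrite !mulgA -(cke _ _ _ hp' he).
  - exists p^-1%g, e^-1%g; split; [exact: (subgroupV gD)|exact: (subgroupV gE)|].
    by rewrite (cke _ _ _ hp he) invgM.
move=> y z /IH[p [e [hp he ->]]] /IH[p' [e' [hp' he' ->]]].
exists [~ p, p']%g, [~ e, e']%g; split; [exact: mem_commutator|exact: exp_group_comm|].
apply: commg_mul_commute.
- exact/commute_sym/(cke _ _ _ hp he).
- exact/commute_sym/(cke _ _ _ hp' he).
- exact: cke hp he'.
- exact: cke hp' he'.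
Qed.

End ExponentialGroups.

(** * Jordan decomposition in the group commuting with the Lie algebra *)

Section MatrixDecomposition.
Variable K : numClosedFieldType.

(** The primary decomposition of [M]. Hiding the polynomials in [M] from the statement
allows for matrices of size zero. *)
Lemma mx_decomposition n (M : 'M[K]_n) : exists N (r : seq (K * 'M[K]_n)),
  [/\ \sum_(x <- r) x.2 = 1%:M,
      forall x, x \in r -> x.2 *m iter N (mulmx (M - x.1%:M)) 1%:M = 0 &
      forall x m (W : 'M[K]_(m, n)) (Q : 'M[K]_n), x \in r -> (W *m M <= W)%MS ->
        (W *m x.2 <= W)%MS /\
        (W *m M *m Q = W *m Q *m M -> W *m x.2 *m Q = W *m Q *m x.2)].
Proof.
case: n M => [|n] M.
  exists 0%N, [::]; rewrite big_nil; split => //.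
  by apply/matrixP => -[].
have p0 : char_poly M != 0 by rewrite monic_neq0 // char_poly_monic.
have [N [r [r1 rN]]] := poly_partition_of_unity p0.
have ann q : char_poly M %| q -> horner_mx M q = 0.
  by move=> /dvdpP[s ->]; rewrite rmorphM /= Cayley_Hamilton mulr0.
exists N, [seq (x.1, horner_mx M x.2) | x <- r]; split.
- have := ann _ r1; rewrite rmorphB rmorph1 raddf_sum big_map => /eqP.
  by rewrite subr_eq0 => /eqP <-.
- move=> _ /mapP[x xr -> /=].
  have iE : iter N (mulmx (M - x.1%:M)) 1%:M = horner_mx M (('X - x.1%:P) ^+ N).
    rewrite rmorphXn rmorphB /= horner_mx_X horner_mx_C.
    by elim: (N) => [|i IH] /=; rewrite ?expr0 // IH exprS.
  rewrite iE -[_ *m _]/(horner_mx M x.2 * _) -rmorphM; apply: ann.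
  by rewrite mulrC; apply: rN.
move=> _ m W Q /mapP[x _ -> /=] WM; move: (x.2) => q.
have Wq p : (W *m horner_mx M p <= W)%MS.
  elim/poly_ind: p => [|p a IH]; first by rewrite rmorph0 mulmx0 sub0mx.
  rewrite rmorphD rmorphM /= horner_mx_X horner_mx_C mulmxDr addmx_sub //.
    by rewrite mulmxA (submx_trans (submxMr _ IH)).
  by rewrite mul_mx_scalar scalemx_sub.
split => // WMQ; elim/poly_ind: q => [|p a IH].
  by rewrite rmorph0 !mulmx0 mul0mx.
rewrite rmorphD rmorphM /= horner_mx_X horner_mx_C -[_ * M]/(_ *m M).
rewrite !mulmxDr mulmxDl !mul_mx_scalar -scalemxAl; congr (_ + _).
have /submxP[D DE] := Wq p.
transitivity (D *m (W *m M *m Q)); first by rewrite mulmxA DE !mulmxA.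
by rewrite WMQ !mulmxA -DE IH.
Qed.

End MatrixDecomposition.

Section UpperBound.
Variables (K : numClosedFieldType) (n : nat).
Local Notation A := (fseries K n).
Local Notation op := (op K n).
Local Notation fdiff := (fdiff K n).
Implicit Types (f v : A) (S T U X Y Z : op) (k N M : nat) (l : K) (a e g h p s w x y z : fdiff).

(** [exp X - 1] is a multiple of [X]. *)
Lemma opexp_unipotent k X : nilp_op X -> exists M, small k ((opexp X - 1) ^+ M).
Proof.
move=> nX; have [N hN] := nX k; exists N.+1.
have hN1 : small k (X ^+ N.+1) by apply: smallX_leq hN.
have h := opexpE nX hN1.
have [q qE] : exists q, expp K N.+1 - 1 = q * 'X.
  exists (\poly_(i < N) (expp K N.+1 - 1)`_i.+1); apply/polyP => i.
  rewrite coefMX coef_poly coefB coef1; case: i => [|i] /=.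
    by rewrite coef_poly /= invr1 subrr.
  case: ltnP => Ni; first by rewrite coefB coef1.
  by rewrite coef_poly ltnS ltnNge Ni subr0.
have tE : exp_trunc N.+1 X - 1 = horner_alg X q * X.
  rewrite /exp_trunc -(rmorph1 (horner_alg X)) -rmorphB qE rmorphM /=.
  by rewrite horner_algX.
have h1 : small k ((opexp X - 1) - (exp_trunc N.+1 X - 1)).
  by rewrite opprB addrA subrK.
have hX i : small k ((opexp X - 1) ^+ i - (exp_trunc N.+1 X - 1) ^+ i).
  elim: i => [|i IH]; first by rewrite !expr0 subrr; apply: small0.
  by rewrite !exprS; apply: small_subM.
have e : (exp_trunc N.+1 X - 1) ^+ N.+1 = horner_alg X q ^+ N.+1 * X ^+ N.+1.
  by rewrite tE exprMn_comm //; apply/esym; apply: horner_alg_commr.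
rewrite -[_ ^+ N.+1](subrK ((exp_trunc N.+1 X - 1) ^+ N.+1)).
by apply: smallD => //; rewrite e; apply: smallMl.
Qed.

Lemma lin_semisimple s a l N (v : 'rV[K]_n) :
  (forall k l N v, geigen k (star a) l N v -> vanish k (star s v - l *: v)) ->
  v *m iter N (mulmx (lin a - l%:M)) 1%:M = 0 -> v *m lin s = l *: v.
Proof.
move=> hs /geigen_lin /hs h.
have v1 := linear_form_vanish v.
have := proj2 (vanish2P _) h; rewrite lrow1B lrow1Z lrow1_star //.
rewrite lrow1_linear_form => e; apply/eqP; rewrite -subr_eq0 e //.
by apply: vanishB; [apply: op_vanish|apply: vanishZ].
Qed.

Variables (G : set fdiff) (c : nat).
Hypotheses (gG : subgroup G) (nilG : lower_central_series G c = [set 1%g]%classic).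
Local Notation lie := (lie G).
Local Notation gamma := (gamma G).
Local Notation exp_group := (exp_group G).

Let gGam : subgroup gamma := gamma_subgroup gG nilG.
Let gE j : subgroup (exp_group j) := exp_group_subgroup gG nilG j.
Let cGE x e : gamma x -> exp_group 0 e -> commute x e := @gamma_exp_commute _ _ _ _ gG nilG x e.

(** Commutators in [G] of corrected elements are computed factorwise. *)
Lemma gamma_lower_central i p : lower_central_series gamma i p ->
  exists2 e, exp_group 0 e & lower_central_series G i (p * e)%g.
Proof.
elim: i p => [|i IH] p; first by case.
pose S : set fdiff := fun p => gamma p /\
  exists2 e, exp_group 0 e & lower_central_series G i.+1 (p * e)%g.
have gL := lower_central_subgroup i.+1 gG.
move=> hp; suff [] : S p by [].
apply: (@commutator_subgroup_min _ gamma (lower_central_series gamma i) S) hp.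
  apply/subgroupP; split=> [|x y [hx [e he xe]] [hy [e' he' ye]]|x [hx [e he xe]]].
  - split; first exact: (subgroup1 gGam).
    by exists 1%g; rewrite ?mulg1; [exact: (subgroup1 (gE 0))|exact: (subgroup1 gL)].
  - split; first exact: (subgroupM gGam).
    exists (e * e')%g; first exact: (subgroupM (gE 0)).
    have ey := cGE hy he.
    suff -> : (x * y * (e * e') = x * e * (y * e'))%g by apply: (subgroupM gL).
    by rewrite -!mulgA; congr (_ * _)%g; rewrite !mulgA ey.
  - split; first exact: (subgroupV gGam).
    exists e^-1%g; first exact: (subgroupV (gE 0)).
    suff -> : (x^-1 * e^-1 = (x * e)^-1)%g by apply: (subgroupV gL).
    by rewrite (cGE hx he) invgM.
move=> x y hx hy; have hy' : gamma y by apply: lower_central_sub hy.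
split; first exact: (subgroupR gGam).
have [_ [e he xe]] := hx; have [e' he' ye] := IH _ hy.
exists [~ e, e']%g; first exact: (subgroupR (gE 0)).
rewrite -commg_mul_commute; first exact: mem_commutator.
- exact/commute_sym/cGE.
- exact/commute_sym/cGE.
- exact: cGE.
- exact: cGE.
Qed.

(** The [c]-th term consists of exponentials, which are central in [gamma]. *)
Lemma gamma_nilpotent : lower_central_series gamma c.+1 = [set 1%g]%classic.
Proof.
apply/seteqP; split=> [|_ ->]; last first.
  exact: (subgroup1 (lower_central_subgroup c.+1 gGam)).
apply: commutator_subgroup_min => [|x y hx hy]; first exact: set1_subgroup.
have [e he] := gamma_lower_central hy; rewrite nilG => ye.
have hy' : exp_group 0 y.
  have -> : y = e^-1%g by apply: (mulIg e); rewrite mulVg.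
  exact: (subgroupV (gE 0)).
by apply/eqP/commgP; apply: cGE.
Qed.

(** Jordan decomposition inside [gamma]: the unipotent factor of an element is
central because it is the exponential of an element of the Lie algebra. *)
Lemma gamma_jordan a : gamma a -> exists s z, [/\ [/\ a = (s * z)%g, gamma s,
  gamma z & forall x, gamma x -> commute x z],
  (exists T, op_unit T /\ star s = semisimple_part T) &
  forall k l N v, geigen k (star a) l N v -> vanish k (star s v - l *: v)].
Proof.
move=> ha; have [_ [e he ae]] := ha; have [u hu uE] := fdlog_exp gG nilG ae.
have [hs sE] := semisimple_in_gamma gG nilG ae hu uE.
set s := (a * e * u^-1)%g in hs sE; pose z := (u * e^-1)%g.
have hz : exp_group 0 z by apply: (subgroupM (gE 0)) => //; apply: (subgroupV (gE 0)).
have aE : a = (s * z)%g by rewrite mulg_insert.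
exists s, z; split; first split => //.
- have -> : z = (s^-1 * a)%g by rewrite aE mulgA mulVg mul1g.
  by apply: (subgroupM gGam) => //; apply: (subgroupV gGam).
- by move=> x hx; apply: cGE.
- by exists (star (a * e)%g); split; [exact: star_unit|].
move=> k l N v hv; rewrite sE; have [Z lZ eZ] := he.
have [M hM] := opexp_unipotent k (lie_nilp gG nilG lZ).
apply: (@geigen_semisimple _ _ _ _ _ (N + M)); first exact: star_unit.
rewrite starM; apply: geigen_mul_unip => //; last by rewrite eZ.
by rewrite -!starM (cGE ha he).
Qed.

End UpperBound.

Local Opaque fdiff_mul fdiff_inv.

(** * The upper bound *)

Section DerivedLength.
Variables (K : numClosedFieldType) (n : nat).
Local Notation A := (fseries K n).
Local Notation op := (op K n).
Local Notation fdiff := (fdiff K n).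
Implicit Types (f v : A) (S T : op) (i k N M : nat) (l : K) (a b e g h p s w x y z : fdiff).

Section Action.
Variables (m : nat) (W : 'M[K]_(m, n)) (H : set fdiff).
Hypotheses (gH : subgroup H) (WH : forall h, H h -> (W *m lin h <= W)%MS).

Definition same_on x y := W *m lin x = W *m lin y.

Lemma same_on_congruence : congruence_on H same_on.
Proof.
rewrite /same_on; split=> [//|x y ->//|x y z ->//|x y z e|x y z Hz e].
  by rewrite !linM !mulmxA e.
by rewrite !linM !mulmxA; have /submxP[D ->] := WH Hz; rewrite -!mulmxA e.
Qed.

End Action.

Variables (G : set fdiff) (c : nat).
Hypotheses (gG : subgroup G) (nilG : lower_central_series G c = [set 1%g]%classic).
Local Notation gamma := (gamma G).

Let gGam : subgroup gamma := gamma_subgroup gG nilG.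

(** Induction on [d]. If the commutators of [H] do not all act trivially on [W], the last
term of the lower central series that does not commute with [H] on [W] provides an
element [a] which commutes on [W] with the commutators of [H]. These therefore preserve
the generalized eigenspaces of [a] in [W]. There are at least two of them: the
semisimple part of [a] would else be scalar on [W], and the unipotent part is central,
so that [a] would commute with [H] on [W]. Thus each eigenspace has smaller rank. *)
Lemma derived_acts_trivially d m (W : 'M[K]_(m, n)) (H : set fdiff) :
  subgroup H -> (H `<=` gamma)%classic -> (forall h, H h -> (W *m lin h <= W)%MS) ->
  (\rank W <= d)%N -> forall y, derived_series H d y -> W *m lin y = W.
Proof.
elim: d m W H => [|d IH] m W H gH HGam WH rW y Hy.
  have : W == 0 by rewrite -mxrank_eq0 -leqn0.
  by move/eqP->; rewrite mul0mx.
have cW := same_on_congruence WH.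
have W1 x : same_on W x 1%g <-> W *m lin x = W by rewrite /same_on lin1 mulmx1.
have g1 := derived_subgroup 1 gH.
have sub1 : (derived_series H d.+1 `<=` derived_series H 1)%classic.
  by rewrite -add1n derived_series_add; apply: derived_sub.
have [triv|] := pselect (forall x z, H x -> H z -> same_on W [~ x, z]%g 1%g).
  apply/W1; suff [] : H y /\ same_on W y 1%g by [].
  apply: (@commutator_subgroup_min _ H H (fun x => H x /\ same_on W x 1%g)) (sub1 _ Hy).
    exact: congr_kernel_subgroup.
  by move=> x z Hx Hz; split; [exact: subgroupR|exact: triv].
move=> /existsNP[x0 /existsNP[z0 /not_implyP[Hx0 /not_implyP[Hz0 nxz0]]]].
have [a [Ha [h0 Hh0 nah0] cen]] : exists a, [/\ H a,
    exists2 h, H h & ~ same_on W [~ h, a]%g 1%g &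
    forall x z, H x -> H z -> same_on W [~ [~ x, a], z]%g 1%g].
  pose P i := `[< exists a, [/\ lower_central_series H i a &
    exists2 h, H h & ~ same_on W [~ h, a]%g 1%g] >].
  have exP : exists i, P i.
    by exists 0%N; apply/asboolP; exists z0; split=> //; exists x0.
  have Pc i : P i -> (i <= c)%N.
    move=> /asboolP[a [ha [h Hh nha]]]; rewrite leqNgt; apply/negP => ci; apply: nha.
    have : lower_central_series gamma i a by apply: lower_central_subset ha.
    by move=> /(lower_central_trivial_leq ci (gamma_nilpotent gG nilG)) ->; rewrite commg1; case: cW.
  have [i /asboolP[a [ha nha]] imax] := ex_maxnP exP Pc.
  exists a; split; [exact: lower_central_sub ha|exact: nha|].
  move=> x z Hx Hz; apply: contrapT => nxz; have : P i.+1.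
    apply/asboolP; exists [~ x, a]%g; split; first exact: mem_commutator.
    exists z; first exact: Hz.
    move=> e; apply: nxz.
    have Hxa : H [~ x, a]%g := subgroupR gH Hx (lower_central_sub gH ha).
    apply/(congr_commg gH cW Hxa Hz)/esym; exact/(congr_commg gH cW Hz Hxa).
  by move/imax; rewrite ltnn.
have Hder x : derived_series H 1 x -> same_on W (x * a)%g (a * x)%g.
  move=> hx; suff [] : H x /\ same_on W (x * a)%g (a * x)%g by [].
  apply: (@commutator_subgroup_min _ H H (fun x => H x /\ same_on W (x * a)%g (a * x)%g)) hx.
    exact: congr_centralizer_subgroup.
  move=> u v Hu Hv; split; first exact: subgroupR.
  apply: (congr_commutator gH cW Ha _ Hu Hv) => p q Hp Hq.
  exact/(congr_commg gH cW (subgroupR gH Hp Ha) Hq)/cen.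
have [N [r [r1 rN rW']]] := mx_decomposition (lin a).
have Wa := WH _ Ha.
have hx (u : K * 'M[K]_n) : u \in r -> W *m u.2 *m lin y = W *m u.2.
  move=> xr; apply: (IH _ (W *m u.2) (derived_series H 1) g1).
  - by apply: subset_trans HGam; apply: derived_sub.
  - move=> h hh; have [_ comm] := rW' u _ W (lin h) xr Wa.
    rewrite comm; last by rewrite -!mulmxA -!linM; apply/esym/Hder.
    have /submxP[D ->] := WH _ (derived_sub gH hh).
    by rewrite -mulmxA submxMl.
  - rewrite -ltnS; apply: leq_trans rW; apply: rank_ltmx.
    have [Wx _] := rW' u _ W 1%:M xr Wa.
    rewrite ltmxE Wx /=; apply/negP => /submxP[D WD]; apply: nah0.
    have [s [z [[aE hs hz cz] _ hsl]]] := gamma_jordan gG nilG (HGam _ Ha).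
    have Ws : W *m lin s = u.1 *: W.
      apply/row_matrixP => i; rewrite row_mul linearZ /=; apply: (lin_semisimple hsl (N := N)).
      by rewrite WD -row_mul -!mulmxA rN // !mulmx0 row0.
    apply/(congr_commg gH cW Hh0 Ha).
    have /submxP[E WE] := WH _ Hh0.
    have e1 : W *m lin h0 *m lin a = u.1 *: (W *m lin (h0 * z)%g).
      rewrite WE aE linM mulmxA -(mulmxA E) Ws linM mulmxA WE.
      by rewrite -scalemxAr -scalemxAl.
    rewrite /same_on [lin (h0 * a)%g]linM mulmxA e1 aE -mulgA -(cz _ (HGam _ Hh0)).
    by rewrite [lin (s * _)%g]linM mulmxA Ws -scalemxAl.
  - by move: Hy; rewrite -add1n derived_series_add.
rewrite -[W in LHS]mulmx1 -[W in RHS]mulmx1 -r1 mulmx_sumr mulmx_suml big_seq [RHS]big_seq.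
by apply: eq_bigr => x /hx.
Qed.

Lemma gamma_derived_lin y : derived_series gamma n y -> lin y = 1%:M.
Proof.
move=> hy; have := @derived_acts_trivially n n 1%:M gamma gGam.
move=> /(_ (@subset_refl _ _)) h; have := h _ _ y hy; rewrite mul1mx; apply.
  by move=> x _; rewrite submx1.
exact: rank_leq_col.
Qed.

(** Commutators of the last derived subgroup are tangent to the identity, hence
equal to their unipotent factors, hence central; and a semisimple element commutes
with [h] as soon as its commutator with [h] is central and unipotent. *)
Lemma gamma_derived_trivial : (0 < n)%N -> derived_series gamma n = [set 1%g]%classic.
Proof.
move=> n0; apply/seteqP; split=> [|_ ->]; last first.
  exact: (subgroup1 (derived_subgroup n gGam)).
move=> y0 hy0; have {hy0} : derived_series gamma n.-1.+1 y0 by rewrite prednK.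
move: y0; apply: commutator_subgroup_min => [|g h hg hh]; first exact: set1_subgroup.
have Gg := derived_sub gGam hg; have Gh := derived_sub gGam hh.
set w := [~ g, h]%g.
have lw : lin w = 1%:M.
  have hw : derived_series gamma n.-1.+1 w := mem_commutator hg hh.
  by apply: gamma_derived_lin; rewrite prednK in hw.
have Gw : gamma w by apply: (subgroupR gGam).
have wc x : gamma x -> commute x w.
  have [s [z [[wE hs hz cz] _ hsl]]] := gamma_jordan gG nilG Gw.
  suff s1 : s = 1%g by move=> hx; rewrite wE s1 mul1g; apply: cz.
  apply: star_inj; rewrite star1; apply: small_sub_eq => k f.
  rewrite opBE op1E -[X in vanish k (_ - X)]scale1r; apply: (hsl _ _ k).
  by rewrite /geigen scale1r; apply: tangent_id_small.
have [s [z [[gE hs hz cz] [T [Tu sT]] _]]] := gamma_jordan gG nilG Gg.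
have wE : w = [~ s, h]%g.
  rewrite /w gE -[h in LHS]mulg1 commg_mul_commute ?comm1g ?commg1 ?mulg1 //.
  - exact/commute_sym/cz.
  - exact/commute_sym/cz.
  - exact: commute1.
  - exact: commute1.
have STW : star s * star h = star h * star s * star w.
  by rewrite -!starM wE -commgC.
have sw : star s * star w = star w * star s by rewrite -!starM (wc _ hs).
have hw : star h * star w = star w * star h by rewrite -!starM (wc _ Gh).
have adS i : iter i (ad (star s)) (star h) = star h * star s ^+ i * (star w - 1) ^+ i.
  elim: i => [|i IH]; first by rewrite !expr0 !mulr1.
  rewrite iterS IH /ad; move: (star s) (star h) (star w) STW sw => S Q V SQV SV.
  have SiV : V * S ^+ i = S ^+ i * V by apply: commrX; rewrite /GRing.comm SV.
  have SU : (V - 1) ^+ i * S = S * (V - 1) ^+ i.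
    by apply/commr_sym/commrX; rewrite /GRing.comm mulrBl mulrBr mulr1 mul1r SV.
  have -> : S * (Q * S ^+ i * (V - 1) ^+ i) = Q * S ^+ i.+1 * (V * (V - 1) ^+ i).
    by rewrite exprS !mulrA SQV -!mulrA (mulrA V) SiV !mulrA.
  have -> : Q * S ^+ i * (V - 1) ^+ i * S = Q * S ^+ i.+1 * (V - 1) ^+ i.
    by rewrite -mulrA SU exprSr !mulrA.
  by rewrite -mulrBr -[X in _ * (_ - X)]mul1r -mulrBl -exprS.
have ad0 : ad (star s) (star h) = 0.
  apply: small_eq0 => k; apply: (@small_commute _ _ _ (star s) _ _ k).
  - exact: star_unit.
  - by rewrite sT => l N v; apply: semisimple_geigen.
  - by rewrite adS; apply/smallMl/tangent_id_small.
rewrite /= -/w wE; apply/eqP/commgP; apply: star_inj; rewrite !starM.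
by apply/eqP; rewrite -subr_eq0; apply/eqP.
Qed.

Theorem derived_length_leq : (0 < n)%N -> derived_series G n = [set 1%g]%classic.
Proof.
move=> n0; apply/seteqP; split=> [|_ ->]; last first.
  exact: (subgroup1 (derived_subgroup n gG)).
move=> x /(derived_gamma gG nilG)[p [e [hp he ->]]].
move: hp; rewrite (gamma_derived_trivial n0) => ->.
by rewrite (exp_group_trivial gG nilG he) mulg1.
Qed.

End DerivedLength.

(** * Weighted polynomials *)

Section GeometricSeries.
Variables (K : fieldType) (n : nat).
Local Notation A := (fseries K n).
Implicit Types (f g : A) (j k : nat).

Lemma vanishX f j : vanish 1 f -> vanish j (f ^+ j).
Proof.
move=> f1; elim: j => [//|j IH]; rewrite exprS -add1n; exact: vanishM.
Qed.

Lemma geometric_series f : vanish 1 f -> exists g, (1 - f) * g = 1.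
Proof.
move=> f1; pose s k : A := \sum_(j < k) f ^+ j; pose g : A := fun m => s (mdeg m).+1 m.
have gs k : vanish k (g - s k).
  move=> m mk; rewrite fsBE /g /s.
  rewrite -(subnKC mk) big_split_ord /= fsDE opprD addrA subrr add0r.
  rewrite fs_sumE big1 ?oppr0 // => j _.
  by apply: (vanishX f1 (j := (mdeg m).+1 + j)); rewrite addSn ltnS leq_addr.
exists g; apply/eqP; rewrite -subr_eq0; apply/eqP/vanish_eq0 => k.
have -> : (1 - f) * g - 1 = (1 - f) * (g - s k) - f ^+ k.
  rewrite [X in _ = X - _]mulrBr.
  have -> : (1 - f) * s k = 1 - f ^+ k.
    apply/esym; rewrite /s -{1}(expr1n A k) subrXX; congr (_ * _).
    by apply: eq_bigr => j _; rewrite expr1n mul1r.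
  by rewrite opprB addrA addrAC addrK.
by apply: vanishB; [apply: vanishMl|apply: vanishX].
Qed.

End GeometricSeries.

Section Weights.
Variables (K : numClosedFieldType) (n : nat).
Local Notation A := (fseries K n.+1).
Local Notation op := (op K n.+1).
Local Notation fdiff := (fdiff K n.+1).
Local Notation X := (fs_var K).
Local Notation X0 := (fs_var K (ord0 : 'I_n.+1)).
Implicit Types (f g q u v : A) (B i j k : nat) (x y : fdiff) (m : 'X_{1..n.+1}).

(** For [i > 0] the weight of [i] exceeds the sum of the previous weights by two, and the
weight of [i.+1] is twice that of [i]. *)
Definition wt i : nat := if i is i'.+1 then 3 * 2 ^ i' else 1.

Lemma wt_gt0 i : (0 < wt i)%N.
Proof. by case: i => // i; rewrite muln_gt0 expn_gt0. Qed.

Definition mwt m : nat := \sum_(i < n.+1) wt i * m i.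

Lemma mwtD m m' : mwt (m + m')%MM = (mwt m + mwt m')%N.
Proof. by rewrite -big_split; apply: eq_bigr => i _; rewrite mnmDE mulnDr. Qed.

Lemma mwt0 : mwt 0%MM = 0%N.
Proof. by rewrite /mwt big1 // => i _; rewrite mnm0E muln0. Qed.

Lemma mwt1 (i : 'I_n.+1) : mwt U_(i)%MM = wt i.
Proof.
rewrite /mwt (bigD1 i) //= mnm1E eqxx muln1 big1 ?addn0 // => l li.
by rewrite mnm1E eq_sym (negbTE li) muln0.
Qed.

Lemma mdeg_mwt m : (mdeg m <= mwt m)%N.
Proof.
by rewrite mdegE; apply: leq_sum => i _; rewrite leq_pmull ?wt_gt0.
Qed.

(** Series supported on the monomials of weight at most [B], which are polynomials. *)
Definition wpoly B f := forall m, f m != 0 -> (mwt m <= B)%N.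

Lemma wpoly0 B : wpoly B 0.
Proof. by move=> m; rewrite eqxx. Qed.

Lemma wpolyD B f g : wpoly B f -> wpoly B g -> wpoly B (f + g).
Proof.
move=> hf hg m; have [f0|/hf //] := eqVneq (f m) 0.
by rewrite fsDE f0 add0r => /hg.
Qed.

Lemma wpolyZ B (a : K) f : wpoly B f -> wpoly B (a *: f).
Proof. by move=> hf m; rewrite fsZE mulf_eq0 => /norP[_ /hf]. Qed.

Lemma wpolyB B f g : wpoly B f -> wpoly B g -> wpoly B (f - g).
Proof. by move=> hf hg; rewrite -scaleN1r; apply: wpolyD => //; apply: wpolyZ. Qed.

Lemma wpoly_sum B (I : Type) (r : seq I) (P : pred I) (F : I -> A) :
  (forall a, P a -> wpoly B (F a)) -> wpoly B (\sum_(a <- r | P a) F a).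
Proof. by move=> h; elim/big_ind: _ => //; [exact: wpoly0|exact: wpolyD]. Qed.

Lemma wpoly_leq B B' f : (B <= B')%N -> wpoly B f -> wpoly B' f.
Proof. by move=> BB' hf m /hf h; apply: leq_trans BB'. Qed.

Lemma wpoly1 : wpoly 0 1.
Proof.
by move=> m; change ((m == 0%MM)%:R != 0 :> K -> (mwt m <= 0)%N); case: (m =P 0%MM) => [->|_]; rewrite ?mwt0 ?eqxx.
Qed.

Lemma wpolyX (i : 'I_n.+1) : wpoly (wt i) (X i).
Proof.
by move=> m; rewrite /fs_var; case: (m =P U_(i)%MM) => [->|_]; rewrite ?mwt1 ?eqxx.
Qed.

Lemma wpolyM B B' f g : wpoly B f -> wpoly B' g -> wpoly (B + B') (f * g).
Proof.
move=> hf hg m; rewrite fsME => nz.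
have [b /andP[/eqP mE /andP[fb gb]]] : exists b : 'X_{1..n.+1 < (mdeg m).+1, (mdeg m).+1},
    (m == (b.1 + b.2)%MM) && ((f b.1 != 0) && (g b.2 != 0)).
  apply: contrapT => h; case/eqP: nz; rewrite big1 // => b mb; apply/eqP.
  rewrite mulf_eq0; apply: contrapT => /negP/norP[fb gb]; apply: h; exists b.
  by rewrite mb fb gb.
by rewrite mE mwtD; apply: leq_add; [exact: hf|exact: hg].
Qed.

Lemma wpolyXn B f j : wpoly B f -> wpoly (B * j) (f ^+ j).
Proof.
move=> hf; elim: j => [|j IH]; first by rewrite muln0; exact: wpoly1.
by rewrite mulnS exprS; apply: wpolyM.
Qed.

Lemma wpoly_prod (I : Type) (r : seq I) (P : pred I) (F : I -> A) (b : I -> nat) :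
  (forall a, P a -> wpoly (b a) (F a)) ->
  wpoly (\sum_(a <- r | P a) b a) (\prod_(a <- r | P a) F a).
Proof.
move=> h; elim/big_rec2: _ => [|a d f Pa hf]; first exact: wpoly1.
by apply: wpolyM => //; apply: h.
Qed.

Lemma wpoly_trunc B f : wpoly B f -> f = fs_of_mpoly (fs_trunc B f).
Proof.
move=> hf; apply/funext => m; rewrite /fs_of_mpoly.
have [mB|Bm] := leqP (mdeg m) B; first by rewrite fs_truncK.
have -> : f m = 0.
  by apply/eqP; apply: contraTT Bm => /hf h; rewrite -leqNgt (leq_trans (mdeg_mwt m)).
apply/esym/eqP; apply: contraTT Bm; rewrite -mcoeff_msupp -leqNgt => hm.
by rewrite -ltnS; apply: leq_trans (msize_mdeg_lt hm) (msize_trunc B f).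
Qed.

Lemma wpoly_vanish_eq0 B f : wpoly B f -> vanish B.+1 f -> f = 0.
Proof.
move=> hf vf; apply/funext => m; apply/eqP; apply: contraT => nz.
have := hf m nz => mB; move: nz; rewrite vf ?eqxx // ltnS.
exact: leq_trans (mdeg_mwt m) mB.
Qed.

Definition affine (a : K) : A := 1 + a *: X0.

Lemma wpoly_affine a : wpoly 1 (affine a).
Proof.
apply: wpolyD; first exact: wpoly_leq wpoly1.
by apply: wpolyZ; have := @wpolyX ord0.
Qed.

(** Homogenizing by powers of [1 + a x_0] turns the substitution of [x] into a
linear transformation of the polynomials of weighted degree at most [B]. *)
Definition weighted (a : K) x := forall k : 'I_n.+1, wpoly (wt k) (affine a ^+ wt k * x k).

(** Each factor [x_i] of a monomial is sent to a polynomial of weight [wt i] divided by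
[affine a ^+ wt i]. *)
Lemma weighted_star a x B q : weighted a x -> wpoly B q ->
  wpoly B (affine a ^+ B * star x q).
Proof.
move=> hx hq; rewrite (wpoly_trunc hq) /fs_trunc.
rewrite [fs_of_mpoly _]linear_sum [star x _]linear_sum mulr_sumr.
apply: wpoly_sum => m _; rewrite 2!linearZ -scalerAr.
have [->|nz] := eqVneq (q m) 0; first by rewrite scale0r; exact: wpoly0.
apply: wpolyZ; move: (star x) (star_mult x) (star_var x) => T hT Tv.
rewrite mpolyXE_id rmorph_prod /= multiplicative_op_prod //.
have -> : \prod_(i < n.+1) T (fs_of_mpoly ('X_i ^+ (val m) i)) =
    \prod_(i < n.+1) x i ^+ (val m) i.
  by apply: eq_bigr => i _; rewrite rmorphXn /= fs_of_mpolyX multiplicative_opX // Tv.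
have mB : (mwt m <= B)%N := hq _ nz.
have -> : affine a ^+ B = affine a ^+ (B - mwt m) * affine a ^+ mwt m.
  by rewrite -exprD subnK.
rewrite -mulrA -[X in wpoly X _](subnK mB); apply: wpolyM.
  by rewrite -[X in wpoly X _]mul1n; apply/wpolyXn/wpoly_affine.
rewrite /mwt expr_sum -big_split; apply: wpoly_prod => i _ /=.
by rewrite exprM -exprMn; apply: wpolyXn; apply: hx.
Qed.

End Weights.

(** * A nilpotent group of weighted substitutions *)

Section Depth.
Variables (K : numClosedFieldType) (n : nat).
Local Notation A := (fseries K n).
Local Notation op := (op K n).
Local Notation fdiff := (fdiff K n).
Implicit Types (f g : A) (S T : op) (i j k : nat) (x y : fdiff).

Definition raises j T := forall i f, vanish i f -> vanish (i + j) (T f).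

Lemma raisesD j S T : raises j S -> raises j T -> raises j (S + T).
Proof. by move=> hS hT i f fi; rewrite opDE; apply: vanishD; [apply: hS|apply: hT]. Qed.

Lemma raisesB j S T : raises j S -> raises j T -> raises j (S - T).
Proof. by move=> hS hT i f fi; rewrite opBE; apply: vanishB; [apply: hS|apply: hT]. Qed.

Lemma raisesM j k S T : raises j S -> raises k T -> raises (j + k) (S * T).
Proof. by move=> hS hT i f fi; rewrite opME addnA; apply/hT/hS. Qed.

Lemma raises_op T : raises 0 T.
Proof. by move=> i f fi; rewrite addn0; apply: op_vanish. Qed.

Lemma raisesMl j S T : raises j T -> raises j (S * T).
Proof. by rewrite -[j in X in _ -> X]add0n; apply: raisesM; apply: raises_op. Qed.

Lemma raisesMr j S T : raises j S -> raises j (S * T).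
Proof. by move=> h; rewrite -[j]addn0; apply: raisesM => //; apply: raises_op. Qed.

Lemma raisesX j T : raises 1 T -> raises j (T ^+ j).
Proof.
move=> h; elim: j => [|j IH]; first exact: raises_op.
by rewrite exprS -add1n; apply: raisesM.
Qed.

Definition deep j : set fdiff := fun x => raises j (star x - 1).

Lemma deep_subgroup j : subgroup (deep j).
Proof.
apply/subgroupP; split=> [|x y hx hy|x hx]; rewrite /deep.
- by rewrite star1 subrr => i f _; exact: vanish0.
- have -> : star (x * y)%g - 1 = (star x - 1) * star y + (star y - 1).
    by rewrite starM mulrBl mul1r addrA subrK.
  exact: raisesD (raisesMr _ hx) hy.
- have -> : star x^-1%g - 1 = 0 - (star x - 1) * star x^-1%g.
    by rewrite mulrBl mul1r starVr sub0r opprB.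
  by apply: raisesB; [move=> i f _; exact: vanish0|apply: raisesMr].
Qed.

(** The commutator differs from the identity by
[(star x - 1) * (star y - 1) - (star y - 1) * (star x - 1)] up to an invertible factor. *)
Lemma deep_commg i j x y : deep i x -> deep j y -> deep (i + j) [~ x, y]%g.
Proof.
move=> hx hy; have e : star x * star y = star y * star x * star [~ x, y]%g.
  by rewrite -!starM -commgC.
rewrite /deep; have -> : star [~ x, y]%g - 1 = star (y * x)^-1%g *
    ((star x - 1) * (star y - 1) - (star y - 1) * (star x - 1)).
  have -> : (star x - 1) * (star y - 1) - (star y - 1) * (star x - 1) =
      star x * star y - star y * star x.
    move: (star x) (star y) => S T; rewrite !mulrBl !mulrBr !mulr1 !mul1r.
    move: (S * T) (T * S) => ST TS; apply: opP => f; rewrite !(opDE, opBE, opNE).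
    by move: (ST f) (TS f) (S f) (T f) (op1E f) => *; ring.
  have VP : star (y * x)^-1%g * (star y * star x) = 1 by rewrite -starM starV.
  by rewrite mulrBr e mulrA VP mul1r.
apply: raisesMl; apply: raisesB; first exact: raisesM hx hy.
rewrite addnC; exact: raisesM hy hx.
Qed.

Lemma deep1 x : lin x = 1%:M -> deep 1 x.
Proof.
by move=> hx i f fi; rewrite opBE op1E addn1; apply: tangent_id_vanish.
Qed.

Lemma deep_lower_central (G : set fdiff) j : (G `<=` deep 1)%classic ->
  (lower_central_series G j `<=` deep j.+1)%classic.
Proof.
move=> G1; elim: j => [//|j IH].
apply: commutator_subgroup_min => [|x y /G1 hx /IH hy]; first exact: deep_subgroup.
by rewrite -add1n; apply: deep_commg.
Qed.

End Depth.

Lemma sum_expr_mulB (R : nzRingType) (u : R) i :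
  (\sum_(j < i) u ^+ j) * (1 - u) = 1 - u ^+ i.
Proof.
elim: i => [|i IH]; first by rewrite big_ord0 mul0r expr0 subrr.
by rewrite big_ord_recr mulrDl IH mulrBr mulr1 -exprSr addrA subrK.
Qed.

Section WeightedGroup.
Variables (K : numClosedFieldType) (n : nat).
Local Notation A := (fseries K n.+1).
Local Notation op := (op K n.+1).
Local Notation fdiff := (fdiff K n.+1).
Local Notation X := (@fs_var K n.+1).
Local Notation X0 := (@fs_var K n.+1 ord0).
Local Notation affine := (@affine K n).
Implicit Types (f g q u v : A) (B i j : nat) (x y : fdiff) (k : 'I_n.+1) (a b : K).

Definition weighted_group : set fdiff :=
  fun x => lin x = 1%:M /\ exists a, weighted a x.

Lemma weighted_group_vanish x k : lin x = 1%:M -> vanish 2 (x k - X k).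
Proof. by move=> hx; rewrite -star_var; apply: tangent_id_vanish; last exact: vanish_var. Qed.

(** A polynomial of weight one is an affine function of [x_0]. *)
Lemma weighted_ord0 a x : lin x = 1%:M -> weighted a x -> affine a * x ord0 = X0.
Proof.
move=> lx /(_ ord0); rewrite expr1 => hx; apply/eqP; rewrite -subr_eq0; apply/eqP.
apply: (@wpoly_vanish_eq0 _ _ 1); first by apply: wpolyB => //; exact: (@wpolyX _ _ ord0).
have -> : affine a * x ord0 - X0 = (x ord0 - X0) + a *: (X0 * x ord0).
  by rewrite /affine mulrDl mul1r -scalerAl addrAC.
apply: vanishD; first exact: weighted_group_vanish.
apply/vanishZ/(@vanishM _ _ 1 1); first exact: vanish_var.
by apply/vanish1/fdiff0.
Qed.

Lemma star_affine a x : star x (affine a) = 1 + a *: x ord0.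
Proof.
have opD f g : star x (f + g) = star x f + star x g by exact: raddfD.
have opZ f : star x (a *: f) = a *: star x f by exact: linearZ.
by rewrite /affine opD opZ star1F star_var.
Qed.

Lemma weightedM a b x y : lin y = 1%:M -> weighted a x -> weighted b y ->
  weighted (a + b) (x * y)%g.
Proof.
move=> ly hx hy k; have y0 := weighted_ord0 ly hy.
have -> : (x * y)%g k = star y (x k) by [].
have -> : affine (a + b) = affine b * star y (affine a).
  rewrite star_affine mulrDr mulr1.
  by rewrite -scalerAr y0 /affine scalerDl addrAC addrA.
rewrite exprMn -(multiplicative_opX _ _ (star_mult y)) -mulrA -starMF.
exact: weighted_star.
Qed.

(** The substitution of [x] differs from the identity by a nilpotent
transformation on weighted polynomials, so that it can be inverted there. *)
Lemma weighted_preimage a x k : lin x = 1%:M -> weighted a x ->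
  exists2 q, wpoly (wt k) q & affine a ^+ wt k * star x q = X k.
Proof.
move=> lx hx; set w := wt k; pose T := star x * mulop (affine a ^+ w).
have TE f : T f = affine a ^+ w * star x f by [].
pose U := 1 - T.
have hU B f : w = B -> wpoly B f -> wpoly B (U f).
  move=> <- hf; rewrite /U opBE op1E TE; apply: wpolyB => //.
  exact: weighted_star.
have U1 : raises 1 U.
  have aff1 : vanish 1 (affine a ^+ w - 1).
    have h : vanish 1 (affine a - 1).
      by rewrite /affine addrAC subrr add0r; apply/vanishZ/vanish_var.
    elim: (w) => [|i IH]; first by rewrite expr0 subrr.
    have -> : affine a ^+ i.+1 - 1 = affine a * (affine a ^+ i - 1) + (affine a - 1).
      by rewrite exprS mulrBr mulr1 addrA subrK.
    by apply: vanishD => //; apply: vanishMl.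
  move=> i f fi.
  have -> : U f = - (star x f - f) - (affine a ^+ w - 1) * star x f.
    by rewrite /U opBE op1E TE; ring.
  apply: vanishB; first by apply: vanishN; rewrite addn1; apply: tangent_id_vanish.
  by rewrite addnC; apply: vanishM => //; apply: op_vanish.
have hUj j : wpoly w ((U ^+ j) (X k)).
  by elim: j => [|j IH]; [exact: wpolyX|rewrite opXSE; apply: hU].
(* The geometric series inverts [T = 1 - U] up to [U ^+ w.+1], which raises the order
   above the weight [w]. *)
exists (\sum_(j < w.+1) (U ^+ j) (X k)); first by apply: wpoly_sum => j _.
rewrite -TE; apply/eqP; rewrite -subr_eq0; apply/eqP.
have -> : T (\sum_(j < w.+1) (U ^+ j) (X k)) - X k = - (U ^+ w.+1) (X k).
  have c : (\sum_(j < w.+1) U ^+ j) * T = 1 - U ^+ w.+1.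
    have -> : T = 1 - U by rewrite /U opprB addrC subrK.
    exact: sum_expr_mulB.
  rewrite -op_sumE -opME c opBE op1E addrC addKr //.
rewrite (@wpoly_vanish_eq0 _ _ w ((U ^+ w.+1) (X k))) ?oppr0 //.
apply: (@vanish_leq _ _ _ (0 + w.+1)) => //; exact: (@raisesX _ _ w.+1 U U1 0 (X k) (@vanish_0 _ _ _)).
Qed.

Lemma affine_opp a f : (1 + a *: f) * X0 = f -> affine (- a) * (1 + a *: f) = 1.
Proof.
rewrite mulrDl mul1r => e; rewrite /affine.
have Z g : a *: g = (a%:A : A) * g by rewrite mulr_algl.
have -> : (1 + (- a) *: X0) * (1 + a *: f) = 1 + a *: (f - (X0 + a *: f * X0)).
  by rewrite scaleNr (Z X0) (Z f) (Z (f - _)); move: (a%:A : A) => c; ring.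
by rewrite e subrr scaler0 addr0.
Qed.

Lemma weightedV a x : lin x = 1%:M -> weighted a x -> weighted (- a) x^-1%g.
Proof.
move=> lx hx k; have [q hq qE] := weighted_preimage k lx hx.
set y := x^-1%g; pose H0 := y ord0.
have yx f : star y (star x f) = f by rewrite -opME starVr.
have yA : star y (affine a) = 1 + a *: H0.
  exact: star_affine.
have e1 : (1 + a *: H0) * X0 = H0.
  have XE : X0 = star y (x ord0) by rewrite -(star_var x) yx.
  by rewrite -yA XE -starMF weighted_ord0 // star_var.
have e2 : affine (- a) * (1 + a *: H0) = 1 by apply: affine_opp.
have -> : y k = (1 + a *: H0) ^+ wt k * q.
  by rewrite -[q in RHS]yx -yA -(multiplicative_opX _ _ (star_mult y)) -starMF qE star_var.
by rewrite mulrA -exprMn e2 expr1n mul1r.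
Qed.

Lemma weighted_group_subgroup : subgroup weighted_group.
Proof.
apply/subgroupP; split=> [|x y [lx [a hx]] [ly [b hy]]|x [lx [a hx]]].
- split; first exact: lin1.
  exists 0 => k; rewrite /affine scale0r addr0 expr1n mul1r; exact: wpolyX.
- split; first by rewrite linM lx ly mulmx1.
  by exists (a + b); apply: weightedM.
- split; first by rewrite -[LHS]mul1mx -lx linV.
  by exists (- a); apply: weightedV.
Qed.

(** The first coordinate shows that [a = 0], and then each coordinate minus the identity is
a polynomial of weight [wt k] and of order greater than [wt k], hence zero. *)
Lemma weighted_group_deep x : weighted_group x ->
  deep (\max_(k < n.+1) wt k).+2 x -> x = 1%g.
Proof.
move=> [lx [a hx]] dx; set N := \max_(k < n.+1) wt k.
have dk k : vanish N.+2 (x k - X k).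
  have := dx 1%N _ (vanish_var K k); rewrite opBE op1E star_var.
  by apply: vanish_leq; rewrite add1n ltnS leqnSn.
have N1 : (1 <= N)%N by apply: (@leq_bigmax_cond _ _ (fun k : 'I_n.+1 => wt k) ord0).
have a0 : a = 0.
  have e := weighted_ord0 lx hx; move: e; rewrite /affine mulrDl mul1r -scalerAl => e.
  have h : vanish 3 (a *: (X0 * X0)).
    have -> : a *: (X0 * X0) = - (x ord0 - X0) - a *: (X0 * (x ord0 - X0)).
      by rewrite -{3}e mulrBr scalerBr; ring.
    have d3 : vanish 3 (x ord0 - X0) by apply: vanish_leq (dk _).
    by apply: vanishB; [apply: vanishN|apply/vanishZ/vanishMl].
  have := h (U_(ord0) + U_(ord0))%MM; rewrite mdegD !mdeg1 fsZE => /(_ isT) /eqP.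
  rewrite -!fs_of_mpolyX -rmorphM /= -mpolyXD /fs_of_mpoly mcoeffX eqxx mulr1.
  by move/eqP.
apply: fdiff_eq => k; apply/eqP; rewrite -subr_eq0; apply/eqP.
apply: (@wpoly_vanish_eq0 _ _ (wt k)).
  apply: wpolyB; last exact: wpolyX.
  by have := hx k; rewrite a0 /affine scale0r addr0 expr1n mul1r.
apply: vanish_leq (dk k); rewrite ltnS; apply: leqW.
exact: (@leq_bigmax_cond _ _ (fun k : 'I_n.+1 => wt k)).
Qed.

Lemma weighted_group_nilpotent : nilpotent weighted_group.
Proof.
exists (\max_(k < n.+1) wt k).+1; apply/seteqP; split=> [x hx|_ ->]; last first.
  exact: (subgroup1 (lower_central_subgroup _ weighted_group_subgroup)).
apply: weighted_group_deep; first exact: (lower_central_sub weighted_group_subgroup hx).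
by apply: (deep_lower_central _ hx) => y [ly _]; exact: deep1.
Qed.

End WeightedGroup.

(** * Iterated commutators of shears *)

Section Shears.
Variables (K : numClosedFieldType) (n : nat).
Local Notation A := (fseries K n.+1).
Local Notation fdiff := (fdiff K n.+1).
Local Notation X := (@fs_var K n.+1).
Local Notation X0 := (@fs_var K n.+1 ord0).
Local Notation affine := (@affine K n).
Local Notation WG := (@weighted_group K n).
Implicit Types (f g q u v w : A) (j k l : nat) (x y a b d : fdiff) (i : 'I_n.+1).

Lemma tangent_fdiff (F : 'I_n.+1 -> A) : (forall i, vanish 2 (F i - X i)) ->
  exists x : fdiff, lin x = 1%:M /\ forall i, x i = F i.
Proof.
move=> hF; have E i (m : 'X_{1..n.+1}) : (mdeg m < 2)%N -> F i m = X i m.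
  by move=> m2; apply/eqP; rewrite -subr_eq0 -fsBE hF.
have lF : linear_part F = 1%:M.
  by rewrite -linear_part_var; apply/matrixP => i i'; rewrite !mxE E ?mdeg1.
have FP : is_fdiff F.
  rewrite /is_fdiff lF unitmx1 andbT; apply/forallP => i.
  by rewrite E ?mdeg0 // fs_var0.
by exists (FDiff FP).
Qed.

Definition Xn l : A := X (inord l).
Definition Xprod j k : A := \prod_(j <= l < k) Xn l.

Lemma wpoly_Xprod j k : (k <= n.+1)%N -> wpoly (\sum_(j <= l < k) wt l) (Xprod j k).
Proof.
move=> kn; rewrite big_nat [X in wpoly X](_ : _ = \sum_(j <= l < k | (j <= l < k)%N) wt (inord l : 'I_n.+1))%N.
  rewrite /Xprod big_nat; apply: wpoly_prod => l _; exact: wpolyX.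
by apply: eq_bigr => l /andP[_ lk]; rewrite inordK // (leq_trans lk).
Qed.

Lemma sum_wt j k : (j < k)%N -> (wt j.+1 + \sum_(j.+1 <= l < k) wt l)%N = wt k.
Proof.
elim: k => // k IH; rewrite ltnS leq_eqVlt => /orP[/eqP ->|jk].
  by rewrite big_geq // addn0.
rewrite big_nat_recr //= addnA IH //.
by case: k jk {IH} => // k _; rewrite /= expnS; ring.
Qed.

Definition shear k u x := lin x = 1%:M /\ forall i, x i = X i + (u *+ (i == k :> nat)).

Lemma shear_ord0 k u x : (0 < k)%N -> shear k u x -> x ord0 = X0.
Proof. by move=> k0 [_ ->]; rewrite /= eq_sym (gtn_eqF k0) mulr0n addr0. Qed.

Lemma shear_Xprod k u x j m : (k < j)%N || (m <= k)%N -> (m <= n.+1)%N -> shear k u x ->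
  star x (Xprod j m) = Xprod j m.
Proof.
move=> jkm mn [_ hx]; rewrite /Xprod (multiplicative_op_prod _ _ _ (star_mult x)).
rewrite big_nat [RHS]big_nat; apply: eq_bigr => l /andP[jl lm].
rewrite /Xn star_var hx inordK ?(leq_trans lm) //.
have -> : (l == k) = false; last by rewrite mulr0n addr0.
by apply/eqP => e; move: jkm; rewrite -e ltnNge jl leqNgt lm.
Qed.

Lemma star_add x f g : star x (f + g) = star x f + star x g.
Proof. exact: raddfD. Qed.
Lemma star_muln x f j : star x (f *+ j) = star x f *+ j.
Proof. exact: raddfMn. Qed.

Lemma shear_in_group k u : (k <= n)%N -> vanish 2 u -> wpoly (wt k) u ->
  exists x, shear k u x /\ WG x.
Proof.
move=> kn u2 hu; have [|x [lx xE]] := @tangent_fdiff (fun i => X i + u *+ (i == k :> nat)).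
  by move=> i; rewrite addrC addKr; case: eqP => _ //; rewrite mulr0n.
exists x; do 2 split => //; exists 0 => i.
rewrite /affine scale0r addr0 expr1n mul1r xE; apply: wpolyD; first exact: wpolyX.
by case: eqP => [->|_]; rewrite ?mulr1n ?mulr0n //; exact: wpoly0.
Qed.

(** The monomial [x_0 ^ wt j * x_j * ... * x_(k - 1)], of weight [wt k] when [0 < j <= k]. *)
Definition monom j k : A := X0 ^+ wt j * Xprod j k.

Lemma wt_ge3 j : (0 < j)%N -> (3 <= wt j)%N.
Proof. by case: j => // j _; rewrite /= leq_pmulr // expn_gt0. Qed.

Lemma wpoly_X0 j : wpoly j (X0 ^+ j).
Proof. by have := @wpolyXn _ _ 1 _ j (@wpolyX K n ord0); rewrite mul1n. Qed.

Lemma vanish_X0 j f : (2 <= j)%N -> vanish 2 (X0 ^+ j * f).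
Proof.
move=> j2; apply/vanishMr/(vanish_leq j2)/vanishX; exact: vanish_var.
Qed.

Lemma wtS j : (0 < j)%N -> wt j.+1 = (wt j + wt j)%N.
Proof. by case: j => // j _; rewrite /= expnS; ring. Qed.

(** Substituting [a] in the monomial of [b] replaces [x_j] by [x_j + x_0 ^ wt j], which adds
the monomial of index [j.+1] because [wt j.+1] is twice [wt j]. *)
Lemma commg_shear j k a b : (0 < j)%N -> (j < k <= n)%N ->
  shear j (monom j j) a -> shear k (monom j k) b -> shear k (monom j.+1 k) [~ b, a]%g.
Proof.
move=> j0 /andP[jk kn] ha hb.
have k0 : (0 < k)%N by apply: leq_trans jk.
have jE : monom j j = X0 ^+ wt j by rewrite /monom /Xprod big_geq // mulr1.
rewrite jE in ha.
have [|d [ld dE]] := @tangent_fdiff (fun i => X i + monom j.+1 k *+ (i == k :> nat)).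
  move=> i; rewrite addrC addKr; case: eqP => _ //; rewrite mulr1n.
  by apply: vanish_X0; apply: leq_trans (wt_ge3 _).
have hd : shear k (monom j.+1 k) d by [].
suff e : (b * a = a * b * d)%g.
  suff -> : [~ b, a]%g = d by [].
  by apply: (mulgI (a * b)%g); rewrite -e -commgC.
have starX0 x u m : (0 < m)%N -> shear m u x -> star x (X0 ^+ wt j) = X0 ^+ wt j.
  by move=> m0 hx; rewrite (multiplicative_opX _ _ (star_mult x)) star_var (shear_ord0 m0 hx).
have dm : star d (monom j k) = monom j k.
  rewrite /monom starMF (starX0 _ _ _ k0 hd) (shear_Xprod _ _ hd) ?leqnn ?orbT //.
  by rewrite leqW.
have bm : monom j k = X0 ^+ wt j * (Xn j * Xprod j.+1 k) by rewrite /monom /Xprod big_ltn.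
have am : star a (monom j k) = monom j k + monom j.+1 k.
  rewrite bm !starMF (starX0 _ _ _ j0 ha) (shear_Xprod _ _ ha) ?leqnn ?leqW //.
  rewrite /Xn star_var; have [_ ->] := ha.
  rewrite inordK ?(leq_trans jk (leqW kn)) // eqxx mulr1n /monom wtS // exprD; ring.
apply: fdiff_eq => i.
have -> : (b * a)%g i = star a (b i) by [].
have -> : (a * b * d)%g i = star d (star b (a i)) by [].
have [_ bE] := hb; have [_ aE] := ha.
rewrite bE aE !star_add !star_muln !star_var aE am bE !star_add !star_muln star_var dE dm.
rewrite (starX0 _ _ _ k0 hb) (starX0 _ _ _ k0 hd).
by rewrite mulrnDl; ring.
Qed.

(** The homography [x_0 / (1 + x_0)], with the multipliers on the other coordinates that
make it a weighted substitution. *)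
Lemma moebius_in_group : exists w, affine 1 * w = 1 /\
  exists a, [/\ WG a, lin a = 1%:M & forall i, a i = X i * w ^+ wt i].
Proof.
have [w wE] : exists w, affine 1 * w = 1.
  have [w wE] := geometric_series (vanishN (vanish_var K (ord0 : 'I_n.+1))).
  by exists w; rewrite /affine scale1r -[X0]opprK.
exists w; split=> //.
have w1 : vanish 1 (w - 1).
  have -> : w - 1 = - (X0 * w) by rewrite -wE /affine scale1r; ring.
  by apply/vanishN/vanishMr/vanish_var.
have wj j : vanish 1 (w ^+ j - 1).
  elim: j => [|j IH]; first by rewrite expr0 subrr.
  have -> : w ^+ j.+1 - 1 = w * (w ^+ j - 1) + (w - 1).
    by rewrite exprS mulrBr mulr1 addrA subrK.
  by apply: vanishD => //; apply: vanishMl.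
have [|a [la aE]] := @tangent_fdiff (fun i => X i * w ^+ wt i).
  move=> i; rewrite -[X in _ - X]mulr1 -mulrBr.
  by apply: (@vanishM _ _ 1 1) => //; exact: vanish_var.
exists a; split=> //; split=> //; exists 1 => i.
by rewrite aE mulrCA -exprMn wE expr1n mulr1; exact: wpolyX.
Qed.

(** The monomial added by [b] has weight [wt k - 1], so that [a] divides it by one power of
[1 + x_0] less than the coordinate [k]: the difference is its product with [x_0]. *)
Lemma commg_moebius w k a b : affine 1 * w = 1 -> lin a = 1%:M ->
  (forall i, a i = X i * w ^+ wt i) -> (0 < k <= n)%N ->
  shear k (X0 ^+ 2 * Xprod 1 k) b -> shear k (monom 1 k) [~ b, a]%g.
Proof.
move=> wE la aE /andP[k0 kn] hb; set u := _ * _ in hb.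
have [|d [ld dE]] := @tangent_fdiff (fun i => X i + monom 1 k *+ (i == k :> nat)).
  by move=> i; rewrite addrC addKr; case: eqP => _ //; rewrite mulr1n; apply: vanish_X0.
have hd : shear k (monom 1 k) d by [].
suff e : (b * a = a * b * d)%g.
  suff -> : [~ b, a]%g = d by [].
  by apply: (mulgI (a * b)%g); rewrite -e -commgC.
have sw x v : shear k v x -> star x w = w.
  move=> hx; have := congr1 (star x) wE; rewrite starMF star1F star_affine.
  rewrite (shear_ord0 k0 hx) -/(affine 1) => e.
  transitivity (w * (affine 1 * star x w)); last by rewrite e mulr1.
  by rewrite mulrCA mulrA wE mul1r.
have mE : monom 1 k = X0 * u by rewrite /monom /u /=; ring.
have du : star d u = u.
  rewrite /u starMF (multiplicative_opX _ _ (star_mult d)) star_var (shear_ord0 k0 hd).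
  by rewrite (shear_Xprod _ _ hd) ?leqnn ?orbT // leqW.
have au : star a u = (u + monom 1 k) * w ^+ wt k.
  have aP : star a (Xprod 1 k) = Xprod 1 k * w ^+ (\sum_(1 <= l < k) wt l).
    rewrite /Xprod (multiplicative_op_prod _ _ _ (star_mult a)) expr_sum -big_split.
    rewrite big_nat [RHS]big_nat; apply: eq_bigr => l /andP[_ lk].
    by rewrite /Xn star_var aE inordK // (leq_trans lk) // leqW.
  rewrite {1}/u starMF (multiplicative_opX _ _ (star_mult a)) star_var aE aP mE.
  rewrite -(sum_wt k0) expr1 exprD.
  have -> : u + X0 * u = affine 1 * u by rewrite /affine scale1r mulrDl mul1r.
  set p := \sum_(1 <= l < k) _; have -> : wt 1 = 3%N by [].
  rewrite exprS.
  have -> : affine 1 * u * (w * w ^+ 2 * w ^+ p) = (affine 1 * w) * (u * w ^+ 2 * w ^+ p).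
    by ring.
  by rewrite wE mul1r /u exprMn; ring.
apply: fdiff_eq => i.
have -> : (b * a)%g i = star a (b i) by [].
have -> : (a * b * d)%g i = star d (star b (a i)) by [].
have [_ bE] := hb.
have sX x v : shear k v x -> star x (w ^+ wt i) = w ^+ wt i.
  by move=> hx; rewrite (multiplicative_opX _ _ (star_mult x)) (sw _ _ hx).
rewrite bE aE star_add star_muln star_var aE au !starMF (sX _ _ hb) (sX _ _ hd).
rewrite star_var bE star_add star_muln star_var dE du.
case: eqP => [<-|_]; last by rewrite !mulr0n !addr0.
by rewrite !mulr1n; ring.
Qed.

Lemma derived_shear j k : (0 < j)%N -> (j <= k <= n)%N ->
  exists2 x, derived_series WG j x & shear k (monom j k) x.
Proof.
elim: j k => // -[_ k _ /andP[k0 kn]|j IH k _ /andP[jk kn]].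
  have [w [wE [a [ha la aE]]]] := moebius_in_group.
  have [b [hb gb]] : exists x, shear k (X0 ^+ 2 * Xprod 1 k) x /\ WG x.
    apply: shear_in_group => //; first exact: vanish_X0.
    rewrite -(sum_wt k0); apply: (@wpoly_leq _ _ (2 + \sum_(1 <= l < k) wt l)).
      by rewrite leq_add2r.
    by apply: wpolyM; [exact: wpoly_X0|apply: wpoly_Xprod; rewrite leqW].
  exists [~ b, a]%g; first exact: (@mem_commutator _ WG WG).
  by apply: (commg_moebius wE) => //; rewrite k0.
have [||a ha sa] := IH j.+1 => //; first by rewrite leqnn (leq_trans (ltnW jk)).
have [||b hb sb] := IH k => //; first by rewrite kn ltnW.
exists [~ b, a]%g; first exact: mem_commutator.
by apply: commg_shear => //; rewrite jk.
Qed.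

Lemma fs_var_neq0 i : X i != 0.
Proof.
apply/eqP => /(congr1 (fun f : A => f U_(i)%MM)) /eqP.
by rewrite /fs_var eqxx oner_eq0.
Qed.

Lemma derived_weighted_group : derived_series WG n <> [set 1%g]%classic.
Proof.
move=> e; have one x : derived_series WG n x -> forall i, x i = X i.
  by rewrite e => -> i; rewrite -star_var star1.
have X00 := fs_var_neq0 ord0.
have [n0|n0] := posnP n; last first.
  have [|x /one hx [_ /(_ ord_max)]] := @derived_shear n n n0; first by rewrite leqnn.
  rewrite hx /= eqxx mulr1n /monom /Xprod big_geq // mulr1 -[X in X = _]addr0.
  by move/addrI/esym/eqP; rewrite expf_eq0 (negbTE X00) andbF.
have [w [wE [a [ha _ /(_ ord0)]]]] := moebius_in_group.
have {}ha j : j = 0%N -> derived_series WG j a by move=> ->.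
rewrite (one a (ha n n0)) expr1.
rewrite -[X in X = _]mulr1 => /(mulfI X00) w1; move: wE; rewrite -w1 mulr1.
rewrite /affine scale1r -[X in _ = X]addr0 => /addrI/eqP.
by rewrite (negbTE X00).
Qed.

End Shears.

(** * Convergence *)

Section Majorants.
Variables (K : numFieldType) (n : nat).
Local Notation A := (fseries K n).
Implicit Types (f g : A) (N : nat) (r C : K) (m : 'X_{1..n}).

(** The truncated norm of the Banach algebra of series that converge absolutely on the
closed polydisc of radius [r]. *)
Definition mnorm r N f : K := \sum_(m : 'X_{1..n < N.+1}) `|f m| * r ^+ mdeg m.

Definition majorized r f := exists C, forall N, mnorm r N f <= C.

Section Radius.
Variable r : K.
Hypothesis r0 : 0 <= r.

Let term_ge0 f m : 0 <= `|f m| * r ^+ mdeg m.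
Proof. by rewrite mulr_ge0 ?exprn_ge0. Qed.

Lemma mnorm_ge0 N f : 0 <= mnorm r N f.
Proof. by apply: sumr_ge0. Qed.

Lemma mnormD N f g : mnorm r N (f + g) <= mnorm r N f + mnorm r N g.
Proof.
rewrite -big_split; apply: ler_sum => m _ /=.
by rewrite -mulrDl ler_wpM2r ?exprn_ge0 // ler_normD.
Qed.

Lemma mnormZ N (a : K) f : mnorm r N (a *: f) = `|a| * mnorm r N f.
Proof.
rewrite mulr_sumr; apply: eq_bigr => m _.
by rewrite fsZE normrM mulrA.
Qed.

(** Group together the pairs of monomials with the same product. *)
Lemma mnormM N f g : mnorm r N (f * g) <= mnorm r N f * mnorm r N g.
Proof.
pose D := 'X_{1..n < N.+1}.
pose T (h : D * D) : K := (`|f h.1| * r ^+ mdeg h.1) * (`|g h.2| * r ^+ mdeg h.2).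
have T0 h : 0 <= T h by rewrite mulr_ge0.
have -> : mnorm r N f * mnorm r N g = \sum_(h : D * D) T h.
  rewrite -(pair_bigA _ (fun a b : D => T (a, b))) mulr_suml; apply: eq_bigr => a _.
  by rewrite mulr_sumr.
apply: (@le_trans _ _ (\sum_(m : D) \sum_(h : D * D | (m : 'X_{1..n}) == (h.1 + h.2)%MM) T h)).
  apply: ler_sum => m _.
  have -> : (f * g) m = \sum_(h : D * D | (m : 'X_{1..n}) == (h.1 + h.2)%MM) f h.1 * g h.2.
    have mN : (mdeg m <= N)%N by have := bmdeg m; rewrite ltnS.
    have := approxM (@fs_truncK _ _ N f) (@fs_truncK _ _ N g) mN => <-.
    rewrite (mcoeff_poly_mul _ _ (k := N.+1)) ?ltnS //.
    apply: eq_bigr => h _; rewrite !fs_truncK //; last by have := bmdeg h.1; rewrite ltnS.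
    by have := bmdeg h.2; rewrite ltnS.
  apply: (@le_trans _ _ (\sum_(h : D * D | (m : 'X_{1..n}) == (h.1 + h.2)%MM)
      `|f h.1 * g h.2| * r ^+ mdeg m)).
    by rewrite -mulr_suml ler_wpM2r ?exprn_ge0 // ler_norm_sum.
  apply: ler_sum => h /eqP ->; rewrite mdegD exprD normrM /T.
  by rewrite mulrACA.
rewrite (exchange_big_dep xpredT) //=; apply: ler_sum => h _ /=.
have [/existsP[m /eqP mE]|] := boolP [exists m : D, (m : 'X_{1..n}) == (h.1 + h.2)%MM].
  rewrite (big_pred1 m) // => m' /=; rewrite -mE; apply/eqP/eqP => [e|->//].
  exact: val_inj.
rewrite negb_exists => /forallP none; rewrite big_pred0 // => m.
exact: negbTE.
Qed.

Lemma majorizedD f g : majorized r f -> majorized r g -> majorized r (f + g).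
Proof.
move=> [C hC] [D hD]; exists (C + D) => N; apply: le_trans (mnormD _ _ _) _.
by apply: lerD.
Qed.

Lemma majorizedZ (a : K) f : majorized r f -> majorized r (a *: f).
Proof.
by move=> [C hC]; exists (`|a| * C) => N; rewrite mnormZ ler_wpM2l.
Qed.

Lemma mnorm_monomial N m : mnorm r N (fs_of_mpoly 'X_[m]) <= r ^+ mdeg m.
Proof.
rewrite /mnorm /fs_of_mpoly; have [mN|Nm] := ltnP (mdeg m) N.+1.
  rewrite (bigD1 (BMultinom mN)) //= mcoeffX eqxx normr1 mul1r big1 ?addr0 // => a am.
  rewrite mcoeffX; case: eqP => [e|_]; last by rewrite normr0 mul0r.
  by case/eqP: am; apply: val_inj.
rewrite big1 ?exprn_ge0 // => a _; rewrite mcoeffX; case: eqP => [e|_].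
  by have := leq_trans (bmdeg a) Nm; rewrite -e ltnn.
by rewrite normr0 mul0r.
Qed.

Lemma majorized_mpoly (p : {mpoly K[n]}) : majorized r (fs_of_mpoly p).
Proof.
rewrite (mpolyE p) linear_sum; elim/big_ind: _ => [||m _].
- exists 0 => N; rewrite /mnorm big1 // => m _.
  by rewrite fs0E normr0 mul0r.
- exact: majorizedD.
rewrite linearZ; apply: majorizedZ; exists (r ^+ mdeg m) => N; exact: mnorm_monomial.
Qed.

(** Multiplication by [a x_i] has norm at most one half, so that the factor is invertible. *)
Lemma majorized_div (i : 'I_n) (a : K) f : `|a| * r <= 2%:R^-1 ->
  majorized r ((1 + a *: fs_var K i) * f) -> majorized r f.
Proof.
move=> ar [C hC]; exists (2%:R * C) => N; have := hC N; set g := _ * f => hg.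
have fE : f = g + (- a) *: (fs_var K i * f).
  by rewrite /g mulrDl mul1r scaleNr scalerAl addrK.
have h : mnorm r N f <= C + 2%:R^-1 * mnorm r N f.
  rewrite {1}fE; apply: le_trans (mnormD _ _ _) _; apply: lerD => //.
  rewrite mnormZ normrN; apply: le_trans (ler_wpM2l (normr_ge0 _) (mnormM _ _ _)) _.
  rewrite mulrA ler_wpM2r ?mnorm_ge0 //; apply: le_trans ar.
  rewrite ler_wpM2l // -fs_of_mpolyX; apply: le_trans (mnorm_monomial _ _) _.
  by rewrite mdeg1 expr1.
have e : mnorm r N f = 2%:R * (mnorm r N f - 2%:R^-1 * mnorm r N f) by field.
by rewrite e ler_pM2l ?ltr0n // lerBlDr.
Qed.

End Radius.
End Majorants.

Section Convergence.
Variables (R : realType) (n : nat).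
Local Notation K := R[i]%C.

Lemma majorized_convergent (r : R) (f : fseries K n) : 0 < r ->
  majorized r%:C%C f -> convergent_fseries f.
Proof.
move=> r0 [C hC]; exists r => // z zr.
pose F m := Normc.normc (f m * \prod_i z i ^+ m i).
have F0 m : 0 <= F m by rewrite /F; case: (f m * _) => a b; rewrite sqrtr_ge0.
have FN N : \sum_(m : 'X_{1..n < N.+1}) F m <= complex.Re C.
  have h : (\sum_(m : 'X_{1..n < N.+1}) F m)%:C%C <= C.
    apply: le_trans (hC N); rewrite rmorph_sum; apply: ler_sum => m _ /=.
    rewrite -[_%:C%C]/(`|f m * \prod_i z i ^+ m i|) normrM ler_wpM2l //.
    rewrite normr_prod mdegE expr_sum; apply: ler_prod => i _.
    rewrite normrX exprn_ge0 //= lerXn2r ?nnegrE //.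
      by rewrite lecR ltW.
    exact/ltW/zr.
  by have := h; rewrite lecE /= => /andP[].
rewrite /summable; apply: (@le_lt_trans _ _ (complex.Re C)%:E); last exact: ltry.
apply: ge_ereal_sup => _ [S [fS _] <-].
rewrite fsbig_finite //.
rewrite (eq_bigr (fun m => (F m)%:E)) => [|m _]; last by rewrite /= ger0_norm ?F0.
rewrite sumEFin lee_fin; set s := enum_fset (fset_set S).
pose N := \max_(m <- s) mdeg m.
apply: le_trans (FN N).
have -> : \sum_(m <- s) F m = \sum_(m : 'X_{1..n < N.+1} | (m : 'X_{1..n}) \in s) F m.
  rewrite -[RHS]big_filter.
  rewrite -(big_map (fun m : 'X_{1..n < N.+1} => m : 'X_{1..n}) xpredT F).
  apply: perm_big; apply: uniq_perm; first exact: fset_uniq.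
    by rewrite map_inj_uniq ?filter_uniq ?index_enum_uniq // => a b; exact: val_inj.
  move=> m; apply/idP/mapP => [ms|[m' + ->]]; last by rewrite mem_filter => /andP[].
  have mN : (mdeg m < N.+1)%N by rewrite ltnS /N; exact: (@leq_bigmax_seq _ s xpredT mdeg).
  by exists (BMultinom mN); rewrite // mem_filter mem_index_enum andbT.
by rewrite [leRHS](bigID (fun m : 'X_{1..n < N.+1} => (m : 'X_{1..n}) \in s)) /= lerDl sumr_ge0.
Qed.

End Convergence.

Section Example.
Variables (R : realType) (n : nat).
Local Notation K := R[i]%C.

Lemma weighted_group_convergent :
  (@weighted_group K n `<=` @convergent_fdiff R n.+1)%classic.
Proof.
move=> x [_ [a hx]] k; pose r : R := (2 * (Normc.normc a + 1))^-1.
have a0 : 0 <= Normc.normc a by case: a {hx r} => b c; rewrite sqrtr_ge0.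
have r0 : 0 < r by rewrite invr_gt0 mulr_gt0 // ltr_wpDl.
apply: (majorized_convergent r0).
have rK : 0 <= r%:C%C :> K by rewrite lecR ltW.
have ar : `|a| * r%:C%C <= 2%:R^-1 :> K.
  have -> : `|a| = (Normc.normc a)%:C%C by [].
  rewrite -rmorphM /= -[2%:R](rmorph_nat (real_complex R)) -fmorphV /= lecR.
  rewrite /r invfM mulrCA ler_piMr ?invr_ge0 ?ler0n //.
  by rewrite ler_pdivrMr ?mul1r ?lerDl // ltr_wpDl.
have : majorized r%:C%C (@affine _ n a ^+ wt k * x k).
  by rewrite (wpoly_trunc (hx k)); apply: majorized_mpoly.
elim: (wt k) => [|j IH]; first by rewrite expr0 mul1r.
by rewrite exprS -mulrA => /(majorized_div rK ar).
Qed.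

End Example.

Local Close Scope ring_scope.
Local Open Scope classical_set_scope.

Theorem theorem1p5 (R : realType) (n : nat) (n_ge1 : (1 <= n)%N) :
  (forall G : set (fdiff R[i] n), subgroup G -> nilpotent G ->
     exists2 l : nat, soluble_length G = Some l & (l <= n)%N) /\
  (exists G : set (fdiff R[i] n),
     [/\ subgroup G,
         G `<=` @convergent_fdiff R n,
         forall F, G F -> unipotent F,
         nilpotent G
       & soluble_length G = Some n]).
Proof.
split=> [G gG [c nilG]|].
  exact: (soluble_length_leP (derived_length_leq gG nilG n_ge1)).
case: n n_ge1 => // n _; have gW := @weighted_group_subgroup R[i]%C n.
have nW := @weighted_group_nilpotent R[i]%C n.
exists (@weighted_group R[i]%C n); split=> //.
- exact: weighted_group_convergent.
- move=> F [lF _]; exists 1%N; rewrite GRing.expr1.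
  by apply/eqP; rewrite GRing.subr_eq0; apply/eqP.
have [c nilW] := nW; apply: soluble_length_eq => [|k kn].
  exact: (derived_length_leq gW nilW (ltn0Sn n)).
by move=> e; apply: (@derived_weighted_group _ n); apply: (derived_trivial_leq _ e); rewrite -ltnS.
Qed.
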